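(* The property of being a reproducing pair does not imply that either of the two mappings is Bessel. Concretely, for $\omega\in\mathbb R$ let $\beta(\omega):=(1+|\omega|)^{-1}$, let $A:=[-1,1]$, and let $\psi,\varphi\in L^2(\mathbb R)$ be given by $\hat\psi(\xi)=(1+\xi)\chi_A(\xi)$ and $\hat\varphi(\xi)=(1-\xi)\chi_A(\xi)$. On $\mathbb R^2$ with Lebesgue measure $dx\,d\omega$ define $$\Psi(x,\omega):=M_{\omega}T_xD_{\beta(\omega)}\psi,\qquad \Phi(x,\omega):=M_{\omega}T_xD_{\beta(\omega)}\varphi .$$ Then $(\Psi,\Phi)$ is a reproducing pair for $L^2(\mathbb R)$, but neither $\Psi$ nor $\Phi$ is Bessel.
   Context: For $f\in L^2(\mathbb R)$: $T_xf(t)=f(t-x)$, $M_\omega f(t)=e^{2\pi i\omega t}f(t)$, $D_af(t)=|a|^{-1/2}f(t/a)$, and $\hat f(\xi)=\int_{\mathbb R}f(t)e^{-2\pi i t\xi}\,dt$ (extended unitarily to $L^2(\mathbb R)$). $\chi_A$ is the indicator function of $A$. Inner products are linear in the first argument. A weakly measurable map $\Psi$ from a measure space $X$ to a Hilbert space $\mathcal H$ is Bessel if there is $B>0$ with $\int_X|\langle f,\Psi\rangle|^2\le B\|f\|^2$ for all $f\in\mathcal H$. A pair $(\Psi,\Phi)$ of weakly measurable maps $X\to\mathcal H$ is a reproducing pair for $\mathcal H$ if the resolution operator $S_{\Psi,\Phi}f:=\int_X\langle f,\Psi\rangle\Phi$ (defined weakly) is a bounded linear operator on $\mathcal H$ with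 bounded inverse defined on all of $\mathcal H$. In the present setting ''weakly'' means that $S_{\Psi,\Phi}$ is the bounded operator on $L^2(\mathbb R)$ determined by $$\langle S_{\Psi,\Phi}f_1,f_2\rangle=\int_{\mathbb R}\Big(\int_{\mathbb R}\langle f_1,\Psi(x,\omega)\rangle\overline{\langle f_2,\Phi(x,\omega)\rangle}\,dx\Big)d\omega$$ for all $f_1,f_2\in L^1(\mathbb R)\cap L^2(\mathbb R)$, extended by density. *)

(* Defs.v *)
From HB Require Import structures.
From mathcomp Require Import all_boot all_order all_algebra.
From mathcomp Require Import all_classical all_reals all_analysis.
From mathcomp Require Import complex.

Set Implicit Arguments.
Unset Strict Implicit.
Unset Printing Implicit Defensive.

Import Order.TTheory GRing.Theory Num.Theory.
Import numFieldNormedType.Exports.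

Local Open Scope classical_set_scope.
Local Open Scope ring_scope.
Local Open Scope complex_scope.

Section ComplexIntegral.
Context {R : realType} {d : measure_display} {T : measurableType d}.
Implicit Type f : T -> R[i].

Definition cmeasurable f : Prop :=
  measurable_fun setT (fun t => complex.Re (f t)) /\
  measurable_fun setT (fun t => complex.Im (f t)).

Definition cintegrable (mu : {measure set T -> \bar R}) f : Prop :=
  mu.-integrable setT (fun t => (complex.Re (f t))%:E) /\
  mu.-integrable setT (fun t => (complex.Im (f t))%:E).

(* Meaningful when [cintegrable mu f]. *)
Definition cintegral (mu : {measure set T -> \bar R}) f : R[i] :=
  Rintegral mu setT (fun t => complex.Re (f t)) +i*
  Rintegral mu setT (fun t => complex.Im (f t)).

End ComplexIntegral.

(* L^2(R) is represented by square-integrable functions R -> C; functions that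
   agree almost everywhere represent the same vector. *)
Section L2.
Context {R : realType}.
Local Notation leb := (@lebesgue_measure R).
Implicit Types f g : R -> R[i].

Definition L1 f : Prop := cintegrable leb f.

Definition L2norm f : \bar R := 'N[leb]_2%:E[EFin \o (@Normc.normc R \o f)].

Definition L2 f : Prop := cmeasurable f /\ (L2norm f < +oo)%E.

Definition inner f g : R[i] := cintegral leb (fun t => f t * conjc (g t)).

Definition expi (theta : R) : R[i] := cos theta +i* sin theta.

Definition translation (x : R) f : R -> R[i] := fun t => f (t - x).

Definition modulation (w : R) f : R -> R[i] :=
  fun t => expi (2 * pi * w * t) * f t.

Definition dilation (a : R) f : R -> R[i] :=
  fun t => (`|a| `^ (- 2^-1))%:C * f (t / a).

Definition fourier f : R -> R[i] :=
  fun xi => cintegral leb (fun t => f t * expi (- (2 * pi * t * xi))).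

(* [g] represents the Fourier transform of [f] in L^2(R): the graph of the
   unitary extension is the closure in L^2 x L^2 of the graph of [fourier] on
   the intersection of L^1 and L^2. *)
Definition fourierL2 f g : Prop :=
  [/\ L2 f, L2 g &
    exists f_ : nat -> R -> R[i],
      [/\ forall n, L1 (f_ n) /\ L2 (f_ n),
          L2norm (fun t => f_ n t - f t) @[n --> \oo] --> 0%E &
          L2norm (fun xi => fourier (f_ n) xi - g xi) @[n --> \oo] --> 0%E]].

(* The second clause makes [S] act on almost-everywhere classes. *)
Definition bounded_linear_L2 (S : (R -> R[i]) -> (R -> R[i])) : Prop :=
  [/\ forall f, L2 f -> L2 (S f),
      forall f g, L2 f -> L2 g -> f = g %[ae leb] -> S f = S g %[ae leb],
      forall (a : R[i]) f g, L2 f -> L2 g ->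
        S (fun t => a * f t + g t) = (fun t => a * S f t + S g t) %[ae leb] &
      exists C : R, forall f, L2 f -> (L2norm (S f) <= C%:E * L2norm f)%E].

Definition boundedly_invertible_L2 (S : (R -> R[i]) -> (R -> R[i])) : Prop :=
  bounded_linear_L2 S /\
  exists T : (R -> R[i]) -> (R -> R[i]),
    bounded_linear_L2 T /\
    forall f, L2 f -> T (S f) = f %[ae leb] /\ S (T f) = f %[ae leb].

Definition weakly_measurable {d} {X : measurableType d}
    (Psi : X -> R -> R[i]) : Prop :=
  (forall x, L2 (Psi x)) /\
  forall f, L2 f -> cmeasurable (fun x => inner f (Psi x)).

Definition bessel {d} {X : measurableType d} (mu : {measure set X -> \bar R})
    (Psi : X -> R -> R[i]) : Prop :=
  weakly_measurable Psi /\
  exists B : R, 0 < B /\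
    forall f, L2 f ->
      (\int[mu]_x ((Normc.normc (inner f (Psi x))) ^+ 2)%:E
         <= B%:E * L2norm f ^+ 2)%E.

(* [S] is the operator weakly defined by the iterated integral (dx first, then
   dw); the existence of the integrals is part of the requirement. *)
Definition resolution_operator (Psi Phi : R * R -> R -> R[i])
    (S : (R -> R[i]) -> (R -> R[i])) : Prop :=
  bounded_linear_L2 S /\
  forall f1 f2, L1 f1 -> L2 f1 -> L1 f2 -> L2 f2 ->
    let F w x := inner f1 (Psi (x, w)) * conjc (inner f2 (Phi (x, w))) in
    [/\ {ae leb, forall w, cintegrable leb (F w)},
        cintegrable leb (fun w => cintegral leb (F w)) &
        inner (S f1) f2 = cintegral leb (fun w => cintegral leb (F w))].

Definition reproducing_pair (Psi Phi : R * R -> R -> R[i]) : Prop :=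
  [/\ weakly_measurable Psi, weakly_measurable Phi &
    exists S, resolution_operator Psi Phi S /\ boundedly_invertible_L2 S].

Definition beta (w : R) : R := (1 + `|w|)^-1.

(* M_w T_x D_(beta w) psi at the point p = (x, w). *)
Definition system (psi : R -> R[i]) (p : R * R) : R -> R[i] :=
  modulation p.2 (translation p.1 (dilation (beta p.2) psi)).

Definition psi_hat (xi : R) : R[i] := ((1 + xi) * \1_`[-1, 1] xi)%:C.

Definition phi_hat (xi : R) : R[i] := ((1 - xi) * \1_`[-1, 1] xi)%:C.

End L2.

(* Main.v *)
Require Import Defs.
From HB Require Import structures.
From mathcomp Require Import all_boot all_order all_algebra.
From mathcomp Require Import all_classical all_reals all_analysis.
From mathcomp Require Import measurable_realfun complex ring lra.

(** On the Fourier side [Psi (x, w)] is [beta w ^ 1/2] times a character in [x]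
    times the bump [xi |-> psi_hat (beta w * (xi - w))].  Hence, up to a phase and
    a conjugation, [x |-> <f, Psi (x, w)>] is the Fourier transform of the slice of
    [f_hat] cut out by this bump, and Plancherel in [x] followed by Fubini turns the
    resolution operator into the Fourier multiplier with symbol
    [m(xi) = int beta(w) (1 - y^2) 1_[-1,1](y) dw], [y = beta(w) (xi - w)].
    For [w >= 0] one has [y = (1 + xi) / (1 + w) - 1], so the integrand is comparable
    to [(1 + xi) / (1 + w)^2] for [(1 + xi) / (1 + w) <= 2]; negative [w] are the same
    with [xi] replaced by [- xi].  This gives [1 <= m <= 8], and the multiplier is
    inverted by the multiplier [1 / m].
    For [Psi] alone the factor [1 - y^2] is replaced by [(1 + y)^2], which stays above
    [1] for all large negative [w] (and [(1 - y)^2] for [Phi] at large positive [w]),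
    so the energy of a unit indicator dominates the divergent integral of [beta].

    Plancherel on [L^1] and [L^2] is obtained by Abel summation: damping
    [|f_hat|^2] by [exp (- a |xi|)] yields [|f|^2] minus half of the Poisson average
    of [||f(. + u) - f||^2], which vanishes as [a -> 0] by continuity of translations.
    The transform extended to [L^2] is onto because its adjoint is the conjugated
    transform. *)

Set Implicit Arguments.
Unset Strict Implicit.
Unset Printing Implicit Defensive.

Import Order.TTheory GRing.Theory Num.Theory.
Import numFieldNormedType.Exports.

Local Open Scope classical_set_scope.
Local Open Scope ring_scope.
Local Open Scope complex_scope.

(** * Complex-valued functions and their integrals *)

(** What keeps the symbol finite is a cancellation at the endpoints of the band. As [w] tends to
    [+oo] the argument [y] tends to [- 1] with [1 + y] of order [beta w], and as [w] tends to [-oo]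
    it tends to [1] with [1 - y] of order [beta w]. So [beta w] times the product of the two
    profiles decays like [beta w ^ 2] at both ends, whereas each squared profile tends to [4] at one
    end and leaves the non-integrable [beta w] there.

    Since neither system has bounded energy, Cauchy-Schwarz gives no joint integrability in [(x, w)]
    of the product of the two coefficients. The order of integration is therefore respected: at
    fixed [w] the slices are in L2 and Plancherel acts in [x]; Fubini is applied only in [(w, xi)],
    where the kernel is nonnegative with mass at most [8] in [w].

    Fourier inversion is never proved. Surjectivity of the transform on L2 takes its place: it
    provides [psi] and [phi], the multipliers, and the test functions that refute the Bessel
    bounds. *)

Section ComplexAlgebra.
Context {R : realType}.
Implicit Types x y : R[i].
Local Notation normc := (@Normc.normc R).

Lemma cReD x y : complex.Re (x + y) = complex.Re x + complex.Re y.
Proof. by case: x; case: y. Qed.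

Lemma cImD x y : complex.Im (x + y) = complex.Im x + complex.Im y.
Proof. by case: x; case: y. Qed.

Lemma cReN x : complex.Re (- x) = - complex.Re x.
Proof. by case: x. Qed.

Lemma cImN x : complex.Im (- x) = - complex.Im x.
Proof. by case: x. Qed.

Lemma cReM x y : complex.Re (x * y) =
  complex.Re x * complex.Re y - complex.Im x * complex.Im y.
Proof. by case: x; case: y. Qed.

Lemma cImM x y : complex.Im (x * y) =
  complex.Re x * complex.Im y + complex.Im x * complex.Re y.
Proof. by case: x; case: y. Qed.

Lemma cReJ x : complex.Re (conjc x) = complex.Re x.
Proof. by case: x. Qed.

Lemma cImJ x : complex.Im (conjc x) = - complex.Im x.
Proof. by case: x. Qed.

Definition cE := (cReD, cImD, cReN, cImN, cReM, cImM, cReJ, cImJ).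

Lemma complex_ext x y :
  complex.Re x = complex.Re y -> complex.Im x = complex.Im y -> x = y.
Proof. by case: x => a b; case: y => c d /= -> ->. Qed.

Lemma normc_sqr x : normc x ^+ 2 = complex.Re x ^+ 2 + complex.Im x ^+ 2.
Proof. by case: x => a b /=; rewrite sqr_sqrtr// addr_ge0// sqr_ge0. Qed.

Lemma normc_ge0 x : 0 <= normc x.
Proof. by case: x => a b; exact: sqrtr_ge0. Qed.

Lemma normc_conj x : normc (conjc x) = normc x.
Proof. by case: x => a b /=; rewrite sqrrN. Qed.

Lemma normc_real (a : R) : normc a%:C = `|a|.
Proof. by rewrite /= expr0n/= addr0 sqrtr_sqr. Qed.

Lemma normc_Re x : `|complex.Re x| <= normc x.
Proof.
rewrite -(ler_pXn2r (ltn0Sn 1)) ?nnegrE ?normc_ge0//.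
by rewrite normc_sqr real_normK ?num_real// lerDl sqr_ge0.
Qed.

Lemma normc_Im x : `|complex.Im x| <= normc x.
Proof.
rewrite -(ler_pXn2r (ltn0Sn 1)) ?nnegrE ?normc_ge0//.
by rewrite normc_sqr real_normK ?num_real// lerDr sqr_ge0.
Qed.

Lemma normc_le_ReIm x : normc x <= `|complex.Re x| + `|complex.Im x|.
Proof.
rewrite -(ler_pXn2r (ltn0Sn 1)) ?nnegrE ?normc_ge0 ?addr_ge0//.
rewrite normc_sqr sqrrD !real_normK ?num_real// -addrA lerD2l lerDr.
by rewrite mulrn_wge0// mulr_ge0.
Qed.

(** By the parallelogram law the defect is [normc (x - y) ^+ 2]. This bound stands in for the
    triangle inequality in L2 and keeps the estimates free of square roots. *)
Lemma normc_sqrD x y : normc (x + y) ^+ 2 <= 2 * normc x ^+ 2 + 2 * normc y ^+ 2.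
Proof.
rewrite !normc_sqr !cE -subr_ge0; set a := complex.Re x; set b := complex.Im x.
set c := complex.Re y; set e := complex.Im y.
suff -> : 2 * (a ^+ 2 + b ^+ 2) + 2 * (c ^+ 2 + e ^+ 2) -
  ((a + c) ^+ 2 + (b + e) ^+ 2) = (a - c) ^+ 2 + (b - e) ^+ 2.
  by rewrite addr_ge0 ?sqr_ge0.
by ring.
Qed.

Lemma conjcD x y : conjc (x + y) = conjc x + conjc y.
Proof. exact: rmorphD. Qed.

Lemma conjcB x y : conjc (x - y) = conjc x - conjc y.
Proof. exact: rmorphB. Qed.

Lemma conjcM x y : conjc (x * y) = conjc x * conjc y.
Proof. exact: rmorphM. Qed.

Lemma ler_normcD x y : normc (x + y) <= normc x + normc y.
Proof. exact: le_normcD. Qed.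

Lemma normc_opp x : normc (- x) = normc x.
Proof. exact: normcN. Qed.

Lemma mul_conjc x : x * conjc x = (normc x ^+ 2)%:C.
Proof.
by apply: complex_ext; rewrite ?normc_sqr !cE/=; ring.
Qed.

Lemma expiD (a b : R) : expi (a + b) = expi a * expi b.
Proof. by apply: complex_ext; rewrite !cE/= ?cosD ?sinD//; ring. Qed.

Lemma expiN (a : R) : expi (- a) = conjc (expi a).
Proof. by apply: complex_ext; rewrite !cE/= ?cosN ?sinN. Qed.

Lemma expi0 : expi 0 = 1 :> R[i].
Proof. by rewrite /expi cos0 sin0. Qed.

Lemma normc_expi (a : R) : normc (expi a) = 1.
Proof. by rewrite /= cos2Dsin2 sqrtr1. Qed.

End ComplexAlgebra.

Section ComplexMeasurable.
Context {R : realType} {d : measure_display} {T : measurableType d}.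
Implicit Types f g : T -> R[i].

Lemma cmeasurableD f g : cmeasurable f -> cmeasurable g ->
  cmeasurable (fun t => f t + g t).
Proof.
move=> [mf1 mf2] [mg1 mg2]; split; under eq_fun do rewrite cE;
by apply: measurable_funD.
Qed.

Lemma cmeasurableN f : cmeasurable f -> cmeasurable (fun t => - f t).
Proof.
move=> [mf1 mf2]; split; under eq_fun do rewrite cE;
by apply: measurableT_comp.
Qed.

Lemma cmeasurableB f g : cmeasurable f -> cmeasurable g ->
  cmeasurable (fun t => f t - g t).
Proof. by move=> mf mg; apply: cmeasurableD => //; exact: cmeasurableN. Qed.

Lemma cmeasurableM f g : cmeasurable f -> cmeasurable g ->
  cmeasurable (fun t => f t * g t).
Proof.
move=> [mf1 mf2] [mg1 mg2]; split; under eq_fun do rewrite cE.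
  by apply: measurable_funB; apply: measurable_funM.
by apply: measurable_funD; apply: measurable_funM.
Qed.

Lemma cmeasurable_conj f : cmeasurable f -> cmeasurable (fun t => conjc (f t)).
Proof.
move=> [mf1 mf2]; split; under eq_fun do rewrite cE; first by [].
by apply: measurableT_comp.
Qed.

Lemma cmeasurable_cst (a : R[i]) : cmeasurable (fun _ : T => a).
Proof. by split. Qed.

Lemma cmeasurable_real (u : T -> R) : measurable_fun setT u ->
  cmeasurable (fun t => (u t)%:C).
Proof. by split. Qed.

Lemma cmeasurable_expi (u : T -> R) : measurable_fun setT u ->
  cmeasurable (fun t => expi (u t)).
Proof.
move=> mu; split => /=.
- apply: (@measurableT_comp _ _ _ _ _ _ (@cos R)); last exact: mu.
  by apply: continuous_measurable_fun; exact: continuous_cos.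
- apply: (@measurableT_comp _ _ _ _ _ _ (@sin R)); last exact: mu.
  by apply: continuous_measurable_fun; exact: continuous_sin.
Qed.

Lemma measurable_normc_sqr f : cmeasurable f ->
  measurable_fun setT (fun t => Normc.normc (f t) ^+ 2).
Proof.
move=> [mf1 mf2]; under eq_fun do rewrite normc_sqr.
exact: measurable_funD (measurable_funX 2 mf1) (measurable_funX 2 mf2).
Qed.

Lemma measurable_normc f : cmeasurable f ->
  measurable_fun setT (fun t => Normc.normc (f t)).
Proof.
move=> mf; have -> : (fun t => Normc.normc (f t)) =
    (fun t => Num.sqrt (Normc.normc (f t) ^+ 2)).
  by apply/funext => t; rewrite sqrtr_sqr ger0_norm// normc_ge0.
apply: (@measurableT_comp _ _ _ _ _ _ (@Num.sqrt R)).
  by apply: continuous_measurable_fun; exact: sqrt_continuous.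
exact: measurable_normc_sqr.
Qed.

Lemma cmeasurable_comp {d'} {S : measurableType d'} (h : S -> T) f :
  measurable_fun setT h -> cmeasurable f -> cmeasurable (fun t => f (h t)).
Proof. by move=> mh [mf1 mf2]; split;
  [exact: (measurableT_comp mf1 mh)|exact: (measurableT_comp mf2 mh)]. Qed.

End ComplexMeasurable.

Section ComplexIntegrable.
Context {R : realType} {d : measure_display} {T : measurableType d}.
Variable mu : {measure set T -> \bar R}.
Implicit Types f g : T -> R[i].

Lemma cintegrable_measurable f : cintegrable mu f -> cmeasurable f.
Proof.
by move=> [/measurable_int/measurable_EFinP ? /measurable_int/measurable_EFinP ?];
  split.
Qed.

Lemma cintegrable_le f (u : T -> R) : cmeasurable f ->
  mu.-integrable setT (EFin \o u) -> (forall t, Normc.normc (f t) <= u t) ->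
  cintegrable mu f.
Proof.
move=> [mf1 mf2] iu fu; split.
- apply: (le_integrable measurableT _ _ iu); first exact/measurable_EFinP.
  move=> t _ /=; rewrite lee_fin (le_trans (normc_Re _))//.
  by rewrite (le_trans (fu t))// ler_norm.
- apply: (le_integrable measurableT _ _ iu); first exact/measurable_EFinP.
  move=> t _ /=; rewrite lee_fin (le_trans (normc_Im _))//.
  by rewrite (le_trans (fu t))// ler_norm.
Qed.

Lemma cintegrable_normc f : cintegrable mu f ->
  mu.-integrable setT (EFin \o (fun t => Normc.normc (f t))).
Proof.
move=> fi; have [/integrable_abse i1 /integrable_abse i2] := fi.
apply: (le_integrable measurableT _ _ (integrableD measurableT i1 i2)).
  exact/measurable_EFinP/measurable_normc/cintegrable_measurable.
move=> t _ /=; rewrite lee_fin ger0_norm ?normc_ge0//.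
by rewrite (ger0_norm (addr_ge0 _ _))// normc_le_ReIm.
Qed.

Lemma cintegrableP f : cintegrable mu f <->
  cmeasurable f /\ (\int[mu]_t (Normc.normc (f t))%:E < +oo)%E.
Proof.
split.
  move=> fi; split; first exact: cintegrable_measurable.
  have /integrableP[_] := cintegrable_normc fi.
  by under eq_integral => t _ do rewrite /= ger0_norm ?normc_ge0//.
move=> [mf fi]; apply: (@cintegrable_le _ (fun t => Normc.normc (f t))) => //.
apply/integrableP; split; first exact/measurable_EFinP/measurable_normc.
by under eq_integral => t _ do rewrite /= ger0_norm ?normc_ge0//.
Qed.

Lemma cintegrableD f g : cintegrable mu f -> cintegrable mu g ->
  cintegrable mu (fun t => f t + g t).
Proof.
move=> [f1 f2] [g1 g2]; split; under eq_fun do rewrite cE EFinD;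
exact: integrableD.
Qed.

Lemma cintegrableZ a f : cintegrable mu f -> cintegrable mu (fun t => a * f t).
Proof.
move=> fi; apply: (@cintegrable_le _ (fun t => Normc.normc a * Normc.normc (f t))).
- apply: cmeasurableM; first exact: cmeasurable_cst.
  exact: cintegrable_measurable fi.
- under [X in integrable _ _ X]eq_fun do rewrite /= EFinM.
  exact/integrableZl/cintegrable_normc.
- by move=> t; rewrite Normc.normcM.
Qed.

Lemma cintegrable_conj f : cintegrable mu f -> cintegrable mu (fun t => conjc (f t)).
Proof.
move=> [f1 f2]; split; under eq_fun do rewrite cE; first by [].
by under eq_fun do rewrite EFinN; exact: integrableN.
Qed.

Lemma cintegralD f g : cintegrable mu f -> cintegrable mu g ->
  cintegral mu (fun t => f t + g t) = cintegral mu f + cintegral mu g.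
Proof.
move=> [f1 f2] [g1 g2]; apply: complex_ext => /=.
- by rewrite -RintegralD//; apply: eq_Rintegral => t _; rewrite cE.
- by rewrite -RintegralD//; apply: eq_Rintegral => t _; rewrite cE.
Qed.

Lemma cintegralZ a f : cintegrable mu f ->
  cintegral mu (fun t => a * f t) = a * cintegral mu f.
Proof.
move=> [f1 f2]; apply: complex_ext; rewrite !cE/=.
- rewrite -!RintegralZl// -RintegralB//.
  + by apply: eq_Rintegral => t _; rewrite cE.
  + by under [X in integrable _ _ X]eq_fun do rewrite /= EFinM; exact: integrableZl.
  + by under [X in integrable _ _ X]eq_fun do rewrite /= EFinM; exact: integrableZl.
- rewrite -!RintegralZl// -RintegralD//.
  + by apply: eq_Rintegral => t _; rewrite cE.
  + by under [X in integrable _ _ X]eq_fun do rewrite /= EFinM; exact: integrableZl.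
  + by under [X in integrable _ _ X]eq_fun do rewrite /= EFinM; exact: integrableZl.
Qed.

Lemma cintegral_conj f : cintegrable mu f ->
  cintegral mu (fun t => conjc (f t)) = conjc (cintegral mu f).
Proof.
move=> [f1 f2]; apply: complex_ext; rewrite !cE/=.
  by apply: eq_Rintegral => t _; rewrite cE.
rewrite -mulN1r -RintegralZl//; apply: eq_Rintegral => t _.
by rewrite cE mulN1r.
Qed.

Lemma normc_cintegral f : cintegrable mu f ->
  Normc.normc (cintegral mu f) <= \int[mu]_t Normc.normc (f t).
Proof.
move=> fi; set z := cintegral mu f.
have [->|z0] := eqVneq z 0.
  by rewrite Normc.normc0; apply: Rintegral_ge0 => t _; exact: normc_ge0.
have nz : 0 < Normc.normc z.
  by rewrite lt_neqAle normc_ge0 andbT eq_sym; apply: contra z0 => /eqP/Normc.eq0_normc ->.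
rewrite -(ler_pM2l nz) -expr2.
(* Rotating the integrand by [conjc z] makes the integral real, which reduces the claim to
   monotonicity of the real integral. *)
have -> : Normc.normc z ^+ 2 = complex.Re (cintegral mu (fun t => conjc z * f t)).
  by rewrite cintegralZ// mulrC mul_conjc.
clearbody z; rewrite -RintegralZl//; last exact: cintegrable_normc.
apply: le_Rintegral => //.
- by case: (cintegrableZ (conjc z) fi).
- under [X in integrable _ _ X]eq_fun do rewrite /= EFinM.
  exact/integrableZl/cintegrable_normc.
- move=> t _; rewrite (le_trans (ler_norm _))// (le_trans (normc_Re _))//.
  by rewrite Normc.normcM normc_conj.
Qed.

Lemma eq_cintegral f g : (forall t, f t = g t) -> cintegral mu f = cintegral mu g.
Proof. by move=> fg; congr cintegral; apply/funext. Qed.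

Lemma eq_cintegrable f g : (forall t, f t = g t) -> cintegrable mu f -> cintegrable mu g.
Proof. by move=> /funext ->. Qed.

Lemma cintegral_Re_ge0 (u : T -> R) : cintegral mu (fun t => (u t)%:C) =
  (\int[mu]_t u t)%:C.
Proof. by apply: complex_ext => //=; rewrite /Rintegral integral0. Qed.

End ComplexIntegrable.

(** * Fubini's theorem for real-valued and complex-valued functions *)

Section RealFubini.
Context {R : realType} {d1 d2 : measure_display}.
Context {X : measurableType d1} {Y : measurableType d2}.
Variables (m1 : {sigma_finite_measure set X -> \bar R}).
Variables (m2 : {sigma_finite_measure set Y -> \bar R}).
Implicit Types f : X * Y -> R.

(** No integrability is assumed: the integrals of the positive and negative parts are measurable by
    Tonelli, and [fine] sends the sections without a finite integral to [0]. Weak measurability of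
    the systems relies on this generality. *)
Lemma measurable_Rintegral1 f : measurable_fun setT f ->
  measurable_fun setT (fun x => \int[m2]_y f (x, y)).
Proof.
move=> mf; rewrite /Rintegral.
apply: (@measurableT_comp _ _ _ _ _ _ (@fine R)); first exact: fine_measurable.
have mF : measurable_fun setT (EFin \o f) by exact/measurable_EFinP.
rewrite (_ : (fun x => _) = (fun x => \int[m2]_y ((EFin \o f)^\+ (x, y)) -
    \int[m2]_y ((EFin \o f)^\- (x, y)))%E); last first.
  by apply/funext => x; rewrite integralE; congr (_ - _)%E;
  apply: eq_integral => y _; rewrite ?funeposE ?funenegE.
apply: emeasurable_funB.
  apply: (@measurable_fun_fubini_tonelli_F _ _ _ _ _ m2 (EFin \o f)^\+%E) => //.
  exact: measurable_funepos.
apply: (@measurable_fun_fubini_tonelli_F _ _ _ _ _ m2 (EFin \o f)^\-%E) => //.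
exact: measurable_funeneg.
Qed.

Lemma integrable_ae_Rintegral1 f :
  (m1 \x m2)%E.-integrable setT (EFin \o f) ->
  {ae m1, forall x, (\int[m2]_y f (x, y))%:E = (\int[m2]_y (f (x, y))%:E)%E}.
Proof.
move=> fi; apply: filterS (ae_integrable1 fi) => x xi.
by rewrite /Rintegral fineK// integrable_fin_num.
Qed.

Lemma integrable_Rintegral1 f : (m1 \x m2)%E.-integrable setT (EFin \o f) ->
  m1.-integrable setT (fun x => (\int[m2]_y f (x, y))%:E).
Proof.
move=> fi; have mf : measurable_fun setT f by case/integrableP : (fi) => /measurable_EFinP.
apply/integrableP; split; first by apply/measurable_EFinP; exact: measurable_Rintegral1.
have /integrableP[mF] := integrable_fubini_F fi.
apply: le_lt_trans; apply: ae_ge0_le_integral => //.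
- apply: measurableT_comp => //.
  by apply/measurable_EFinP; exact: measurable_Rintegral1.
- exact: measurableT_comp.
- by apply: filterS (integrable_ae_Rintegral1 fi) => x xE _; rewrite xE.
Qed.

Lemma Rintegral12_prod f : (m1 \x m2)%E.-integrable setT (EFin \o f) ->
  \int[m1]_x \int[m2]_y f (x, y) = \int[(m1 \x m2)%E]_z f z.
Proof.
move=> fi; have mf : measurable_fun setT f by case/integrableP : (fi) => /measurable_EFinP.
rewrite {1 3}/Rintegral -(integral12_prod_meas1 fi); congr fine.
apply: ae_eq_integral => //.
- by apply/measurable_EFinP; exact: measurable_Rintegral1.
- exact: measurable_fubini_F fi.
- by apply: filterS (integrable_ae_Rintegral1 fi) => x xE _; rewrite xE.
Qed.

Lemma measurable_Rintegral2 f : measurable_fun setT f ->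
  measurable_fun setT (fun y => \int[m1]_x f (x, y)).
Proof.
move=> mf; rewrite /Rintegral.
apply: (@measurableT_comp _ _ _ _ _ _ (@fine R)); first exact: fine_measurable.
have mF : measurable_fun setT (EFin \o f) by exact/measurable_EFinP.
rewrite (_ : (fun y => _) = (fun y => \int[m1]_x ((EFin \o f)^\+ (x, y)) -
    \int[m1]_x ((EFin \o f)^\- (x, y)))%E); last first.
  by apply/funext => x; rewrite integralE; congr (_ - _)%E;
  apply: eq_integral => y _; rewrite ?funeposE ?funenegE.
apply: emeasurable_funB.
  apply: (@measurable_fun_fubini_tonelli_G _ _ _ _ _ m1 (EFin \o f)^\+%E) => //.
  exact: measurable_funepos.
apply: (@measurable_fun_fubini_tonelli_G _ _ _ _ _ m1 (EFin \o f)^\-%E) => //.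
exact: measurable_funeneg.
Qed.

Lemma integrable_ae_Rintegral2 f :
  (m1 \x m2)%E.-integrable setT (EFin \o f) ->
  {ae m2, forall y, (\int[m1]_x f (x, y))%:E = (\int[m1]_x (f (x, y))%:E)%E}.
Proof.
move=> fi; apply: filterS (ae_integrable2 fi) => x xi.
by rewrite /Rintegral fineK// integrable_fin_num.
Qed.

Lemma Rintegral21_prod f : (m1 \x m2)%E.-integrable setT (EFin \o f) ->
  \int[m2]_y \int[m1]_x f (x, y) = \int[(m1 \x m2)%E]_z f z.
Proof.
move=> fi; have mf : measurable_fun setT f by case/integrableP : (fi) => /measurable_EFinP.
rewrite {1 3}/Rintegral -(integral21_prod_meas1 fi); congr fine.
apply: ae_eq_integral => //.
- by apply/measurable_EFinP; exact: measurable_Rintegral2.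
- exact: measurable_fubini_G fi.
- by apply: filterS (integrable_ae_Rintegral2 fi) => x xE _; rewrite xE.
Qed.

End RealFubini.

Section ComplexFubini.
Context {R : realType} {d1 d2 : measure_display}.
Context {X : measurableType d1} {Y : measurableType d2}.
Variables (m1 : {sigma_finite_measure set X -> \bar R}).
Variables (m2 : {sigma_finite_measure set Y -> \bar R}).
Implicit Types f : X * Y -> R[i].

Lemma cmeasurable_cintegral1 f : cmeasurable f ->
  cmeasurable (fun x => cintegral m2 (fun y => f (x, y))).
Proof.
move=> [f1 f2].
by split; [exact: (measurable_Rintegral1 m2 f1)|exact: (measurable_Rintegral1 m2 f2)].
Qed.

Lemma cintegrable_cintegral1 f : cintegrable (m1 \x m2)%E f ->
  cintegrable m1 (fun x => cintegral m2 (fun y => f (x, y))).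
Proof.
move=> [f1 f2].
by split; [exact: (integrable_Rintegral1 f1)|exact: (integrable_Rintegral1 f2)].
Qed.

Lemma cintegral12_prod f : cintegrable (m1 \x m2)%E f ->
  cintegral m1 (fun x => cintegral m2 (fun y => f (x, y))) =
  cintegral (m1 \x m2)%E f.
Proof.
move=> [fi1 fi2]; congr Complex; [exact: (Rintegral12_prod fi1)|exact: (Rintegral12_prod fi2)].
Qed.

Lemma cintegral21_prod f : cintegrable (m1 \x m2)%E f ->
  cintegral m2 (fun y => cintegral m1 (fun x => f (x, y))) =
  cintegral (m1 \x m2)%E f.
Proof.
move=> [fi1 fi2]; congr Complex; [exact: (Rintegral21_prod fi1)|exact: (Rintegral21_prod fi2)].
Qed.

Lemma integrable_tensor (u : X -> R) (v : Y -> R) :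
  m1.-integrable setT (EFin \o u) -> m2.-integrable setT (EFin \o v) ->
  (m1 \x m2)%E.-integrable setT (fun z => (u z.1 * v z.2)%:E).
Proof.
move=> iu iv.
have mu : measurable_fun setT u by case/integrableP : (iu) => /measurable_EFinP.
have mv : measurable_fun setT v by case/integrableP : (iv) => /measurable_EFinP.
apply/integrable12ltyP.
  apply/measurable_EFinP; apply: measurable_funM.
    exact: (measurableT_comp mu measurable_fst).
  exact: (measurableT_comp mv measurable_snd).
have /integrableP[mv' v1] := iv; have /integrableP[mu' u1] := iu.
rewrite (_ : (fun x => _) = (fun x => `|(u x)%:E| * \int[m2]_y `|(v y)%:E|)%E).
  rewrite ge0_integralZr//; last 2 first.
  - exact: measurableT_comp.
  - exact: integral_ge0.
  by apply: lte_mul_pinfty => //; [exact: integral_ge0|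
    rewrite ge0_fin_numE//; exact: integral_ge0].
apply/funext => x; rewrite -ge0_integralZl//; last exact: measurableT_comp.
by apply: eq_integral => y _; rewrite /= normrM EFinM.
Qed.

Lemma cintegrable_tensor (f : X -> R[i]) (g : Y -> R[i]) :
  cintegrable m1 f -> cintegrable m2 g ->
  cintegrable (m1 \x m2)%E (fun z => f z.1 * g z.2).
Proof.
move=> fi gi; apply: cintegrable_le (integrable_tensor
  (cintegrable_normc fi) (cintegrable_normc gi)) _; last first.
  by move=> z; rewrite Normc.normcM.
apply: cmeasurableM.
  exact: (cmeasurable_comp measurable_fst (cintegrable_measurable fi)).
exact: (cmeasurable_comp measurable_snd (cintegrable_measurable gi)).
Qed.

Lemma cintegral_tensor (f : X -> R[i]) (g : Y -> R[i]) :
  cintegrable m1 f -> cintegrable m2 g ->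
  cintegral (m1 \x m2)%E (fun z => f z.1 * g z.2) =
  cintegral m1 f * cintegral m2 g.
Proof.
move=> fi gi; rewrite -cintegral12_prod; last exact: cintegrable_tensor.
rewrite mulrC -cintegralZ//; apply: eq_cintegral => x /=.
by rewrite cintegralZ// mulrC.
Qed.

End ComplexFubini.

(** * Affine changes of variables for Lebesgue measure *)

Section AffineChange.
Context {R : realType}.
Local Notation leb := (@lebesgue_measure R).
Local Open Scope ereal_scope.

Lemma measurable_affine (a b : R) : measurable_fun setT (fun t : R => a * t + b)%R.
Proof. by apply: measurable_funD => //; exact: mulrl_measurable. Qed.

(** Hides the pushforward of Lebesgue measure behind the only two properties that the changes of
    variables use: its values on sets and its integrals. The witness is read off from the type of
    the pushforward formula. *)
Lemma exists_image_measure (phi : measurableTypeR R -> measurableTypeR R) :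
  measurable_fun setT phi ->
  exists2 m : {measure set (measurableTypeR R) -> \bar R},
    forall A, m A = leb (phi @^-1` A) &
    forall f : R -> \bar R, measurable_fun setT f -> (forall t, 0 <= f t) ->
      \int[m]_t f t = \int[leb]_t f (phi t).
Proof.
move=> mphi; have H := @ge0_integral_pushforward _ _ _ _ R _ mphi leb.
have {}H f mf f0 := H setT f measurableT mf f0.
match type of H with
| forall f mf f0, @eq _ (integral ?m _ _) _ => exists m
end; first by [].
by move=> f mf f0; rewrite H//.
Unshelve.
exact: mphi.
Qed.

(** The pushforward of Lebesgue measure under the affine map, multiplied by [a], gives half-open
    intervals their length, so it is Lebesgue measure by uniqueness. *)
Lemma ge0_integral_affine (a b : R) (f : R -> \bar R) : (0 < a)%R ->
  measurable_fun setT f -> (forall t, 0 <= f t) ->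
  \int[leb]_t f (a * t + b)%R = (a^-1)%:E * \int[leb]_t f t.
Proof.
move=> a0 mf f0.
have [m mE mI] := exists_image_measure (measurable_affine a b).
rewrite -(mI f)//.
rewrite [in RHS](eq_measure_integral (mscale (NngNum (ltW a0)) m)).
  by rewrite ge0_integral_mscale//= muleA -EFinM mulVf ?mul1e// gt_eqF.
move=> A mA _; apply: (@lebesgue_measure_unique R (mscale (NngNum (ltW a0)) m)) => //.
move=> _ [[x y]] _ <-.
transitivity (a%:E * m `]x, y]%classic); last by [].
rewrite mE.
rewrite (_ : _ @^-1` _ = `](x - b) / a, (y - b) / a]%classic)%R; last first.
  apply/seteqP; split => t; rewrite /= !in_itv/= ltr_pdivrMr// ler_pdivlMr//;
  by rewrite ltrBlDr lerBrDr (mulrC t).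
rewrite !lebesgue_measure_itv/= !lte_fin ltr_pM2r ?invr_gt0// ltrD2r.
case: ifPn => xy; last by rewrite mule0.
rewrite -!EFinB -EFinM; congr EFin; field.
by rewrite gt_eqF.
Qed.

Lemma ge0_integral_opp (f : R -> \bar R) :
  measurable_fun setT f -> (forall t, 0 <= f t) ->
  \int[leb]_t f (- t)%R = \int[leb]_t f t.
Proof.
move=> mf f0.
have [m mE mI] := exists_image_measure (@oppr_measurable R setT).
rewrite -(mI f)//; apply: eq_measure_integral => A mA _.
by rewrite mE; exact: lebesgue_measureN.
Qed.

Lemma integrable_affine (a b : R) (f : R -> R) : (0 < a)%R ->
  leb.-integrable setT (EFin \o f) ->
  leb.-integrable setT (fun t => (f (a * t + b)%R)%:E).
Proof.
move=> a0 /integrableP[mf fi]; apply/integrableP; split.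
  exact: (measurableT_comp mf (measurable_affine a b)).
rewrite (ge0_integral_affine b a0 (f := fun t => `|(f t)%:E|)) //; last exact: measurableT_comp.
apply: lte_mul_pinfty => //; last by rewrite lee_fin invr_ge0 ltW.
Qed.

Lemma Rintegral_affine (a b : R) (f : R -> R) : (0 < a)%R ->
  leb.-integrable setT (EFin \o f) ->
  (\int[leb]_t f (a * t + b) = a^-1 * \int[leb]_t f t)%R.
Proof.
move=> a0 fi; have /integrableP[mf _] := fi.
have ip := integrable_pos_fin_num measurableT fi.
have ineg := integrable_neg_fin_num measurableT fi.
rewrite /Rintegral integralE [in RHS]integralE.
rewrite (_ : \int[leb]_x (fun t => (f (a * t + b)%R)%:E)^\+ x =
  (a^-1)%:E * \int[leb]_x (EFin \o f)^\+ x); last first.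
  rewrite -(ge0_integral_affine b a0)//; last exact: measurable_funepos.
  by apply: eq_integral => t _; rewrite !funeposE.
rewrite (_ : \int[leb]_x (fun t => (f (a * t + b)%R)%:E)^\- x =
  (a^-1)%:E * \int[leb]_x (EFin \o f)^\- x); last first.
  rewrite -(ge0_integral_affine b a0)//; last exact: measurable_funeneg.
  by apply: eq_integral => t _; rewrite !funenegE.
rewrite -muleBr//; last by rewrite fin_num_adde_defl// fin_numN.
by rewrite fineM// fin_numB ip.
Qed.

Lemma Rintegral_opp (f : R -> R) : leb.-integrable setT (EFin \o f) ->
  (\int[leb]_t f (- t) = \int[leb]_t f t)%R.
Proof.
move=> fi; have /integrableP[mf _] := fi.
rewrite /Rintegral integralE [in RHS]integralE; congr (fine (_ - _)).
  rewrite -[RHS]ge0_integral_opp//; last exact: measurable_funepos.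
  by apply: eq_integral => t _; rewrite !funeposE.
rewrite -[RHS]ge0_integral_opp//; last exact: measurable_funeneg.
  by apply: eq_integral => t _; rewrite !funenegE.
Qed.

Lemma cintegrable_affine (a b : R) (f : R -> R[i]) : (0 < a)%R ->
  cintegrable leb f -> cintegrable leb (fun t => f (a * t + b)%R).
Proof.
move=> a0 [f1 f2].
by split; [exact: (integrable_affine b a0 f1)|exact: (integrable_affine b a0 f2)].
Qed.

Lemma cintegral_affine (a b : R) (f : R -> R[i]) : (0 < a)%R ->
  cintegrable leb f ->
  cintegral leb (fun t => f (a * t + b)%R) = ((a^-1)%:C * cintegral leb f)%R.
Proof.
move=> a0 [fi1 fi2]; apply: complex_ext; rewrite !cE /cintegral/= ?mul0r ?subr0 ?addr0;
by rewrite -(Rintegral_affine b).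
Qed.

End AffineChange.

(** * Square-integrable functions *)

Section SquareNorm.
Context {R : realType}.
Local Notation leb := (@lebesgue_measure R).
Local Notation normc := (@Normc.normc R).
Implicit Types f g : R -> R[i].

Lemma ae_leb_mono (P Q : R -> Prop) : (forall t, P t -> Q t) ->
  {ae leb, forall t, P t} -> {ae leb, forall t, Q t}.
Proof. by move=> PQ; apply: (@filterS _ _ (ae_filter_ringOfSetsType leb)). Qed.

(** The squared norm, not the norm, is the working quantity: Tonelli and the changes of variables
    apply to it directly. *)
Definition N2 f : \bar R := (\int[leb]_t (normc (f t) ^+ 2)%:E)%E.

(** Equal to [0] when the energy is infinite, so it carries information only next to [L2]. *)
Definition n2 f : R := fine (N2 f).

Lemma N2_ge0 f : (0 <= N2 f)%E.
Proof. by apply: integral_ge0 => t _; rewrite lee_fin sqr_ge0. Qed.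

Lemma n2_ge0 f : 0 <= n2 f.
Proof. exact/fine_ge0/N2_ge0. Qed.

Lemma L2normE f : L2norm f = (N2 f `^ 2^-1)%E.
Proof.
rewrite /L2norm unlock /N2; congr (_ `^ _)%E; apply: eq_integral => t _ /=.
by rewrite powR_mulrn// ger0_norm// normc_ge0.
Qed.

Lemma L2P f : L2 f <-> cmeasurable f /\ (N2 f < +oo)%E.
Proof.
rewrite /L2 L2normE; split=> -[mf fi]; split => //.
  exact: (lty_poweRy _ fi).
by rewrite poweR_lty.
Qed.

Lemma L2_measurable f : L2 f -> cmeasurable f. Proof. by case. Qed.

Lemma L2_fin f : L2 f -> N2 f \is a fin_num.
Proof. by move=> /L2P[_ ?]; rewrite ge0_fin_numE// N2_ge0. Qed.

Lemma L2_n2E f : L2 f -> N2 f = (n2 f)%:E.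
Proof. by move=> /L2_fin ?; rewrite fineK. Qed.

Lemma L2norm_n2 f : L2 f -> L2norm f = (Num.sqrt (n2 f))%:E.
Proof. by move=> /L2_n2E fE; rewrite L2normE fE poweR_EFin powR12_sqrt// n2_ge0. Qed.

Lemma L2normX f : L2 f -> (L2norm f ^+ 2 = (n2 f)%:E)%E.
Proof. by move=> f2; rewrite L2norm_n2// -EFin_expe sqr_sqrtr// n2_ge0. Qed.

Lemma L2_integrable_sqr f : L2 f ->
  leb.-integrable setT (fun t => (normc (f t) ^+ 2)%:E).
Proof.
move=> /L2P[mf fi]; apply/integrableP; split.
  exact/measurable_EFinP/measurable_normc_sqr.
by under eq_integral => t _ do rewrite gee0_abs ?lee_fin ?sqr_ge0//.
Qed.

Lemma le_N2 f g (c : R) : cmeasurable f -> cmeasurable g -> 0 <= c ->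
  (forall t, normc (f t) <= c * normc (g t)) -> (N2 f <= (c ^+ 2)%:E * N2 g)%E.
Proof.
move=> mf mg c0 fg; rewrite /N2 -ge0_integralZl_EFin//; last 3 first.
- by move=> t _; rewrite lee_fin sqr_ge0.
- exact/measurable_EFinP/measurable_normc_sqr.
- exact: sqr_ge0.
apply: ge0_le_integral => //.
- by move=> t _; rewrite lee_fin sqr_ge0.
- exact/measurable_EFinP/measurable_normc_sqr.
- by apply: measurable_funeM; exact/measurable_EFinP/measurable_normc_sqr.
- move=> t _; rewrite -EFinM lee_fin -exprMn.
  by rewrite lerXn2r// ?nnegrE ?normc_ge0// mulr_ge0// normc_ge0.
Qed.

Lemma L2_le f g (c : R) : cmeasurable f -> L2 g -> 0 <= c ->
  (forall t, normc (f t) <= c * normc (g t)) -> L2 f.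
Proof.
move=> mf g2 c0 fg; apply/L2P; split => //.
apply: (le_lt_trans (le_N2 mf (L2_measurable g2) c0 fg)).
by rewrite L2_n2E// -EFinM ltry.
Qed.

Lemma N2D f g : cmeasurable f -> cmeasurable g ->
  (N2 (fun t => (f t + g t)%R) <= 2%:E * N2 f + 2%:E * N2 g)%E.
Proof.
move=> mf mg; rewrite /N2 -!ge0_integralZl_EFin//; last 4 first.
- by move=> t _; rewrite lee_fin sqr_ge0.
- exact/measurable_EFinP/measurable_normc_sqr.
- by move=> t _; rewrite lee_fin sqr_ge0.
- exact/measurable_EFinP/measurable_normc_sqr.
have m2f h : cmeasurable h ->
    measurable_fun [set: R] (fun t : R => 2%:E * (normc (h t) ^+ 2)%:E)%E.
  by move=> mh; apply: measurable_funeM; exact/measurable_EFinP/measurable_normc_sqr.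
rewrite -ge0_integralD//; last 4 first.
- by move=> t _; rewrite -EFinM lee_fin mulr_ge0// sqr_ge0.
- exact: m2f.
- by move=> t _; rewrite -EFinM lee_fin mulr_ge0// sqr_ge0.
- exact: m2f.
apply: ge0_le_integral => //.
- by move=> t _; rewrite lee_fin sqr_ge0.
- exact/measurable_EFinP/measurable_normc_sqr/cmeasurableD.
- by apply: emeasurable_funD; exact: m2f.
- by move=> t _; rewrite -!EFinM -EFinD lee_fin normc_sqrD.
Qed.

Lemma L2D f g : L2 f -> L2 g -> L2 (fun t => f t + g t).
Proof.
move=> f2 g2; have mf := L2_measurable f2; have mg := L2_measurable g2.
apply/L2P; split; first exact: cmeasurableD.
by apply: (le_lt_trans (N2D mf mg)); rewrite !L2_n2E// -!EFinM -EFinD ltry.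
Qed.

Lemma L2Z a f : L2 f -> L2 (fun t => a * f t).
Proof.
move=> f2; apply: (@L2_le _ f (normc a)) => //; rewrite ?normc_ge0//.
  by apply: cmeasurableM; [exact: cmeasurable_cst|exact: L2_measurable].
by move=> t; rewrite Normc.normcM.
Qed.

Lemma L2N f : L2 f -> L2 (fun t => - f t).
Proof.
move=> f2; rewrite (_ : (fun t => _) = (fun t => -1 * f t)); first exact: L2Z.
by apply/funext => t; rewrite mulN1r.
Qed.

Lemma L2B f g : L2 f -> L2 g -> L2 (fun t => f t - g t).
Proof. by move=> f2 g2; apply: L2D => //; exact: L2N. Qed.

Lemma L2_conj f : L2 f -> L2 (fun t => conjc (f t)).
Proof.
move=> f2; apply: (@L2_le _ f 1) => //.
  exact/cmeasurable_conj/L2_measurable.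
by move=> t; rewrite mul1r normc_conj.
Qed.

Lemma N2N f : N2 (fun t => - f t) = N2 f.
Proof. by apply: eq_integral => t _; rewrite normc_opp. Qed.

Lemma N2_conj f : N2 (fun t => conjc (f t)) = N2 f.
Proof. by apply: eq_integral => t _; rewrite normc_conj. Qed.

Lemma n2D f g : L2 f -> L2 g -> n2 (fun t => f t + g t) <= 2 * n2 f + 2 * n2 g.
Proof.
move=> f2 g2; have := N2D (L2_measurable f2) (L2_measurable g2).
by rewrite !L2_n2E ?lee_fin//; exact: L2D.
Qed.

Lemma n2BC f g : n2 (fun t => f t - g t) = n2 (fun t => g t - f t).
Proof.
by rewrite /n2 -N2N; congr (fine (N2 _)); apply/funext => t; rewrite opprB.
Qed.

Lemma L2_mul_integrable f g : L2 f -> L2 g -> cintegrable leb (fun t => f t * g t).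
Proof.
move=> f2 g2; have mf := L2_measurable f2; have mg := L2_measurable g2.
apply: (@cintegrable_le _ _ _ leb _ (fun t => normc (f t) ^+ 2 + normc (g t) ^+ 2)).
- exact: cmeasurableM.
- exact: (integrableD measurableT (L2_integrable_sqr f2) (L2_integrable_sqr g2)).
- by move=> t; rewrite Normc.normcM; have := normc_ge0 (f t);
    have := normc_ge0 (g t); nra.
Qed.

Lemma inner_integrable f g : L2 f -> L2 g ->
  cintegrable leb (fun t => f t * conjc (g t)).
Proof. by move=> f2 g2; apply: L2_mul_integrable => //; exact: L2_conj. Qed.

Lemma innerDl f g h : L2 f -> L2 g -> L2 h ->
  inner (fun t => f t + g t) h = inner f h + inner g h.
Proof.
move=> f2 g2 h2; rewrite /inner -cintegralD; [|exact: inner_integrable..].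
by apply: eq_cintegral => t; rewrite mulrDl.
Qed.

Lemma innerZl a f h : L2 f -> L2 h ->
  inner (fun t => a * f t) h = a * inner f h.
Proof.
move=> f2 h2; rewrite /inner -cintegralZ; last exact: inner_integrable.
by apply: eq_cintegral => t; rewrite mulrA.
Qed.

Lemma inner_conj f g : L2 f -> L2 g -> inner g f = conjc (inner f g).
Proof.
move=> f2 g2; rewrite /inner -cintegral_conj; last exact: inner_integrable.
by apply: eq_cintegral => t; rewrite conjcM conjcK mulrC.
Qed.

Lemma innerDr f g h : L2 f -> L2 g -> L2 h ->
  inner h (fun t => f t + g t) = inner h f + inner h g.
Proof.
move=> f2 g2 h2; rewrite inner_conj//; last exact: L2D.
by rewrite innerDl// conjcD -!inner_conj.
Qed.

Lemma innerZr a f h : L2 f -> L2 h ->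
  inner h (fun t => a * f t) = conjc a * inner h f.
Proof.
move=> f2 h2; rewrite inner_conj//; last exact: L2Z.
by rewrite innerZl// conjcM -!inner_conj.
Qed.

Lemma innerBl f g h : L2 f -> L2 g -> L2 h ->
  inner (fun t => f t - g t) h = inner f h - inner g h.
Proof.
move=> f2 g2 h2; rewrite innerDl//; last exact: L2N.
congr (_ + _); rewrite -mulN1r -innerZl//; congr inner.
by apply/funext => t; rewrite mulN1r.
Qed.

Lemma innerBr f g h : L2 f -> L2 g -> L2 h ->
  inner h (fun t => f t - g t) = inner h f - inner h g.
Proof.
move=> f2 g2 h2; rewrite inner_conj//; last exact: L2B.
by rewrite innerBl// conjcB -!inner_conj.
Qed.

Lemma inner_self f : inner f f = (n2 f)%:C.
Proof.
rewrite /inner; under eq_cintegral do rewrite mul_conjc.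
by rewrite cintegral_Re_ge0.
Qed.

(** Cauchy-Schwarz, obtained from Hoelder's inequality with both exponents [2]. *)
Lemma normc_inner_le f g : L2 f -> L2 g ->
  normc (inner f g) <= Num.sqrt (n2 f) * Num.sqrt (n2 g).
Proof.
move=> f2 g2; have mf := L2_measurable f2; have mg := L2_measurable g2.
have fg := inner_integrable f2 g2.
apply: le_trans (normc_cintegral fg) _.
rewrite -lee_fin EFinM -!L2norm_n2//.
have -> : (\int[leb]_t normc (f t * conjc (g t)))%:E =
    'N[leb]_1[EFin \o ((normc \o f) \* (normc \o g))%R]%E.
  rewrite Lnorm1 /Rintegral fineK; last first.
    exact/integrable_fin_num/cintegrable_normc.
  apply: eq_integral => t _ /=; rewrite Normc.normcM normc_conj.
  by rewrite ger0_norm// mulr_ge0// normc_ge0.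
apply: hoelder => //; [exact: measurable_normc|exact: measurable_normc|].
by rewrite -div1r -splitr.
Qed.

Lemma ae_eq_lebP f g : f = g %[ae leb] <-> {ae leb, forall t, f t = g t}.
Proof.
split=> fg; first by apply: ae_leb_mono fg => t /(_ I).
by apply: ae_leb_mono fg => t fgt _.
Qed.

Lemma N2_eq0 f : cmeasurable f -> N2 f = 0%E -> {ae leb, forall t, f t = 0}.
Proof.
move=> mf f0; have : (\int[leb]_t `|(normc (f t) ^+ 2)%:E| = 0)%E.
  by rewrite -f0; apply: eq_integral => t _; rewrite gee0_abs// lee_fin sqr_ge0.
move=> /ae_eq_integral_abs => /(_ measurableT) H.
have {}H := H (iffRL (measurable_EFinP _ _) (measurable_normc_sqr mf)).
apply: ae_leb_mono H => t /(_ I)/= [] /eqP; rewrite sqrf_eq0 => /eqP.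
exact: Normc.eq0_normc.
Qed.

Lemma ae_eq_n2 f g : L2 f -> L2 g -> n2 (fun t => f t - g t) = 0 ->
  {ae leb, forall t, f t = g t}.
Proof.
move=> f2 g2 fg; have fg2 := L2B f2 g2.
have := N2_eq0 (L2_measurable fg2); rewrite L2_n2E// fg => /(_ erefl).
by apply: ae_leb_mono => t /eqP; rewrite subr_eq0 => /eqP.
Qed.

Lemma N2_ae f g : cmeasurable f -> cmeasurable g ->
  {ae leb, forall t, f t = g t} -> N2 f = N2 g.
Proof.
move=> mf mg fg; apply: ge0_ae_eq_integral => //.
- exact/measurable_EFinP/measurable_normc_sqr.
- exact/measurable_EFinP/measurable_normc_sqr.
- by move=> t _; rewrite lee_fin sqr_ge0.
- by move=> t _; rewrite lee_fin sqr_ge0.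
- by apply: ae_leb_mono fg => t -> _.
Qed.

Lemma ae_n2_eq0 f g : cmeasurable f -> cmeasurable g ->
  {ae leb, forall t, f t = g t} -> n2 (fun t => f t - g t) = 0.
Proof.
move=> mf mg fg; rewrite /n2 (@N2_ae _ (fun=> 0))//.
- rewrite /N2; under eq_integral do rewrite Normc.normc0 expr0n/=.
  by rewrite integral0.
- exact: cmeasurableB.
- by apply: ae_leb_mono fg => t ->; rewrite subrr.
Qed.

End SquareNorm.

(** * Convergence in mean square *)

Section MeanSquareConvergence.
Context {R : realType}.
Local Notation leb := (@lebesgue_measure R).
Local Notation normc := (@Normc.normc R).
Implicit Types f g : R -> R[i].

Definition cvgL2 (f_ : nat -> R -> R[i]) f : Prop :=
  n2 (fun t => f_ n t - f t) @[n --> \oo] --> (0 : R).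

Lemma cvgr_sqrt (u : nat -> R) : u n @[n --> \oo] --> 0 ->
  Num.sqrt (u n) @[n --> \oo] --> 0.
Proof.
move=> u0; rewrite -[X in _ --> X](@sqrtr0 R).
by apply: continuous_cvg u0; exact: sqrt_continuous.
Qed.

Lemma L2norm_cvg0 (u_ : nat -> R -> R[i]) : (forall n, L2 (u_ n)) ->
  (L2norm (u_ n) @[n --> \oo] --> 0%E) <-> (n2 (u_ n) @[n --> \oo] --> (0 : R)).
Proof.
move=> u2; have -> : (fun n => L2norm (u_ n)) = (fun n => (Num.sqrt (n2 (u_ n)))%:E).
  by apply/funext => n; rewrite L2norm_n2.
split=> [/fine_cvgP[_]/= u0|u0].
  rewrite (_ : (fun n => n2 (u_ n)) =
    (fun n => Num.sqrt (n2 (u_ n)) * Num.sqrt (n2 (u_ n)))).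
    by rewrite -[X in _ --> X](mulr0 0); exact: cvgM.
  by apply/funext => n; rewrite -expr2 sqr_sqrtr ?n2_ge0.
apply/fine_cvgP; split; first by apply: nearW.
exact: cvgr_sqrt.
Qed.

Lemma cvgL2_inner (f_ g_ : nat -> R -> R[i]) f g :
  (forall n, L2 (f_ n)) -> (forall n, L2 (g_ n)) -> L2 f -> L2 g ->
  cvgL2 f_ f -> cvgL2 g_ g ->
  normc (inner (f_ n) (g_ n) - inner f g) @[n --> \oo] --> (0 : R).
Proof.
move=> f2_ g2_ f2 g2 ff gg.
pose a n := Num.sqrt (n2 (fun t => f_ n t - f t)).
pose b n := Num.sqrt (n2 (fun t => g_ n t - g t)).
have a0 : a n @[n --> \oo] --> (0 : R).
  exact: cvgr_sqrt.
have b0 : b n @[n --> \oo] --> (0 : R).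
  exact: cvgr_sqrt.
apply: (@squeeze_cvgr _ _ _ _ (fun=> 0)
  (fun n => a n * b n + a n * Num.sqrt (n2 g) + Num.sqrt (n2 f) * b n)).
- apply: nearW => n; rewrite normc_ge0 andTb.
  have fn2 := L2B (f2_ n) f2; have gn2 := L2B (g2_ n) g2.
  have -> : inner (f_ n) (g_ n) - inner f g =
    inner (fun t => f_ n t - f t) (fun t => g_ n t - g t) +
    inner (fun t => f_ n t - f t) g + inner f (fun t => g_ n t - g t).
    by rewrite !(innerBl, innerBr)//; ring.
  rewrite (le_trans (ler_normcD _ _))// lerD//; last exact: normc_inner_le.
  rewrite (le_trans (ler_normcD _ _))// lerD//; exact: normc_inner_le.
- exact: cvg_cst.
- rewrite [X in _ --> X](_ : 0 = 0 * 0 + 0 * Num.sqrt (n2 g) + Num.sqrt (n2 f) * 0).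
    apply: cvgD; last by apply: cvgM => //; exact: cvg_cst.
    by apply: cvgD; apply: cvgM => //; exact: cvg_cst.
  by rewrite !mul0r mulr0 !addr0.
Qed.

(** The device that carries identities between inner products from the intersection of L1 and L2 to
    all of L2: it extends both Plancherel's identity and the adjoint formula. *)
Lemma cvgL2_inner_eq (f_ g_ F_ G_ : nat -> R -> R[i]) f g F G :
  (forall n, L2 (f_ n)) -> (forall n, L2 (g_ n)) -> L2 f -> L2 g ->
  (forall n, L2 (F_ n)) -> (forall n, L2 (G_ n)) -> L2 F -> L2 G ->
  cvgL2 f_ f -> cvgL2 g_ g -> cvgL2 F_ F -> cvgL2 G_ G ->
  (forall n, inner (f_ n) (g_ n) = inner (F_ n) (G_ n)) ->
  inner f g = inner F G.
Proof.
move=> f2_ g2_ f2 g2 F2_ G2_ F2 G2 ff gg FF GG E.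
have H1 := cvgL2_inner f2_ g2_ f2 g2 ff gg.
have H2 := cvgL2_inner F2_ G2_ F2 G2 FF GG.
have H : normc (inner f g - inner F G) @[n --> \oo] --> (0 : R).
  apply: (@squeeze_cvgr _ _ _ _ (fun=> 0) (fun n =>
    normc (inner (f_ n) (g_ n) - inner f g) + normc (inner (F_ n) (G_ n) - inner F G))).
  - apply: nearW => n; rewrite normc_ge0 andTb E.
    rewrite (_ : inner f g - inner F G = - (inner (F_ n) (G_ n) - inner f g) +
      (inner (F_ n) (G_ n) - inner F G)); last by ring.
    by rewrite (le_trans (ler_normcD _ _))// normc_opp.
  - exact: cvg_cst.
  - by rewrite -[X in _ --> X](addr0 0); apply: cvgD.
have /Normc.eq0_normc/eqP : normc (inner f g - inner F G) = 0.
  exact: (cvg_unique _ (cvg_cst _) H).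
by rewrite subr_eq0 => /eqP.
Qed.

Lemma cvgL2D (f_ g_ : nat -> R -> R[i]) f g :
  (forall n, L2 (f_ n)) -> (forall n, L2 (g_ n)) -> L2 f -> L2 g ->
  cvgL2 f_ f -> cvgL2 g_ g ->
  cvgL2 (fun n t => f_ n t + g_ n t) (fun t => f t + g t).
Proof.
move=> f2_ g2_ f2 g2 ff gg.
apply: (@squeeze_cvgr _ _ _ _ (fun=> 0) (fun n => 2 * n2 (fun t => f_ n t - f t) +
  2 * n2 (fun t => g_ n t - g t))).
- apply: nearW => n; rewrite n2_ge0 andTb.
  rewrite (_ : (fun t => _) = (fun t => (f_ n t - f t) + (g_ n t - g t))).
    by apply: n2D; exact: L2B.
  by apply/funext => t; ring.
- exact: cvg_cst.
- rewrite [X in _ --> X](_ : 0 = 2 * 0 + 2 * 0); last by rewrite mulr0 addr0.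
  by apply: cvgD; apply: cvgM => //; exact: cvg_cst.
Qed.

Lemma n2Z a f : L2 f -> n2 (fun t => a * f t) = normc a ^+ 2 * n2 f.
Proof.
move=> f2; have a2 := L2Z a f2; apply: (@complexI R).
rewrite -inner_self innerZl// innerZr// mulrA mul_conjc inner_self.
exact/esym/rmorphM.
Qed.

Lemma cvgL2Z (f_ : nat -> R -> R[i]) f a : (forall n, L2 (f_ n)) -> L2 f ->
  cvgL2 f_ f -> cvgL2 (fun n t => a * f_ n t) (fun t => a * f t).
Proof.
move=> f2_ f2 ff; rewrite /cvgL2.
rewrite [X in _ --> X](_ : 0 = normc a ^+ 2 * 0); last by rewrite mulr0.
rewrite (_ : (fun n => _) = (fun n => normc a ^+ 2 * n2 (fun t => f_ n t - f t))).
  by apply: cvgM => //; exact: cvg_cst.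
apply/funext => n; rewrite -n2Z; last exact: L2B.
by congr n2; apply/funext => t; rewrite mulrBr.
Qed.

(** Dominated convergence for the squares, with the integrable bound [normc (g t) ^+ 2]. *)
Lemma cvg_n2_dominated (u_ : nat -> R -> R[i]) g :
  (forall n, cmeasurable (u_ n)) -> L2 g ->
  (forall n t, normc (u_ n t) <= normc (g t)) ->
  (forall t, normc (u_ n t) @[n --> \oo] --> (0 : R)) ->
  n2 (u_ n) @[n --> \oo] --> (0 : R).
Proof.
move=> mu_ g2 ug u0.
have [] := @dominated_convergence _ _ _ leb setT measurableT
  (fun n t => (normc (u_ n t) ^+ 2)%:E) (fun=> 0%E) (fun t => (normc (g t) ^+ 2)%:E).
- by move=> n; apply/measurable_EFinP/measurable_normc_sqr; exact: mu_.
- by [].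
- apply: aeW => t _; apply/fine_cvgP; split; first by apply: nearW.
  rewrite (_ : _ \o _ = fun n => normc (u_ n t) * normc (u_ n t)); last first.
    by apply/funext => n /=; rewrite expr2.
  by rewrite -[X in _ --> X](mulr0 0); apply: cvgM.
- exact: L2_integrable_sqr.
- apply: aeW => t n _; rewrite lee_fin ger0_norm ?sqr_ge0//.
  by rewrite lerXn2r ?nnegrE ?normc_ge0.
move=> _ _; rewrite integral0 => /fine_cvgP[_].
by [].
Qed.

End MeanSquareConvergence.

(** * Completeness of L2 and truncation to bounded intervals *)

Section Completeness.
Context {R : realType}.
Local Notation leb := (@lebesgue_measure R).
Local Notation normc := (@Normc.normc R).

(** The radius [2 * s * 2^-1 ^+ n] is the sum of the bounds on all increments from [n] on, so the
    intervals of these radii about [u n] are nested and share a point. The explicit rate is kept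
    because it has to be integrated later. *)
Lemma geometric_cvg (u : nat -> R) (s : R) : 0 <= s ->
  (forall n, `|u n.+1 - u n| <= s * 2^-1 ^+ n) ->
  exists l, forall n, `|l - u n| <= 2 * s * 2^-1 ^+ n.
Proof.
move=> s0 us; pose a n := u n - 2 * s * 2^-1 ^+ n; pose b n := u n + 2 * s * 2^-1 ^+ n.
have e0 n : 0 <= (2^-1 : R) ^+ n by rewrite exprn_ge0.
have aS n : a n <= a n.+1.
  by have := us n; rewrite /a exprS ler_norml => /andP[]; move: (e0 n); nra.
have bS n : b n.+1 <= b n.
  by have := us n; rewrite /b exprS ler_norml => /andP[]; move: (e0 n); nra.
have andd : nondecreasing_seq a by apply/nondecreasing_seqP.
have bni : nonincreasing_seq b by apply/nonincreasing_seqP.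
have ab n m : a n <= b m.
  have lenm := leq_maxl n m; have lemm := leq_maxr n m.
  apply: le_trans (andd _ _ lenm) _; apply: le_trans (bni _ _ lemm).
  rewrite /a /b; have := mulr_ge0 s0 (e0 (maxn n m)); lra.
have ca : cvgn a.
  apply: nondecreasing_is_cvgn => //.
  by exists (b 0%N) => _ [n _ <-].
exists (limn a) => n; rewrite ler_norml; apply/andP; split.
  by have := nondecreasing_cvgn_le andd ca n; rewrite /a; lra.
have : limn a <= b n by apply: limr_le => //; apply: nearW => m.
by rewrite /b; lra.
Qed.

(* The weight [4 ^ n] makes [sum 4^n (f_(n+1) - f_n)^2] integrable, which bounds the
   increments by a geometric sequence almost everywhere. *)
Lemma complete_sqr_integral (f : nat -> R -> R) :
  (forall n, measurable_fun setT (f n)) ->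
  (forall n, (\int[leb]_t ((f n.+1 t - f n t) ^+ 2)%:E <= (8^-1 ^+ n)%:E)%E) ->
  exists2 g : R -> R, measurable_fun setT g & forall n,
    (\int[leb]_t ((f n t - g t) ^+ 2)%:E <= (8 * 4^-1 ^+ n)%:E)%E.
Proof.
move=> mf df.
pose h n t : R := 4 ^+ n * (f n.+1 t - f n t) ^+ 2.
pose H t : \bar R := (\sum_(0 <= n <oo) (h n t)%:E)%E.
have h0 n t : 0 <= h n t by apply: mulr_ge0; [exact: exprn_ge0|exact: sqr_ge0].
have mh n : measurable_fun setT (h n).
  apply: measurable_funM => //; apply: measurable_funX.
  exact: measurable_funB.
have H0 t : (0 <= H t)%E by apply: nneseries_ge0 => n _ _; rewrite lee_fin.
have mH : measurable_fun setT H.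
  by apply: (@ge0_emeasurable_sum _ _ R setT (fun n t => (h n t)%:E) xpredT) =>
    [n t _ _|n _]; [rewrite lee_fin|apply/measurable_EFinP; exact: mh].
(* The integral is at most the sum of [4 ^+ n * 8^-1 ^+ n = 2^-1 ^+ n]. *)
have intH : (\int[leb]_t H t <= 2%:E)%E.
  rewrite integral_nneseries; [|by []|
    by move=> n; apply/measurable_EFinP; exact: mh|by move=> n t _; rewrite lee_fin h0].
  apply: (@le_trans _ _ (\sum_(0 <= n <oo) ((2^-1) ^+ n)%:E)%E).
    apply: lee_nneseries => [n _ _|n _]; first by apply: integral_ge0 => t _; rewrite lee_fin.
    under eq_integral do rewrite EFinM.
    rewrite ge0_integralZl_EFin; [|exact: measurableT|
      by move=> t _; rewrite lee_fin sqr_ge0|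
      apply/measurable_EFinP; exact: (measurable_funX 2 (measurable_funB (mf n.+1) (mf n)))|
      exact: exprn_ge0].
    apply: (@le_trans _ _ ((4 ^+ n)%:E * (8^-1 ^+ n)%:E)%E).
      by rewrite lee_pmul2l// lte_fin exprn_gt0.
    rewrite -EFinM lee_fin -exprMn.
    by rewrite (_ : 4 / 8 = 2^-1 :> R)//; lra.
  have /cvg_lim <- // : (\sum_(0 <= i < n) (2^-1 ^+ i)%:E)%E @[n --> \oo] --> (2 : R)%:E.
  apply: cvg_trans (_ : EFin (series (geometric 1 2^-1) n) @[n --> \oo] --> _).
    apply: near_eq_cvg; apply: nearW => n.
    by rewrite /series/= -sumEFin; apply: eq_bigr => i _; rewrite mul1r.
  apply: cvg_EFin; first by apply: nearW.
  rewrite [X in _ --> X](_ : 2 = 1 / (1 - 2^-1)); last first.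
    by rewrite (_ : 1 - 2^-1 = 2^-1 :> R) ?div1r ?invrK//; lra.
  by apply: cvg_geometric_series; rewrite ger0_norm ?invr_ge0// invf_lt1// ltr1n.
have Hae : {ae leb, forall t, H t \is a fin_num}.
  have iH : leb.-integrable setT H.
    apply/integrableP; split => //.
    under eq_integral do rewrite gee0_abs//.
    by rewrite (le_lt_trans intH)// ltry.
  by apply: ae_leb_mono (integrable_ae measurableT iH) => t /(_ I).
pose A : set R := [set t | H t \is a fin_num].
have mA : measurable A by rewrite -[A]setTI; exact: emeasurable_fin_num.
(* Zeroing the sequence on the null set where [H] is infinite makes it converge at every point, so
   its limit is measurable. *)
pose f' n t := f n t * \1_A t.
pose s t : R := Num.sqrt (fine (H t)).
have f's t n : `|f' n.+1 t - f' n t| <= s t * 2^-1 ^+ n.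
  rewrite /f' -mulrBl indicE; case: (boolP (t \in A)) => tA; last first.
    by rewrite mulr0 normr0 mulr_ge0 ?sqrtr_ge0// exprn_ge0.
  rewrite mulr1; have {}tA := set_mem tA.
  rewrite -(ler_pXn2r (ltn0Sn 1)) ?nnegrE ?mulr_ge0 ?sqrtr_ge0 ?exprn_ge0//.
  rewrite exprMn sqr_sqrtr ?fine_ge0// exprAC.
  rewrite real_normK ?num_real//.
  have : ((h n t)%:E <= H t)%E.
    apply: le_trans (nneseries_lim_ge n.+1 _); last by move=> i _ _; rewrite lee_fin.
    rewrite big_nat_recr//= leeDr//.
    by apply: sume_ge0 => i _; rewrite lee_fin.
  rewrite -(fineK tA) lee_fin /h => hH.
  rewrite (_ : (f n.+1 t - f n t) ^+ 2 = (4 ^+ n * (f n.+1 t - f n t) ^+ 2) * 4^-1 ^+ n).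
    rewrite (_ : 2^-1 ^+ 2 = 4^-1 :> R); last by lra.
    by rewrite ler_wpM2r// exprn_ge0.
  by rewrite mulrAC -exprMn divff ?expr1n ?mul1r.
have /choice[g gf'] t : exists l, forall n, `|l - f' n t| <= 2 * s t * 2^-1 ^+ n.
  exact: (geometric_cvg (sqrtr_ge0 _) (f's t)).
have e0 : (2^-1 : R) ^+ n @[n --> \oo] --> (0 : R).
  by apply: cvg_expr; rewrite ger0_norm ?invr_ge0// invf_lt1// ltr1n.
have mg : measurable_fun setT g.
  apply: (@measurable_fun_cvg _ _ _ setT f') => [n|t _].
    by apply: measurable_funM => //; exact: measurable_indic.
  apply: (@squeeze_cvgr _ _ _ _ (fun n => g t - 2 * s t * 2^-1 ^+ n)
      (fun n => g t + 2 * s t * 2^-1 ^+ n)).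
  - by apply: nearW => n; have := gf' t n; rewrite ler_norml => /andP[]; lra.
  - rewrite -[X in _ --> X]subr0; apply: cvgB; first exact: cvg_cst.
    by rewrite -[X in _ --> X](mulr0 (2 * s t)); apply: cvgM => //; exact: cvg_cst.
  - rewrite -[X in _ --> X]addr0; apply: cvgD; first exact: cvg_cst.
    by rewrite -[X in _ --> X](mulr0 (2 * s t)); apply: cvgM => //; exact: cvg_cst.
(* Almost everywhere the squared distance is at most [(2 * s t * 2^-1 ^+ n) ^+ 2], that is
   [4 * 4^-1 ^+ n * H t]; the bound [2] on the integral of [H] then produces the [8]. *)
exists g => // n; apply: (@le_trans _ _ (\int[leb]_t ((4 * 4^-1 ^+ n)%:E * H t))%E); last first.
  rewrite ge0_integralZl_EFin; [|by []|by []|by []|by rewrite mulr_ge0// exprn_ge0].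
  rewrite (_ : 8 * 4^-1 ^+ n = 4 * 4^-1 ^+ n * 2); last by ring.
  by rewrite [X in (_ <= X)%E]EFinM lee_pmul2l// lte_fin mulr_gt0// exprn_gt0.
apply: ae_ge0_le_integral => //.
- by move=> t _; rewrite lee_fin sqr_ge0.
- by apply/measurable_EFinP; exact: (measurable_funX 2 (measurable_funB (mf n) mg)).
- by move=> t _; rewrite mule_ge0// lee_fin mulr_ge0// exprn_ge0.
- exact: measurable_funeM.
apply: ae_leb_mono Hae => t Ht _; rewrite -(fineK Ht) -EFinM lee_fin.
have := gf' t n; rewrite /f' indicE mem_set// mulr1 => gfn.
rewrite -real_normK ?num_real// distrC.
apply: (@le_trans _ _ ((2 * s t * 2^-1 ^+ n) ^+ 2)).
  by rewrite lerXn2r ?nnegrE ?normr_ge0// (le_trans _ gfn).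
rewrite !exprMn sqr_sqrtr ?fine_ge0// exprAC.
rewrite (_ : 2^-1 ^+ 2 = 4^-1 :> R); last by lra.
by rewrite (_ : 2 ^+ 2 = 4 :> R)// ; lra.
Qed.

(** Fast Cauchy sequences suffice: the approximations in [fourierL2_ex] are chosen at this rate.
    Real and imaginary parts are treated separately and contribute [8 * 4^-1 ^+ n] each. *)
Lemma complete_L2 (g : nat -> R -> R[i]) : (forall n, L2 (g n)) ->
  (forall n, n2 (fun t => g n.+1 t - g n t) <= 8^-1 ^+ n) ->
  exists2 l, L2 l & cvgL2 g l.
Proof.
move=> g2 dg.
have mg n := L2_measurable (g2 n).
have dN n : (N2 (fun t => (g n.+1 t - g n t)%R) <= (8^-1 ^+ n)%:E)%E.
  by rewrite L2_n2E ?lee_fin//; exact: L2B.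
have mre n : measurable_fun setT (fun t => complex.Re (g n t)) by case: (mg n).
have mim n : measurable_fun setT (fun t => complex.Im (g n t)) by case: (mg n).
have le_part (p q : R -> R) n : measurable_fun setT p -> measurable_fun setT q ->
    (forall t, normc (g n.+1 t - g n t) ^+ 2 = p t ^+ 2 + q t ^+ 2) ->
    (\int[leb]_t (p t ^+ 2)%:E <= (8^-1 ^+ n)%:E)%E.
  move=> mp mq pq; apply: le_trans (dN n); apply: ge0_le_integral => //.
  - by move=> t _; rewrite lee_fin sqr_ge0.
  - by apply/measurable_EFinP; exact: measurable_funX.
  - by apply/measurable_EFinP/measurable_normc_sqr; exact: cmeasurableB (mg _) (mg _).
  - by move=> t _; rewrite lee_fin pq lerDl sqr_ge0.
have [n|u mu un] := complete_sqr_integral mre.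
  apply: (le_part _ (fun t => complex.Im (g n.+1 t) - complex.Im (g n t))).
  - exact: (measurable_funB (mre _) (mre _)).
  - exact: (measurable_funB (mim _) (mim _)).
  - by move=> t; rewrite normc_sqr !cE.
have [n|v mv vn] := complete_sqr_integral mim.
  apply: (le_part _ (fun t => complex.Re (g n.+1 t) - complex.Re (g n t))).
  - exact: (measurable_funB (mim _) (mim _)).
  - exact: (measurable_funB (mre _) (mre _)).
  - by move=> t; rewrite normc_sqr !cE addrC.
pose l t := u t +i* v t.
have ml : cmeasurable l by [].
have gl n : (N2 (fun t => (g n t - l t)%R) <= (16 * 4^-1 ^+ n)%:E)%E.
  rewrite /N2; under eq_integral do rewrite normc_sqr !cE/= EFinD.
  rewrite ge0_integralD//; last 4 first.
  - by move=> t _; rewrite lee_fin sqr_ge0.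
  - by apply/measurable_EFinP; exact: (measurable_funX 2 (measurable_funB (mre n) mu)).
  - by move=> t _; rewrite lee_fin sqr_ge0.
  - by apply/measurable_EFinP; exact: (measurable_funX 2 (measurable_funB (mim n) mv)).
  rewrite (_ : 16 * 4^-1 ^+ n = 8 * 4^-1 ^+ n + 8 * 4^-1 ^+ n); last by ring.
  by rewrite EFinD leeD.
have gl2 n : L2 (fun t => g n t - l t).
  apply/L2P; split; first exact: cmeasurableB (mg n) ml.
  by rewrite (le_lt_trans (gl n))// ltry.
exists l.
  have := L2B (g2 0%N) (gl2 0%N).
  by rewrite (_ : (fun t => _) = l)//; apply/funext => t; ring.
apply: (@squeeze_cvgr _ _ _ _ (fun=> 0) (fun n => 16 * 4^-1 ^+ n)).
- apply: nearW => n; rewrite n2_ge0 andTb.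
  by have := gl n; rewrite L2_n2E// lee_fin.
- exact: cvg_cst.
- rewrite -[X in _ --> X](mulr0 16); apply: cvgM; first exact: cvg_cst.
  by apply: cvg_expr; rewrite ger0_norm ?invr_ge0// invf_lt1// ltr1n.
Qed.

Definition window (r : R) : R -> R[i] := fun t => (\1_`[- r, r] t)%:C.

Lemma window_L2 r : L2 (window r).
Proof.
apply/L2P; split.
  by apply: cmeasurable_real; exact: measurable_indic.
rewrite /N2 (_ : (fun t => _) = (EFin \o \1_`[- r, r])); last first.
  apply/funext => t /=; rewrite expr0n/= addr0 sqrtr_sqr indicE.
  by case: (_ \in _); rewrite ?normr1 ?normr0 ?expr1n ?expr0n.
rewrite integral_indic// setIT/= lebesgue_measure_itv/=.
by case: ifPn => _; rewrite ?ltry// -EFinB ltry.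
Qed.

Lemma normc_window r t : normc (window r t) <= 1.
Proof. by rewrite normc_real indicE; case: (_ \in _); rewrite ?normr1 ?normr0. Qed.

Lemma windowM_L2 r f : L2 f -> L2 (fun t => window r t * f t).
Proof.
move=> f2; apply: (@L2_le _ _ f 1) => //.
  by apply: cmeasurableM; [have /L2_measurable := window_L2 r|exact: L2_measurable].
by move=> t; rewrite Normc.normcM ler_wpM2r ?normc_ge0 ?normc_window.
Qed.

Lemma windowM_L1 r f : L2 f -> L1 (fun t => window r t * f t).
Proof. by move=> f2; apply: L2_mul_integrable => //; exact: window_L2. Qed.

Lemma cvgL2_window f : L2 f -> cvgL2 (fun n t => window n%:R t * f t) f.
Proof.
move=> f2; apply: (cvg_n2_dominated (g := f)) => //.
- move=> n; apply: cmeasurableB; last exact: L2_measurable.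
  exact/L2_measurable/windowM_L2.
- move=> n t; rewrite -{2}(mul1r (f t)) -mulrBl Normc.normcM.
  rewrite ler_piMl ?normc_ge0//.
  rewrite (_ : 1 = 1%:C)// -rmorphB/= expr0n/= addr0 sqrtr_sqr indicE.
  by case: (_ \in _); rewrite ?subrr ?normr0// sub0r normrN normr1.
- move=> t; apply: cvg_near_cst; near=> n.
  rewrite /window indicE mem_set ?mul1r ?subrr ?Normc.normc0//.
  by rewrite /= in_itv/= -ler_norml; near: n; exact: nbhs_infty_ger.
Unshelve. all: by end_near. Qed.

(** The division by [4] absorbs the factors [2] of [n2D]: two consecutive truncations then differ in
    energy by at most [8^-1 ^+ j], the rate that [complete_L2] asks for. *)
Lemma window_fast_approx f : L2 f -> exists r : nat -> R,
  forall j, n2 (fun t => window (r j) t * f t - f t) <= 8^-1 ^+ j / 4.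
Proof.
move=> f2; suff /choice[r rP] j : exists r : R,
    n2 (fun t => window r t * f t - f t) <= 8^-1 ^+ j / 4 by exists r.
have e0 : (0 : R) < 8^-1 ^+ j / 4 by rewrite divr_gt0// exprn_gt0.
have [n _ /(_ n (leqnn n)) H] := cvgr_le _ (cvgL2_window f2) _ e0.
by exists n%:R.
Qed.

End Completeness.

(** * The Poisson kernel and Plancherel's theorem *)

Section LaplaceKernel.
Context {R : realType}.
Local Notation leb := (@lebesgue_measure R).

Definition laplace (x : R) : R := expR (- `|x|).
(** The Fourier transform of [laplace] at angular frequency [c]; see [Rintegral_laplace_cos]. *)
Definition cauchyk (c : R) : R := 2 / (1 + c ^+ 2).

Lemma laplace_ge0 x : 0 <= laplace x.
Proof. exact: expR_ge0. Qed.

Lemma laplace_continuous : continuous laplace.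
Proof.
move=> x; apply: (@continuous_comp _ _ _ (fun x : R => - `|x|) expR).
  by apply: continuousN; exact: norm_continuous.
exact: continuous_expR.
Qed.

Lemma measurable_laplace : measurable_fun setT laplace.
Proof. exact: continuous_measurable_fun laplace_continuous. Qed.

Lemma laplaceN x : laplace (- x) = laplace x.
Proof. by rewrite /laplace normrN. Qed.

Lemma cvgy_expRN : expR (- x) @[x --> +oo%R] --> (0 : R).
Proof. exact: cvgr_expR. Qed.

Lemma integral_laplace : (\int[leb]_x (laplace x)%:E = 2%:E)%E.
Proof.
rewrite ge0_symfun_integralT; [|exact: laplace_ge0|exact: laplace_continuous|
  by move=> x /=; rewrite laplaceN].
rewrite -set_itvcy (_ : (\int[leb]_(x in `[0%R, +oo[) (laplace x)%:E =
  \int[leb]_(x in `[0%R, +oo[) (expR (- x))%:E)%E); last first.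
  apply: eq_integral; by move=> x; rewrite inE/= in_itv/= andbT => x0; rewrite /laplace ger0_norm.
have cexpN : continuous (fun x : R => expR (- x)).
  move=> x; apply: (@continuous_comp _ _ _ (fun x : R => - x) expR).
    exact: opp_continuous.
  exact: continuous_expR.
rewrite (@ge0_continuous_FTC2y _ _ (fun x => - expR (- x)) _ 0).
- by rewrite oppr0 expR0 -EFinB -EFinM; congr EFin; ring.
- by move=> x _; exact: expR_ge0.
- exact: continuous_subspaceT.
- by rewrite -[X in _ --> X]oppr0; apply: cvgN; exact: cvgr_expR.
- by move=> x _; apply: ex_derive.
- by apply: cvg_at_right_filter; apply: cvgN; exact: cexpN.
- move=> x _; rewrite derive1E; apply: (@derive_val _ _ _ _ _ _ (expR (- x))).
  by apply: is_derive_eq; rewrite ?scaler1; ring.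
Qed.

(** The added [1] makes the integrand nonnegative, so that the fundamental theorem of calculus for
    nonnegative functions on a half-line applies. [Rintegral_laplace_cos] subtracts it again. *)
Lemma integral_laplace_cos1 c :
  (\int[leb]_x (laplace x * (1 + cos (c * x)))%:E = (2 + cauchyk c)%:E)%E.
Proof.
have ccos : continuous (fun x : R => cos (c * x)).
  move=> x; apply: (@continuous_comp _ _ _ (fun x : R => c * x) cos).
    exact: mulrl_continuous.
  exact: continuous_cos.
have csin : continuous (fun x : R => sin (c * x)).
  move=> x; apply: (@continuous_comp _ _ _ (fun x : R => c * x) sin).
    exact: mulrl_continuous.
  exact: continuous_sin.
have cexpN : continuous (fun x : R => expR (- x)).
  move=> x; apply: (@continuous_comp _ _ _ (fun x : R => - x) expR).
    exact: opp_continuous.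
  exact: continuous_expR.
have c1 : 1 + c ^+ 2 != 0 by rewrite gt_eqF// ltr_pwDl// sqr_ge0.
have cosge x : 0 <= 1 + cos (c * x) :> R by have := cos_geN1 (c * x); lra.
rewrite ge0_symfun_integralT; last 3 first.
- by move=> x; rewrite mulr_ge0 ?laplace_ge0.
- move=> x; apply: continuousM; first exact: laplace_continuous.
  by apply: continuousD; [exact: cst_continuous|exact: ccos].
- by move=> x /=; rewrite laplaceN mulrN cosN.
rewrite -set_itvcy (_ : (\int[leb]_(x in `[0%R, +oo[) (laplace x * (1 + cos (c * x)))%:E =
  \int[leb]_(x in `[0%R, +oo[) (expR (- x) * (1 + cos (c * x)))%:E)%E); last first.
  apply: eq_integral; by move=> x; rewrite inE/= in_itv/= andbT => x0; rewrite /laplace ger0_norm.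
(* An antiderivative of [expR (- x) * (1 + cos (c * x))]; it vanishes at infinity and equals
   [- 1 - (1 + c ^+ 2)^-1] at [0]. *)
pose F x := expR (- x) * (-1 + (c * sin (c * x) - cos (c * x)) / (1 + c ^+ 2)).
have cf : continuous (fun x : R => expR (- x) * (1 + cos (c * x))).
  move=> x; apply: cvgM; first exact: cexpN.
  by apply: cvgD; [exact: cvg_cst|exact: ccos].
have cF : continuous F.
  move=> x; apply: cvgM; first exact: cexpN.
  apply: cvgD; first exact: cvg_cst.
  apply: cvgM; last exact: cvg_cst.
  apply: cvgB; last exact: ccos.
  by apply: cvgM; [exact: cvg_cst|exact: csin].
rewrite (@ge0_continuous_FTC2y _ _ F _ 0).
- rewrite /F oppr0 mulr0 expR0 sin0 cos0 -EFinB -EFinM; congr EFin.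
  by rewrite /cauchyk; field.
- by move=> x _; rewrite mulr_ge0 ?expR_ge0.
- exact: continuous_subspaceT.
- apply: (@squeeze_cvgr _ _ _ _ (fun x => - (2 + `|c|) * expR (- x))
    (fun x => (2 + `|c|) * expR (- x))).
  + apply: nearW => x; rewrite mulNr -ler_norml /F normrM mulrC.
    rewrite (ger0_norm (expR_ge0 _)) ler_wpM2r ?expR_ge0//.
    rewrite (le_trans (ler_normD _ _))// normrN1 -[2]/(1 + 1) -addrA lerD2l.
    rewrite normrM normfV (ger0_norm (addr_ge0 _ (sqr_ge0 _)))//.
    rewrite ler_pdivrMr ?ltr_pwDl ?sqr_ge0//.
    apply: (@le_trans _ _ (1 + `|c|)); last by rewrite ler_peMr ?addr_ge0// lerDl sqr_ge0.
    rewrite (le_trans (ler_normB _ _))// addrC lerD//; last first.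
      by rewrite normrM ler_piMr// ler_norml sin_geN1 sin_le1.
    by rewrite ler_norml cos_geN1 cos_le1.
  + by rewrite -[X in _ --> X](mulr0 (- (2 + `|c|))); apply: cvgM cvgy_expRN; exact: cvg_cst.
  + by rewrite -[X in _ --> X](mulr0 (2 + `|c|)); apply: cvgM cvgy_expRN; exact: cvg_cst.
- by move=> x _; apply: ex_derive.
- by apply: cvg_at_right_filter; exact: cF.
- move=> x _; rewrite derive1E; apply: derive_val.
  by apply: is_derive_eq; rewrite /GRing.scale/=; field.
Qed.

Lemma integrable_laplace : leb.-integrable setT (EFin \o laplace).
Proof.
apply/integrableP; split; first by apply/measurable_EFinP; exact: measurable_laplace.
under eq_integral do rewrite /= ger0_norm ?laplace_ge0//.
by rewrite integral_laplace ltry.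
Qed.

Lemma measurable_cosM (c : R) : measurable_fun setT (fun x : R => cos (c * x)).
Proof.
apply: continuous_measurable_fun => x.
apply: (@continuous_comp _ _ _ (fun x : R => c * x) cos).
  exact: mulrl_continuous.
exact: continuous_cos.
Qed.

Lemma integrable_laplace_cos1 c :
  leb.-integrable setT (fun x => (laplace x * (1 + cos (c * x)))%:E).
Proof.
apply/integrableP; split.
  apply/measurable_EFinP; apply: measurable_funM; first exact: measurable_laplace.
  by apply: measurable_funD => //; exact: measurable_cosM.
under eq_integral => x _.
  rewrite gee0_abs; last first.
    by rewrite lee_fin mulr_ge0 ?laplace_ge0//; have := cos_geN1 (c * x); lra.
  over.
by rewrite integral_laplace_cos1 ltry.
Qed.

Lemma Rintegral_laplace_cos c :
  \int[leb]_x (laplace x * cos (c * x)) = cauchyk c.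
Proof.
have -> : \int[leb]_x (laplace x * cos (c * x)) =
    \int[leb]_x (laplace x * (1 + cos (c * x)) - laplace x).
  by apply: eq_Rintegral => x _; ring.
rewrite RintegralB//; [|exact: integrable_laplace_cos1|exact: integrable_laplace].
by rewrite /Rintegral integral_laplace integral_laplace_cos1/=; ring.
Qed.

Lemma integrable_laplace_sin c :
  leb.-integrable setT (EFin \o (fun x => laplace x * sin (c * x))).
Proof.
have msin : measurable_fun setT (fun x : R => sin (c * x)).
  apply: continuous_measurable_fun => x.
  apply: (@continuous_comp _ _ _ (fun x : R => c * x) sin).
    exact: mulrl_continuous.
  exact: continuous_sin.
apply: (le_integrable measurableT _ _ integrable_laplace).
  by apply/measurable_EFinP; apply: measurable_funM => //; exact: measurable_laplace.
move=> x _ /=; rewrite lee_fin normrM ler_piMr// ler_norml.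
by rewrite sin_geN1 sin_le1.
Qed.

Lemma Rintegral_laplace_sin c :
  \int[leb]_x (laplace x * sin (c * x)) = 0.
Proof.
have si := integrable_laplace_sin c.
have := Rintegral_opp si.
under eq_Rintegral => x _ do rewrite laplaceN mulrN sinN mulrN -mulN1r.
by rewrite RintegralZl//; lra.
Qed.

Lemma cauchyk_ge0 c : 0 <= cauchyk c.
Proof. by rewrite divr_ge0// addr_ge0// sqr_ge0. Qed.

Lemma cauchyk_continuous : continuous cauchyk.
Proof.
move=> x; apply: cvgM; first exact: cvg_cst.
apply: cvgV; first by rewrite gt_eqF// ltr_pwDl// sqr_ge0.
by apply: cvgD; [exact: cvg_cst|exact: exprn_continuous].
Qed.

Lemma measurable_cauchyk : measurable_fun setT cauchyk.
Proof. exact: continuous_measurable_fun cauchyk_continuous. Qed.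

Lemma integral_cauchyk : (\int[leb]_c (cauchyk c)%:E = (2 * pi)%:E)%E.
Proof.
rewrite ge0_symfun_integralT; [|exact: cauchyk_ge0|exact: cauchyk_continuous|
  by move=> x /=; rewrite /cauchyk sqrrN].
rewrite -set_itvcy; under eq_integral do rewrite EFinM.
rewrite ge0_integralZl_EFin//.
- rewrite (_ : (\int[leb]_(x in `[0%R, +oo[) _ = (pi / 2)%:E)%E); last first.
    exact: integral0y_oneDsqr.
  by rewrite -!EFinM; congr EFin; field.
- by move=> x _; rewrite lee_fin invr_ge0 addr_ge0// sqr_ge0.
- apply/measurable_EFinP; apply: measurable_funTS; apply: continuous_measurable_fun.
  move=> x; apply: cvgV; first by rewrite gt_eqF// ltr_pwDl// sqr_ge0.
  by apply: cvgD; [exact: cvg_cst|exact: exprn_continuous].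
Qed.

End LaplaceKernel.

(** * Continuity of translations in L2 *)

Section TranslationContinuity.
Context {R : realType}.
Local Notation leb := (@lebesgue_measure R).
Local Notation normc := (@Normc.normc R).
Implicit Types f g : R -> R[i].

Lemma measurable_shift (u : R) : measurable_fun setT (fun t : R => t + u).
Proof. exact: measurable_funD. Qed.

Lemma N2_shift f u : cmeasurable f -> N2 (fun t => f (t + u)) = N2 f.
Proof.
move=> mf; have := @ge0_integral_affine R 1 u (fun t => (normc (f t) ^+ 2)%:E) ltr01.
rewrite /N2 invr1 mul1e => <-.
- by apply: eq_integral => t _; rewrite mul1r.
- exact/measurable_EFinP/measurable_normc_sqr.
- by move=> t; rewrite lee_fin sqr_ge0.
Qed.

Lemma L2_shift f u : L2 f -> L2 (fun t => f (t + u)).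
Proof.
move=> /L2P[mf fi]; apply/L2P; split; last by rewrite N2_shift.
exact: cmeasurable_comp (measurable_shift u) mf.
Qed.

Definition shift_continuous f : Prop := forall u : nat -> R,
  u n @[n --> \oo] --> (0 : R) ->
  n2 (fun t => f (t + u n) - f t) @[n --> \oo] --> (0 : R).

(** Energy is invariant under translation, so replacing [f] by a close [g] costs the same error
    before and after the shift. *)
Lemma shift_continuous_closure f : L2 f ->
  (forall e, 0 < e -> exists g, [/\ L2 g, shift_continuous g &
    n2 (fun t => f t - g t) <= e]) ->
  shift_continuous f.
Proof.
move=> f2 H u u0; apply/cvgr0Pnorm_le => e e0.
(* Two uses of [n2D] give [2 * (e / 12) + 2 * (2 * (e / 8) + 2 * (e / 12)) = e]. *)
have [|g [g2 gc fg]] := H (e / 12); first by rewrite divr_gt0.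
have := gc u u0 => /cvgr0Pnorm_le/(_ (e / 8)).
rewrite divr_gt0// => /(_ isT); apply: filterS => n.
rewrite !ger0_norm ?n2_ge0// => gn.
have fgu : n2 (fun t => f (t + u n) - g (t + u n)) <= e / 12.
  rewrite /n2 (N2_shift (f := fun t => f t - g t))//.
  by apply: cmeasurableB; exact: L2_measurable.
have -> : (fun t => f (t + u n) - f t) = (fun t => (f (t + u n) - g (t + u n)) +
    ((g (t + u n) - g t) + (g t - f t))).
  by apply/funext => t; ring.
have f2u := L2_shift (u n) f2; have g2u := L2_shift (u n) g2.
apply: le_trans (n2D _ _) _; [exact: L2B|by apply: L2D; exact: L2B|].
have := n2D (L2B g2u g2) (L2B g2 f2); rewrite (n2BC g f).
lra.
Qed.

Lemma shift_continuousD f g : L2 f -> L2 g ->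
  shift_continuous f -> shift_continuous g -> shift_continuous (fun t => f t + g t).
Proof.
move=> f2 g2 fc gc u u0.
apply: (@squeeze_cvgr _ _ _ _ (fun=> 0) (fun n => 2 * n2 (fun t => f (t + u n) - f t) +
  2 * n2 (fun t => g (t + u n) - g t))).
- apply: nearW => n; rewrite n2_ge0 andTb.
  rewrite (_ : (fun t => _) = (fun t => (f (t + u n) - f t) + (g (t + u n) - g t))).
    by apply: n2D; apply: L2B => //; exact: L2_shift.
  by apply/funext => t; ring.
- exact: cvg_cst.
- rewrite [X in _ --> X](_ : 0 = 2 * 0 + 2 * 0); last by rewrite mulr0 addr0.
  by apply: cvgD; apply: cvgM; [exact: cvg_cst|exact: fc|exact: cvg_cst|exact: gc].
Qed.

Lemma shift_continuousZ f a : L2 f -> shift_continuous f ->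
  shift_continuous (fun t => a * f t).
Proof.
move=> f2 fc u u0.
rewrite [X in _ --> X](_ : 0 = normc a ^+ 2 * 0); last by rewrite mulr0.
rewrite (_ : (fun n => _) = (fun n => normc a ^+ 2 * n2 (fun t => f (t + u n) - f t))).
  by apply: cvgM; [exact: cvg_cst|exact: fc].
apply/funext => n; rewrite -n2Z; last by apply: L2B => //; exact: L2_shift.
by congr n2; apply/funext => t; rewrite mulrBr.
Qed.

Lemma shift_continuous_compact (h : R -> R) (M r : R) : continuous h -> 0 <= M ->
  (forall t, `|h t| <= M) -> (forall t, r < `|t| -> h t = 0) ->
  shift_continuous (fun t => (h t)%:C).
Proof.
move=> hc M0 hM hr u u0.
(* A convergent sequence of shifts is bounded, so all translates of [h] vanish outside one common
   window and dominated convergence applies. *)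
have [B [_ HB]] : bounded_fun u by apply: cvg_seq_bounded; apply/cvg_ex; exists 0.
have {HB} uB n : `|u n| <= `|B| + 1 by apply: HB => //; have := ler_norm B; lra.
apply: (cvg_n2_dominated (g := fun t => (2 * M)%:C * window (r + (`|B| + 1)) t)).
- move=> n; apply: cmeasurableB; apply: cmeasurable_real.
    apply: (measurableT_comp _ (measurable_shift (u n))).
    exact: continuous_measurable_fun.
  exact: continuous_measurable_fun.
- by apply: L2Z; exact: window_L2.
- move=> n t; rewrite -rmorphB normc_real Normc.normcM !normc_real.
  rewrite (ger0_norm (mulr_ge0 _ M0))// indicE.
  case: (boolP (t \in _)) => tr.
    by rewrite normr1 mulr1 mulr_natl mulr2n (le_trans (ler_normB _ _))// lerD.
  have {tr} : r + (`|B| + 1) < `|t|.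
    rewrite ltNge ler_norml; apply: contra tr => tr.
    by apply/mem_set; rewrite /= in_itv.
  have := uB n; move=> un rt.
  have t1 : r < `|t| by have := normr_ge0 B; lra.
  have t2 : r < `|t + u n|.
    by have := ler_normB (t + u n) (u n); rewrite addrK; lra.
  by rewrite (hr _ t1) (hr _ t2) subrr normr0 mulr0.
- move=> t.
  have : h (t + u n) @[n --> \oo] --> h t.
    apply: continuous_cvg; first exact: hc.
    by rewrite -[X in _ --> X]addr0; apply: cvgD => //; exact: cvg_cst.
  move=> hh; rewrite (_ : (fun n => _) = (fun n => `|h (t + u n) - h t|)); last first.
    by apply/funext => n; rewrite -rmorphB normc_real.
  rewrite -[X in _ --> X](@normr0 R R) -(subrr (h t)).
  by apply: cvg_norm; apply: cvgB => //; exact: cvg_cst.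
Qed.

Definition clip (M x : R) : R := Num.max (- M) (Num.min M x).

Lemma normr_clip (M x : R) : 0 <= M -> `|clip M x| <= M.
Proof.
move=> M0; rewrite ler_norml /clip le_max lexx/= ge_max ge_min lexx/= andbT.
lra.
Qed.

(** Clipping is the projection onto the interval from [- M] to [M], which brings no point further
    away from a point of that interval. *)
Lemma dist_clip (M x y : R) : `|x| <= M -> `|x - clip M y| <= `|x - y|.
Proof.
rewrite ler_norml => /andP[Mx xM].
have := ler_norm (x - y); have := ler_norm (- (x - y)); rewrite normrN.
move: `|x - y| => d d1 d2; rewrite ler_norml /clip.
by case: (leP M y) => My; case: (leP (- M) _) => My'; apply/andP; split; lra.
Qed.

Lemma clip_continuous M : continuous (clip M).
Proof.
move=> x; apply: (@continuous_max R R^o (fun=> - M) (fun x => Num.min M x)).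
  exact: cst_continuous.
by apply: (@continuous_min R R^o (fun=> M) id) => //; exact: cst_continuous.
Qed.

(** Continuous functions approximate [p] in L1 on a bounded set. Once they are clipped at [M], the
    square of the error is at most [2 * M] times the L1 error, so the approximation also holds in
    L2. *)
Lemma shift_continuous_bounded (p : R -> R) (M r : R) : measurable_fun setT p ->
  0 < M -> 0 < r -> (forall t, `|p t| <= M) -> (forall t, r < `|t| -> p t = 0) ->
  shift_continuous (fun t => (p t)%:C).
Proof.
move=> mp M0 r0 pM pr.
pose E : set R := `[- (r + 1), r + 1]%classic.
have mE : measurable E by exact: measurable_itv.
have Efin : (leb E < +oo)%E by rewrite lebesgue_measure_itv/=; case: ifPn; rewrite ?ltry.
have pE t : ~ E t -> p t = 0.
  move=> tE; apply: pr; rewrite ltNge; apply/negP => tr; apply: tE.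
  by move: tr; rewrite /E/= in_itv/= ler_norml => /andP[? ?]; apply/andP; split; lra.
have pi : leb.-integrable E (EFin \o p).
  apply: measurable_bounded_integrable => //; first exact: measurable_funTS.
  by exists M; split; [exact: num_real|move=> x Mx t _ /=; rewrite (le_trans (pM t))// ltW].
have [h_ [hc hi hp]] := approximation_continuous_integrable mE Efin pi.
(* A continuous trapezoidal cutoff: [1] up to distance [r] from the origin and [0] beyond [r + 1].
   It gives the approximants compact support without moving them away from [p], which vanishes
   outside radius [r]. *)
pose rho (t : R) : R := Num.max 0 (Num.min 1 (r + 1 - `|t|)).
have rhoc : continuous rho.
  move=> t; apply: (@continuous_max R R^o (fun=> 0) (fun t => Num.min 1 (r + 1 - `|t|))).
    exact: cst_continuous.
  apply: (@continuous_min R R^o (fun=> 1) (fun t => r + 1 - `|t|)).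
    exact: cst_continuous.
  apply: cvgB; first exact: cvg_cst.
  exact: norm_continuous.
have rho01 t : 0 <= rho t <= 1.
  by rewrite /rho le_max lexx/= ge_max ler01 ge_min lexx.
have rho1 t : `|t| <= r -> rho t = 1.
  move=> tr; rewrite /rho; case: (leP 1 (r + 1 - `|t|)) => H; last lra.
  by case: (leP 0 1) => //; rewrite ltr10.
have rho0 t : r + 1 < `|t| -> rho t = 0.
  by move=> tr; rewrite /rho; case: (leP 1 (r + 1 - `|t|)) => H; case: leP => //; lra.
pose h n t := rho t * clip M (h_ n t).
have hcont n : continuous (h n).
  move=> t; apply: cvgM; first exact: rhoc.
  apply: continuous_cvg; first exact: clip_continuous.
  exact: hc.
have hM n t : `|h n t| <= M.
  rewrite normrM; have /andP[? ?] := rho01 t; rewrite (ger0_norm (x := rho t))//.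
  by rewrite (le_trans _ (normr_clip (h_ n t) (ltW M0)))// ler_piMl.
have h0 n t : r + 1 < `|t| -> h n t = 0 by move=> /rho0 tr; rewrite /h tr mul0r.
have hL2 n : L2 (fun t => (h n t)%:C).
  apply: (@L2_le _ _ (window (r + 1)) M); [|exact: window_L2|exact: ltW|].
    by apply: cmeasurable_real; exact: continuous_measurable_fun.
  move=> t; rewrite !normc_real indicE; case: (boolP (t \in _)) => tr.
    by rewrite normr1 mulr1.
  rewrite h0 ?normr0 ?mulr0// ltNge ler_norml; apply: contra tr => tr.
  by apply/mem_set; rewrite /= in_itv.
have pL2 : L2 (fun t => (p t)%:C).
  apply: (@L2_le _ _ (window r) M); [|exact: window_L2|exact: ltW|].
    exact: cmeasurable_real.
  move=> t; rewrite !normc_real indicE; case: (boolP (t \in _)) => tr.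
    by rewrite normr1 mulr1.
  rewrite pr ?normr0 ?mulr0// ltNge ler_norml; apply: contra tr => tr.
  by apply/mem_set; rewrite /= in_itv.
have ph n : (N2 (fun t => ((p t)%:C - (h n t)%:C)%R) <=
    (2 * M)%:E * \int[leb]_(z in E) `|(p z - h_ n z)%:E|)%E.
  have mph : measurable_fun E (fun z => `|(p z - h_ n z)%:E|%E).
    apply: measurableT_comp => //; apply/measurable_EFinP; apply: measurable_funTS.
    by apply: measurable_funB => //; exact: continuous_measurable_fun (hc n).
  rewrite -ge0_integralZl_EFin//; last by rewrite mulr_ge0// ltW.
  rewrite [leRHS]integral_mkcond; apply: ge0_le_integral => //.
  - by move=> t _; rewrite lee_fin sqr_ge0.
  - apply/measurable_EFinP/measurable_normc_sqr/cmeasurableB; exact: L2_measurable.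
  - apply/(measurable_restrictT _ mE); exact: measurable_funeM.
  - move=> t _; rewrite patchE -rmorphB normc_real.
    case: ifPn => tE; last first.
      move: tE; rewrite notin_setE => tE; rewrite pE// sub0r normrN /h rho0 ?mul0r ?normr0 ?expr0n//.
      rewrite ltNge ler_norml; apply/negP => tr; apply: tE.
      by rewrite /E/= in_itv.
    rewrite -EFinM lee_fin expr2.
    have d1 : `|p t - h n t| <= 2 * M.
      by rewrite mulr_natl mulr2n (le_trans (ler_normB _ _))// lerD.
    have d2 : `|p t - h n t| <= `|p t - h_ n t|.
      apply: le_trans (dist_clip (h_ n t) (pM t)); rewrite /h.
      have [tr|tr] := leP `|t| r; first by rewrite rho1// mul1r.
      rewrite pr// !sub0r !normrN normrM; have /andP[? ?] := rho01 t.
      by rewrite (ger0_norm (x := rho t))// ler_piMl.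
    by rewrite ler_pM.
apply: shift_continuous_closure => // e e0.
have e1 : 0 < e / (2 * M) by rewrite divr_gt0// mulr_gt0.
have /fine_cvgP[[n1 _ Hfin] /cvgr_le/(_ _ e1)[n2 _ Hle]] := hp.
pose n := maxn n1 n2.
have {Hfin}fin := Hfin n (leq_maxl n1 n2).
have {Hle}le := Hle n (leq_maxr n1 n2).
exists (fun t => (h n t)%:C); split => //.
  exact: (shift_continuous_compact (hcont n) (ltW M0) (hM n) (h0 n)).
have := ph n; rewrite L2_n2E; last exact: L2B.
move=> /le_trans; rewrite -lee_fin; apply.
rewrite -(fineK fin) -EFinM lee_fin mulrC -ler_pdivlMr ?mulr_gt0//.
Qed.

(** Truncating both the domain and the values of [f] gives bounded functions of compact support that
    are dense in L2; their real and imaginary parts fall under [shift_continuous_bounded]. *)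
Lemma shift_continuous_L2 f : L2 f -> shift_continuous f.
Proof.
move=> f2; have mf := L2_measurable f2; apply: shift_continuous_closure => // e e0.
pose k n t : R := (\1_`[- n%:R, n%:R] t) * (\1_[set t | normc (f t) <= n%:R] t).
have mset n : measurable [set t | normc (f t) <= n%:R].
  rewrite -[X in measurable X]setTI; apply: (measurable_fun_ler _ _ measurableT) => //.
  - exact: measurable_normc.
have mk n : measurable_fun setT (k n).
  by apply: measurable_funM; exact: measurable_indic.
have k01 n t : 0 <= k n t <= 1.
  by rewrite /k !indicE; case: (_ \in _); case: (_ \in _); rewrite ?mulr0 ?mulr1 ?lexx ?ler01.
pose g n t := (k n t)%:C * f t.
have gL2 n : L2 (g n).
  apply: (@L2_le _ _ f 1) => //.
    by apply: cmeasurableM => //; exact: cmeasurable_real.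
  move=> t; rewrite Normc.normcM normc_real ler_wpM2r ?normc_ge0//.
  by have /andP[? ?] := k01 n t; rewrite ger0_norm.
have gf : cvgL2 g f.
  apply: (cvg_n2_dominated (g := f)) => //.
  - by move=> n; apply: cmeasurableB => //; exact: L2_measurable.
  - move=> n t; rewrite /g -{2}(mul1r (f t)) -mulrBl Normc.normcM.
    rewrite ler_piMl ?normc_ge0// -(rmorphB (real_complex R) _ 1) normc_real.
    by have /andP[? ?] := k01 n t; rewrite ler_norml; apply/andP; split; lra.
  - move=> t; apply: cvg_near_cst; near=> n.
    rewrite /g /k !indicE !mem_set ?mulr1 ?mul1r ?subrr ?Normc.normc0//.
    + by rewrite /=; near: n; exact: nbhs_infty_ger.
    + by rewrite /= in_itv/= -ler_norml; near: n; exact: nbhs_infty_ger.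
have [n0 _ /(_ n0 (leqnn n0)) H] := cvgr_le _ gf _ e0.
exists (g n0); split => //; last by rewrite n2BC.
(* The [+ 1] keeps the bound and the radius positive when [n0] is [0]. *)
have gM t : normc (g n0 t) <= n0%:R + 1.
  rewrite /g /k !indicE Normc.normcM normc_real.
  case: (boolP (t \in [set t | normc (f t) <= n0%:R])) => tn; last by rewrite mulr0 normr0 mul0r.
  move: tn; rewrite inE/= => tn; case: (_ \in _); rewrite ?mul0r ?normr0 ?mul0r//.
  by rewrite mulr1 normr1 mul1r (le_trans tn)// lerDl.
have g0 t : n0%:R + 1 < `|t| -> g n0 t = 0.
  move=> tn; rewrite /g /k indicE memNset ?mul0r//= in_itv/= -ler_norml.
  by apply/negP; rewrite -ltNge (le_lt_trans _ tn)// lerDl.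
have n01 : (0 : R) < n0%:R + 1 by rewrite ltr_wpDl.
have reI : g n0 = (fun t => (complex.Re (g n0 t))%:C + 'i%C * (complex.Im (g n0 t))%:C).
  by apply/funext => t; rewrite -complexE.
have [mg1 mg2] := L2_measurable (gL2 n0).
have re2 : L2 (fun t => (complex.Re (g n0 t))%:C).
  apply: (@L2_le _ _ (g n0) 1) => //.
  by move=> t; rewrite normc_real mul1r normc_Re.
have im2 : L2 (fun t => (complex.Im (g n0 t))%:C).
  apply: (@L2_le _ _ (g n0) 1) => //.
  by move=> t; rewrite normc_real mul1r normc_Im.
rewrite reI; apply: shift_continuousD => //; first exact: L2Z.
  apply: (@shift_continuous_bounded _ (n0%:R + 1) (n0%:R + 1)) => //.
    by move=> t; rewrite (le_trans (normc_Re _)).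
  by move=> t /g0 ->.
apply: shift_continuousZ => //.
apply: (@shift_continuous_bounded _ (n0%:R + 1) (n0%:R + 1)) => //.
  by move=> t; rewrite (le_trans (normc_Im _)).
by move=> t /g0 ->.
Unshelve. all: by end_near. Qed.

End TranslationContinuity.

Section SigmaFiniteProduct.
Context {R : realType} {d1 d2 : measure_display}.
Context {X : measurableType d1} {Y : measurableType d2}.
Variables (m1 : {sigma_finite_measure set X -> \bar R}).
Variables (m2 : {sigma_finite_measure set Y -> \bar R}).

Lemma sigma_finite_product : sigma_finite setT (m1 \x m2)%E.
Proof.
have /sigma_finiteP[F [FT Fnd Foo]] := sigma_finiteT m1.
have /sigma_finiteP[G [GT Gnd Goo]] := sigma_finiteT m2.
exists (fun n => F n `*` G n) => [|n]; last first.
  have [[mF Fn] [mG Gn]] := (Foo n, Goo n); split; first exact: measurableX.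
  by rewrite product_measure1E// lte_mul_pinfty// ge0_fin_numE.
apply/esym/seteqP; split => // -[x y] _.
have [i _ Fi] : (\bigcup_i F i) x by rewrite -FT.
have [j _ Gj] : (\bigcup_i G i) y by rewrite -GT.
exists (maxn i j) => //; split => /=.
- by apply: (subsetPset _ _ (Fnd _ _ (leq_maxl i j))).
- by apply: (subsetPset _ _ (Gnd _ _ (leq_maxr i j))).
Qed.

(* Has to be passed explicitly: inference finds no sigma-finite structure on a product. *)
Definition sigma_finite_prod : {sigma_finite_measure set (X * Y)%type -> \bar R} :=
  HB.pack (m1 \x m2)%E
    (Measure_isSigmaFinite.Build _ _ _ (m1 \x m2)%E sigma_finite_product).

End SigmaFiniteProduct.

(** * The Poisson kernel and the damped Fourier energy *)

Section Plancherel.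
Context {R : realType}.
Local Notation leb := (@lebesgue_measure R).
Local Notation normc := (@Normc.normc R).
Implicit Types f g : R -> R[i].

Lemma realcM (a b : R) : (a * b)%:C = a%:C * b%:C :> R[i].
Proof. exact: rmorphM. Qed.

Lemma cintegrable_expi {d} {T : measurableType d} (mu : {measure set T -> \bar R})
    (f : T -> R[i]) (u : T -> R) : measurable_fun setT u ->
  cintegrable mu f -> cintegrable mu (fun t => f t * expi (u t)).
Proof.
move=> mu' fi; apply: cintegrable_le (cintegrable_normc fi) _.
  by apply: cmeasurableM; [exact: cintegrable_measurable fi|exact: cmeasurable_expi].
by move=> t; rewrite Normc.normcM normc_expi mulr1.
Qed.

Lemma fourier_integrable f xi : L1 f ->
  cintegrable leb (fun t => f t * expi (- (2 * pi * t * xi))).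
Proof.
move=> fi; apply: cintegrable_expi => //; apply: measurableT_comp => //.
by apply: measurable_funM => //; exact: mulrl_measurable.
Qed.

Lemma cmeasurable_fourier f : L1 f -> cmeasurable (fourier f).
Proof.
move=> fi; apply: (@cmeasurable_cintegral1 _ _ _ _ _ leb
  (fun z : R * R => f z.2 * expi (- (2 * pi * z.2 * z.1)))).
apply: cmeasurableM.
  exact: (cmeasurable_comp measurable_snd (cintegrable_measurable fi)).
apply: cmeasurable_expi; apply: measurableT_comp => //.
apply: measurable_funM; last exact: measurable_fst.
by apply: measurable_funM => //; exact: measurable_snd.
Qed.

Lemma normc_fourier_le f xi : L1 f -> normc (fourier f xi) <= \int[leb]_t normc (f t).
Proof.
move=> fi; apply: le_trans (normc_cintegral (fourier_integrable xi fi)) _.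
rewrite le_eqVlt; apply/orP; left; apply/eqP/eq_Rintegral => t _.
by rewrite Normc.normcM normc_expi mulr1.
Qed.

Lemma integrable_laplaceM (a : R) : 0 < a ->
  leb.-integrable setT (fun x => (laplace (a * x))%:E).
Proof.
move=> a0; have := @integrable_affine R a 0 _ a0 integrable_laplace.
by under eq_fun do rewrite addr0.
Qed.

Lemma cintegrable_laplace_expi (c : R) :
  cintegrable leb (fun x => (laplace x)%:C * expi (- (c * x))).
Proof.
apply: cintegrable_expi.
  by apply: measurableT_comp => //; exact: mulrl_measurable.
split; first exact: integrable_laplace.
exact: integrable0.
Qed.

Lemma cintegral_laplace_expi (c : R) :
  cintegral leb (fun x => (laplace x)%:C * expi (- (c * x))) = (cauchyk c)%:C.
Proof.
apply: complex_ext; rewrite /cintegral/=.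
  rewrite -Rintegral_laplace_cos; apply: eq_Rintegral => x _.
  by rewrite cosN mul0r subr0.
transitivity (-1 * \int[leb]_x (laplace x * sin (c * x))); last first.
  by rewrite Rintegral_laplace_sin mulr0.
rewrite -RintegralZl//; last exact: integrable_laplace_sin.
by apply: eq_Rintegral => x _; rewrite sinN; ring.
Qed.

(** The Poisson kernel of the upper half-plane at height [a / (2 * pi)]. It is the Fourier transform
    of the damping factor [laplace (a * x)]. *)
Definition poisson (a u : R) : R := a^-1 * cauchyk (2 * pi / a * u).

Lemma poisson_ge0 a u : 0 < a -> 0 <= poisson a u.
Proof. by move=> a0; rewrite mulr_ge0 ?cauchyk_ge0// invr_ge0 ltW. Qed.

Lemma measurable_poisson a : measurable_fun setT (poisson a).
Proof.
apply: measurable_funM => //; apply: measurableT_comp; first exact: measurable_cauchyk.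
exact: mulrl_measurable.
Qed.

Lemma poissonN a u : poisson a (- u) = poisson a u.
Proof. by rewrite /poisson /cauchyk mulrN sqrrN. Qed.

Lemma cintegral_laplaceM_expi (a u : R) : 0 < a ->
  cintegral leb (fun x => (laplace (a * x))%:C * expi (- (2 * pi * u * x))) =
  (poisson a u)%:C.
Proof.
move=> a0; have aN0 : a != 0 by rewrite gt_eqF.
rewrite /poisson realcM -cintegral_laplace_expi.
rewrite -(cintegral_affine 0 a0); last exact: cintegrable_laplace_expi.
apply: eq_cintegral => x; rewrite addr0; congr (_ * expi (- _)).
by field.
Qed.

Lemma integral_poisson (a b : R) : 0 < a ->
  (\int[leb]_u (poisson a (u - b))%:E = 1)%E.
Proof.
move=> a0; have p0 : (0 : R) < 2 * pi by rewrite mulr_gt0// pi_gt0.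
have pN0 : (pi : R) != 0 by rewrite gt_eqF// pi_gt0.
have aN0 : a != 0 by rewrite gt_eqF.
have H := @ge0_integral_affine R (2 * pi / a) (- (2 * pi / a * b))
  (fun u => (a^-1 * cauchyk u)%:E) (divr_gt0 p0 a0).
transitivity (\int[leb]_t (a^-1 * cauchyk (2 * pi / a * t - 2 * pi / a * b))%:E)%E.
  by apply: eq_integral => u _; rewrite /poisson mulrBr.
rewrite H.
- under eq_integral do rewrite EFinM.
  rewrite ge0_integralZl_EFin; [|exact: measurableT|
    by move=> u _; rewrite lee_fin cauchyk_ge0|
    by apply/measurable_EFinP; exact: measurable_cauchyk|
    by rewrite invr_ge0 ltW].
  by rewrite integral_cauchyk -!EFinM; congr EFin; move: pN0; move: (pi : R) => p pN0; field; rewrite aN0 pN0.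
- by apply/measurable_EFinP; apply: measurable_funM => //; exact: measurable_cauchyk.
- by move=> u; rewrite lee_fin mulr_ge0 ?cauchyk_ge0// invr_ge0 ltW.
Qed.

Local Notation leb2 := (leb \x leb)%E.

Lemma measurable_phase (xi : R) :
  measurable_fun setT (fun z : R * R => - (2 * pi * (z.1 - z.2) * xi)).
Proof.
apply: measurableT_comp => //; apply: measurable_funM => //.
apply: measurable_funM => //; apply: measurable_funB.
  exact: measurable_fst.
exact: measurable_snd.
Qed.

Lemma normc_sqr_fourier f xi : L1 f ->
  (normc (fourier f xi) ^+ 2)%:C = cintegral leb2
    (fun z => f z.1 * conjc (f z.2) * expi (- (2 * pi * (z.1 - z.2) * xi))).
Proof.
move=> fi; rewrite -mul_conjc /fourier -cintegral_conj; last exact: fourier_integrable.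
rewrite -cintegral_tensor; [|exact: fourier_integrable|
  by apply: cintegrable_conj; exact: fourier_integrable].
apply: eq_cintegral => z; rewrite conjcM -expiN mulrACA -expiD.
by congr (_ * expi _); ring.
Qed.

(** Writing the squared transform as a double integral gives a triple integral that the damping
    makes absolutely convergent; integrating the frequency first leaves the Poisson kernel. *)
Lemma laplace_fourier f a : L1 f -> 0 < a ->
  cintegral leb (fun xi => (laplace (a * xi) * normc (fourier f xi) ^+ 2)%:C) =
  cintegral leb2 (fun z => f z.1 * conjc (f z.2) * (poisson a (z.1 - z.2))%:C).
Proof.
move=> fi a0.
have gi : cintegrable (sigma_finite_prod leb leb) (fun z => f z.1 * conjc (f z.2)) :=
  cintegrable_tensor fi (cintegrable_conj fi).
have li : cintegrable leb (fun x => (laplace (a * x))%:C).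
  by split; [exact: integrable_laplaceM|exact: integrable0].
have mw : measurable_fun setT (fun w : R * (R * R) =>
    - (2 * pi * (w.2.1 - w.2.2) * w.1)).
  apply: measurableT_comp => //; apply: measurable_funM; last exact: measurable_fst.
  apply: measurable_funM => //; apply: measurable_funB.
    exact: (measurableT_comp measurable_fst measurable_snd).
  exact: (measurableT_comp measurable_snd measurable_snd).
have ti := cintegrable_tensor li gi.
have /(_ (fun w => - (2 * pi * (w.2.1 - w.2.2) * w.1)) mw) Hi :=
  fun u mu => cintegrable_expi (u := u) mu ti.
have := cintegral12_prod Hi; rewrite -(cintegral21_prod Hi) => E.
apply: etrans (etrans E _).
  apply: eq_cintegral => xi; rewrite realcM normc_sqr_fourier// -cintegralZ.
    by apply: eq_cintegral => z; rewrite /= mulrA.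
  by apply: cintegrable_expi gi; exact: measurable_phase.
apply: eq_cintegral => z; rewrite -cintegral_laplaceM_expi// -cintegralZ.
  by apply: eq_cintegral => xi; rewrite /=; ring.
apply: cintegrable_expi => //; apply: measurableT_comp => //.
Qed.

Lemma measurable_poissonB a : measurable_fun setT (fun z : R * R => poisson a (z.1 - z.2)).
Proof.
apply: measurableT_comp; first exact: measurable_poisson.
by apply: measurable_funB; [exact: measurable_fst|exact: measurable_snd].
Qed.

Lemma integral_poisson_fst f a : cmeasurable f -> 0 < a ->
  (\int[leb2]_z (normc (f z.1) ^+ 2 * poisson a (z.1 - z.2))%:E = N2 f)%E.
Proof.
move=> mf a0; rewrite fubini_tonelli1; last 2 first.
- apply/measurable_EFinP; apply: measurable_funM; last exact: measurable_poissonB.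
  apply: measurable_normc_sqr; exact: (cmeasurable_comp measurable_fst mf).
- by move=> z; rewrite lee_fin mulr_ge0 ?sqr_ge0 ?poisson_ge0.
apply: eq_integral => x _; rewrite /fubini_F/=.
under eq_integral do rewrite EFinM -poissonN opprB.
rewrite ge0_integralZl_EFin; [|exact: measurableT|
  by move=> u _; rewrite lee_fin poisson_ge0| |exact: sqr_ge0].
  by rewrite integral_poisson// mule1.
apply/measurable_EFinP; apply: measurableT_comp; first exact: measurable_poisson.
exact: measurable_funB.
Qed.

Lemma integral_poisson_snd f a : cmeasurable f -> 0 < a ->
  (\int[leb2]_z (normc (f z.2) ^+ 2 * poisson a (z.1 - z.2))%:E = N2 f)%E.
Proof.
move=> mf a0; rewrite fubini_tonelli2; last 2 first.
- apply/measurable_EFinP; apply: measurable_funM; last exact: measurable_poissonB.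
  apply: measurable_normc_sqr; exact: (cmeasurable_comp measurable_snd mf).
- by move=> z; rewrite lee_fin mulr_ge0 ?sqr_ge0 ?poisson_ge0.
apply: eq_integral => x _; rewrite /fubini_G/=.
under eq_integral do rewrite EFinM.
rewrite ge0_integralZl_EFin; [|exact: measurableT|
  by move=> u _; rewrite lee_fin poisson_ge0| |exact: sqr_ge0].
  by rewrite integral_poisson// mule1.
apply/measurable_EFinP; apply: measurableT_comp; first exact: measurable_poisson.
exact: measurable_funB.
Qed.

Lemma cmeasurable_shiftB f : cmeasurable f ->
  cmeasurable (fun z : R * R => f (z.2 + z.1) - f z.2).
Proof.
move=> mf; apply: cmeasurableB; last exact: (cmeasurable_comp measurable_snd mf).
apply: (@cmeasurable_comp _ _ _ _ _ (fun z : R * R => z.2 + z.1) f) => //.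
by apply: measurable_funD; [exact: measurable_snd|exact: measurable_fst].
Qed.

Lemma measurable_N2_shift f : cmeasurable f ->
  measurable_fun setT (fun u => N2 (fun t => f (t + u) - f t)).
Proof.
move=> mf; apply: (@measurable_fun_fubini_tonelli_F _ _ _ _ _ leb
  (fun z : R * R => (normc (f (z.2 + z.1) - f z.2) ^+ 2)%:E)).
  by apply/measurable_EFinP/measurable_normc_sqr; exact: cmeasurable_shiftB.
by move=> z; rewrite lee_fin sqr_ge0.
Qed.

Lemma integral_poisson_diff f a : cmeasurable f -> 0 < a ->
  (\int[leb2]_z (normc (f z.1 - f z.2) ^+ 2 * poisson a (z.1 - z.2))%:E =
   \int[leb]_u ((poisson a u)%:E * N2 (fun t => f (t + u) - f t)%R))%E.
Proof.
move=> mf a0.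
have m1 : cmeasurable (fun z : R * R => f z.1 - f z.2).
  by apply: cmeasurableB; [exact: (cmeasurable_comp measurable_fst mf)|
    exact: (cmeasurable_comp measurable_snd mf)].
have m2 : measurable_fun setT (fun z : R * R =>
    (normc (f z.1 - f z.2) ^+ 2 * poisson a (z.1 - z.2))%:E).
  apply/measurable_EFinP; apply: measurable_funM; last exact: measurable_poissonB.
  exact: measurable_normc_sqr.
rewrite fubini_tonelli2//; last first.
  by move=> z; rewrite lee_fin mulr_ge0 ?sqr_ge0 ?poisson_ge0.
(* The same integrand in the coordinates [u = z.1 - z.2] and [t = z.2]; translation invariance at
   fixed [t] justifies the substitution. *)
pose K (z : R * R) := (normc (f (z.2 + z.1) - f z.2) ^+ 2 * poisson a z.1)%:E.
transitivity (\int[leb]_t \int[leb]_u K (u, t))%E.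
  apply: eq_integral => t _; rewrite /fubini_G/=.
  have H := @ge0_integral_affine R 1 t
    (fun x => (normc (f x - f t) ^+ 2 * poisson a (x - t))%:E) ltr01.
  rewrite invr1 mul1e in H; rewrite -H.
  - by apply: eq_integral => u _; rewrite /K/= mul1r addrK (addrC t u).
  - exact: (measurableT_comp m2 (@pair2_measurable _ _ _ _ t)).
  - by move=> x; rewrite lee_fin mulr_ge0 ?sqr_ge0 ?poisson_ge0.
transitivity (\int[leb]_u \int[leb]_t K (u, t))%E.
  apply/esym/(@fubini_tonelli _ _ _ _ _ leb leb K).
    apply/measurable_EFinP; apply: measurable_funM.
      by apply: measurable_normc_sqr; exact: cmeasurable_shiftB.
    exact: (measurableT_comp (measurable_poisson a) measurable_fst).
  by move=> z; rewrite lee_fin mulr_ge0 ?sqr_ge0 ?poisson_ge0.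
apply: eq_integral => u _; rewrite /N2 -ge0_integralZl_EFin; [|exact: measurableT|
  by move=> t _; rewrite lee_fin sqr_ge0| |exact: poisson_ge0].
  by apply: eq_integral => t _; rewrite /K/= mulrC EFinM.
apply/measurable_EFinP/measurable_normc_sqr.
apply: cmeasurableB => //; exact: (cmeasurable_comp (measurable_shift u) mf).
Qed.

End Plancherel.

(** * Plancherel's theorem by removal of the damping *)

Section PlancherelTheorem.
Context {R : realType}.
Local Notation leb := (@lebesgue_measure R).
Local Notation normc := (@Normc.normc R).
Local Notation leb2 := (leb \x leb)%E.
Implicit Types f g : R -> R[i].

Lemma Re_mul_conjc (x y : R[i]) :
  complex.Re (x * conjc y) = 2^-1 * (normc x ^+ 2 + normc y ^+ 2 - normc (x - y) ^+ 2).
Proof. by rewrite !normc_sqr !cE; field. Qed.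

Lemma Re_mul_real (x : R[i]) (r : R) : complex.Re (x * r%:C) = complex.Re x * r.
Proof. by rewrite cReM/= mulr0 subr0. Qed.

Lemma integrable_laplace_fourier f a : L1 f -> 0 < a ->
  leb.-integrable setT
    (fun xi => (laplace (a * xi) * normc (fourier f xi) ^+ 2)%:E).
Proof.
move=> fi a0; pose M := \int[leb]_t normc (f t).
apply: (le_integrable measurableT _ _ (integrableZl measurableT (M ^+ 2) (integrable_laplaceM a0))).
  apply/measurable_EFinP; apply: measurable_funM.
    by apply: measurableT_comp; [exact: measurable_laplace|exact: mulrl_measurable].
  exact/measurable_normc_sqr/cmeasurable_fourier.
move=> xi _; rewrite -EFinM !abse_EFin lee_fin.
rewrite (ger0_norm (mulr_ge0 (laplace_ge0 _) (sqr_ge0 _))).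
rewrite (ger0_norm (mulr_ge0 (sqr_ge0 _) (laplace_ge0 _))) mulrC.
have M0 : 0 <= M by apply: Rintegral_ge0 => t _; exact: normc_ge0.
by rewrite ler_wpM2r ?laplace_ge0// lerXn2r ?nnegrE ?normc_ge0// normc_fourier_le.
Qed.

(** By the polarisation identity [Re_mul_conjc] the double integral of [laplace_fourier] splits into
    three nonnegative ones. Two of them equal [n2 f], since the Poisson kernel has mass one in
    either variable; the third is the averaged energy of [f (. + u) - f]. *)
Lemma poisson_energy f a : L1 f -> L2 f -> 0 < a ->
  (\int[leb]_xi (laplace (a * xi) * normc (fourier f xi) ^+ 2)%:E =
   (n2 f)%:E - (2^-1)%:E * \int[leb]_u ((poisson a u)%:E *
     N2 (fun t => f (t + u) - f t)%R))%E.
Proof.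
move=> fi f2 a0; have mf := L2_measurable f2.
have i0 := integrable_laplace_fourier fi a0.
pose W1 (z : R * R) := normc (f z.1) ^+ 2 * poisson a (z.1 - z.2).
pose W2 (z : R * R) := normc (f z.2) ^+ 2 * poisson a (z.1 - z.2).
pose W3 (z : R * R) := normc (f z.1 - f z.2) ^+ 2 * poisson a (z.1 - z.2).
have m1 : cmeasurable (fun z : R * R => f z.1) by exact: (cmeasurable_comp measurable_fst mf).
have m2 : cmeasurable (fun z : R * R => f z.2) by exact: (cmeasurable_comp measurable_snd mf).
have pos (x : R[i]) u : 0 <= normc x ^+ 2 * poisson a u.
  by rewrite mulr_ge0 ?sqr_ge0 ?poisson_ge0.
have i1 : leb2.-integrable setT (EFin \o W1).
  apply/integrableP; split.
    apply/measurable_EFinP; apply: measurable_funM; last exact: measurable_poissonB.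
    exact: measurable_normc_sqr.
  under eq_integral => z _ do rewrite /= ger0_norm ?pos//.
  by rewrite integral_poisson_fst// L2_n2E ?ltry.
have i2 : leb2.-integrable setT (EFin \o W2).
  apply/integrableP; split.
    apply/measurable_EFinP; apply: measurable_funM; last exact: measurable_poissonB.
    exact: measurable_normc_sqr.
  under eq_integral => z _ do rewrite /= ger0_norm ?pos//.
  by rewrite integral_poisson_snd// L2_n2E ?ltry.
have i3 : leb2.-integrable setT (EFin \o W3).
  apply: (le_integrable measurableT _ _
    (integrableZl measurableT 2 (integrableD measurableT i1 i2))).
    apply/measurable_EFinP; apply: measurable_funM; last exact: measurable_poissonB.
    by apply: measurable_normc_sqr; exact: cmeasurableB.
  move=> z _ /=; rewrite lee_fin ger0_norm ?pos//.
  apply: le_trans (ler_norm _); rewrite /W1 /W2 /W3 -mulrDl [leRHS]mulrA.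
  rewrite ler_wpM2r ?poisson_ge0// mulrDr.
  by have := normc_sqrD (f z.1) (- f z.2); rewrite normc_opp.
have E := congr1 (@complex.Re R) (laplace_fourier fi a0).
rewrite /cintegral/= in E.
have {}E : \int[leb]_xi (laplace (a * xi) * normc (fourier f xi) ^+ 2) =
    2^-1 * (\int[leb2]_z W1 z + \int[leb2]_z W2 z - \int[leb2]_z W3 z).
  rewrite E -RintegralD// -RintegralB//; last first.
    exact: (integrableD measurableT i1 i2).
  rewrite -RintegralZl//; last first.
    exact: (integrableB measurableT (integrableD measurableT i1 i2) i3).
  apply: eq_Rintegral => z _; rewrite [LHS](Re_mul_real _ _) Re_mul_conjc.
  by rewrite /W1 /W2 /W3; ring.
have F0 := integrable_fin_num measurableT i0.
rewrite -(fineK F0).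
rewrite -(integral_poisson_diff mf a0).
have F3 := integrable_fin_num measurableT i3.
rewrite -(fineK F3) -EFinM -EFinB; congr EFin.
rewrite -[LHS]/(\int[leb]_xi (laplace (a * xi) * normc (fourier f xi) ^+ 2)) E.
rewrite -[fine _]/(\int[leb2]_z W3 z).
have -> : \int[leb2]_z W1 z = n2 f by rewrite /Rintegral integral_poisson_fst.
have -> : \int[leb2]_z W2 z = n2 f by rewrite /Rintegral integral_poisson_snd.
by field.
Qed.

Lemma n2_shiftB_le f u : L2 f -> n2 (fun t => f (t + u) - f t) <= 4 * n2 f.
Proof.
move=> f2; apply: le_trans (n2D (L2_shift u f2) (L2N f2)) _.
rewrite /n2 N2N (N2_shift _ (L2_measurable f2)); lra.
Qed.

(** Moves [a] from the kernel into the shift. The fixed function [4 * n2 f * cauchyk v] then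
    dominates for every [a], and the limit [a -> 0] becomes pointwise continuity of translations. *)
Lemma poisson_scale f a : cmeasurable f -> 0 < a ->
  (\int[leb]_u ((poisson a u)%:E * N2 (fun t => f (t + u) - f t)%R) =
   ((2 * pi)^-1)%:E * \int[leb]_v ((cauchyk v)%:E *
     N2 (fun t => f (t + a / (2 * pi) * v) - f t)%R))%E.
Proof.
move=> mf a0; have p0 : (0 : R) < 2 * pi by rewrite mulr_gt0// pi_gt0.
have pN0 : (2 * pi : R) != 0 by rewrite gt_eqF.
have aN0 : a != 0 by rewrite gt_eqF.
have mN : measurable_fun setT (fun v : R => (N2 (fun t => f (t + a / (2 * pi) * v) - f t))).
  apply: (measurableT_comp (measurable_N2_shift mf)).
  exact: mulrl_measurable.
have H := @ge0_integral_affine R (2 * pi / a) 0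
  (fun v => (a^-1 * cauchyk v)%:E * N2 (fun t => f (t + a / (2 * pi) * v) - f t)%R)%E
  (divr_gt0 p0 a0).
transitivity (\int[leb]_u ((a^-1 * cauchyk (2 * pi / a * u + 0))%:E *
  N2 (fun t => f (t + a / (2 * pi) * (2 * pi / a * u + 0)) - f t)%R))%E.
  apply: eq_integral => u _; rewrite addr0 /poisson.
  rewrite (_ : a / (2 * pi) * (2 * pi / a * u) = u)//.
  by move: pN0; move: (2 * pi : R) => p pN0; field; rewrite aN0 pN0.
rewrite H.
- rewrite [X in _ = (X * _)%E](_ : _ = ((2 * pi / a)^-1)%:E * (a^-1)%:E)%E; last first.
    rewrite -EFinM; congr EFin.
    by move: pN0; move: (2 * pi : R) => p pN0; field; rewrite aN0 pN0.
  rewrite -muleA; congr (_ * _)%E.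
  rewrite -ge0_integralZl_EFin; [|exact: measurableT| | |by rewrite invr_ge0 ltW].
  + by apply: eq_integral => v _; rewrite EFinM muleA.
  + by move=> v _; rewrite mule_ge0 ?N2_ge0// lee_fin cauchyk_ge0.
  + apply: emeasurable_funM => //; apply/measurable_EFinP; exact: measurable_cauchyk.
- apply: emeasurable_funM => //; apply/measurable_EFinP.
  by apply: measurable_funM => //; exact: measurable_cauchyk.
- by move=> v; rewrite mule_ge0 ?N2_ge0// lee_fin mulr_ge0 ?cauchyk_ge0// invr_ge0 ltW.
Qed.

Lemma cvg_poisson f (a_ : nat -> R) : L2 f -> (forall n, 0 < a_ n) ->
  a_ n @[n --> \oo] --> (0 : R) ->
  (\int[leb]_u ((poisson (a_ n) u)%:E * N2 (fun t => f (t + u) - f t)%R))%E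
    @[n --> \oo] --> 0%E.
Proof.
move=> f2 a0 al; have mf := L2_measurable f2.
rewrite (_ : (fun n => _) = (fun n => ((2 * pi)^-1)%:E *
  \int[leb]_v (cauchyk v * n2 (fun t => f (t + a_ n / (2 * pi) * v) - f t))%:E)%E); last first.
  apply/funext => n; rewrite poisson_scale//; congr (_ * _)%E.
  apply: eq_integral => v _; rewrite L2_n2E ?EFinM//.
  by apply: L2B => //; exact: L2_shift.
rewrite -(mule0 ((2 * pi)^-1)%:E); apply: cvgeZl => //.
have md n : measurable_fun setT (fun v : R => cauchyk v * n2 (fun t => f (t + a_ n / (2 * pi) * v) - f t)).
  apply: measurable_funM; first exact: measurable_cauchyk.
  apply: (@measurableT_comp _ _ _ _ _ _ (fun u : R => n2 (fun t => f (t + u) - f t))).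
    apply: (@measurableT_comp _ _ _ _ _ _ (@fine R)); first exact: fine_measurable.
    exact: measurable_N2_shift.
  exact: mulrl_measurable.
have ic : leb.-integrable setT (EFin \o (@cauchyk R)).
  apply/integrableP; split; first by apply/measurable_EFinP; exact: measurable_cauchyk.
  under eq_integral do rewrite /= ger0_norm ?cauchyk_ge0//.
  by rewrite integral_cauchyk ltry.
have [] := @dominated_convergence _ _ _ leb setT measurableT
  (fun n v => (cauchyk v * n2 (fun t => f (t + a_ n / (2 * pi) * v) - f t))%:E)
  (fun=> 0%E) (fun v => ((4 * n2 f)%:E * (cauchyk v)%:E)%E).
- by move=> n; apply/measurable_EFinP; exact: md.
- by [].
- apply: aeW => v _; apply/fine_cvgP; split; first by apply: nearW.
  rewrite -[X in _ --> X](mulr0 (cauchyk v)); apply: cvgM; first exact: cvg_cst.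
  apply: (shift_continuous_L2 f2).
  rewrite -[X in _ --> X](mul0r ((2 * pi)^-1 * v)).
  under eq_fun do rewrite -mulrA.
  by apply: cvgM => //; exact: cvg_cst.
- exact: integrableZl.
- apply: aeW => v n _; rewrite abse_EFin (ger0_norm (mulr_ge0 (cauchyk_ge0 _) (n2_ge0 _))).
  rewrite -EFinM lee_fin; by rewrite mulrC ler_wpM2r ?cauchyk_ge0// n2_shiftB_le.
by move=> _ _; rewrite integral0.
Qed.

(** The damping factors increase to [1], so monotone convergence applies before the transform is
    known to be square-integrable; its finite energy is a result of [plancherel_L1]. *)
Lemma cvg_laplace_fourier f : L1 f ->
  (\int[leb]_xi (laplace (n.+1%:R^-1 * xi) * normc (fourier f xi) ^+ 2)%:E)%E
    @[n --> \oo] --> N2 (fourier f).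
Proof.
move=> fi; have mF := cmeasurable_fourier fi.
have := @cvg_monotone_convergence _ _ _ leb setT measurableT
  (fun n xi => (laplace (n.+1%:R^-1 * xi) * normc (fourier f xi) ^+ 2)%:E).
rewrite (_ : (\int[leb]_x limn _ = N2 (fourier f))%E); last first.
  apply: eq_integral => xi _; apply/cvg_lim => //.
  apply/fine_cvgP; split; first by apply: nearW.
  rewrite -[X in _ --> X]mul1r; apply: cvgM; last exact: cvg_cst.
  rewrite [X in _ --> X](_ : 1 = laplace 0); last by rewrite /laplace normr0 oppr0 expR0.
  apply: continuous_cvg; first exact: laplace_continuous.
  rewrite -[X in _ --> X](mul0r xi); apply: cvgM; last exact: cvg_cst.
  exact: (@cvg_harmonic R).
apply.
- move=> n; apply/measurable_EFinP; apply: measurable_funM.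
    by apply: measurableT_comp; [exact: measurable_laplace|exact: mulrl_measurable].
  exact: measurable_normc_sqr.
- by move=> n xi _; rewrite lee_fin mulr_ge0 ?laplace_ge0 ?sqr_ge0.
- move=> xi _ n m nm; rewrite lee_fin ler_wpM2r ?sqr_ge0//.
  rewrite /laplace ler_expR lerN2 !normrM ler_wpM2r//.
  by rewrite !ger0_norm ?invr_ge0// lef_pV2 ?posrE ?ltr0n// ler_nat.
Qed.

Theorem plancherel_L1 f : L1 f -> L2 f -> N2 (fourier f) = N2 f.
Proof.
move=> fi f2; have a0 n : (0 : R) < n.+1%:R^-1 by rewrite invr_gt0 ltr0n.
have H1 := cvg_laplace_fourier fi.
have H2 := cvg_poisson f2 a0 (@cvg_harmonic R).
have H3 : (\int[leb]_xi (laplace (n.+1%:R^-1 * xi) * normc (fourier f xi) ^+ 2)%:E)%E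
    @[n --> \oo] --> N2 f.
  have -> := funext (fun n => poisson_energy fi f2 (a0 n)).
  rewrite L2_n2E// -[X in _ --> X]sube0 -(mule0 (2^-1)%:E).
  apply: cvgeB => //; last exact: cvgeZl.
  exact: cvg_cst.
exact: cvg_unique H1 H3.
Qed.

End PlancherelTheorem.

(** * The Fourier transform on L2 and Fourier multipliers *)

Section FourierL2.
Context {R : realType}.
Local Notation leb := (@lebesgue_measure R).
Local Notation normc := (@Normc.normc R).
Implicit Types f g : R -> R[i].

Lemma fourier_L2 f : L1 f -> L2 f -> L2 (fourier f).
Proof.
move=> fi f2; apply/L2P; split; first exact: cmeasurable_fourier.
by rewrite plancherel_L1// L2_n2E ?ltry.
Qed.

Lemma fourierD f g : L1 f -> L1 g ->
  fourier (fun t => f t + g t) = (fun xi => fourier f xi + fourier g xi).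
Proof.
move=> fi gi; apply/funext => xi; rewrite /fourier -cintegralD; [|exact: fourier_integrable..].
by apply: eq_cintegral => t; rewrite mulrDl.
Qed.

Lemma fourierZ a f : L1 f -> fourier (fun t => a * f t) = (fun xi => a * fourier f xi).
Proof.
move=> fi; apply/funext => xi; rewrite /fourier -cintegralZ; last exact: fourier_integrable.
by apply: eq_cintegral => t; rewrite mulrA.
Qed.

Lemma n2D_inner f g : L2 f -> L2 g ->
  n2 (fun t => f t + g t) = n2 f + n2 g + 2 * complex.Re (inner f g).
Proof.
move=> f2 g2; have fg2 := L2D f2 g2.
have := inner_self (fun t => f t + g t).
rewrite innerDl// !innerDr// !inner_self (inner_conj f2 g2).
move=> /(congr1 (@complex.Re R)); rewrite !cE => /esym.
by move: (inner f g) => z /= ->; ring.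
Qed.

Lemma plancherel_n2 f : L1 f -> L2 f -> n2 (fourier f) = n2 f.
Proof. by move=> fi f2; rewrite /n2 plancherel_L1. Qed.

Lemma plancherel_inner f g : L1 f -> L2 f -> L1 g -> L2 g ->
  inner (fourier f) (fourier g) = inner f g.
Proof.
move=> fi f2 gi g2.
have re h : L1 h -> L2 h ->
    complex.Re (inner (fourier h) (fourier g)) = complex.Re (inner h g).
  move=> hi h2; have Fh2 := fourier_L2 hi h2; have Fg2 := fourier_L2 gi g2.
  have := plancherel_n2 (cintegrableD hi gi) (L2D h2 g2).
  rewrite fourierD// !n2D_inner// !plancherel_n2//; lra.
apply: complex_ext; first exact: re.
(* Multiplication by ['i] turns the real part of the inner product into minus its imaginary part. *)
have := re _ (cintegrableZ 'i%C fi) (L2Z 'i%C f2).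
rewrite fourierZ// !innerZl//; [|exact: fourier_L2..].
rewrite !cE; move: (inner _ _) (inner f g) => x y /=; lra.
Qed.

Lemma fourierL2P f g : fourierL2 f g <-> [/\ L2 f, L2 g &
  exists2 f_ : nat -> R -> R[i], forall n, L1 (f_ n) /\ L2 (f_ n) &
    cvgL2 f_ f /\ cvgL2 (fun n => fourier (f_ n)) g].
Proof.
split=> [[f2 g2 [f_ [fi fc gc]]]|[f2 g2 [f_ fi [fc gc]]]]; split => //; exists f_ => //.
  split; first by apply/(L2norm_cvg0 _).1 => // n; apply: L2B => //; case: (fi n).
  apply/(L2norm_cvg0 _).1 => // n; apply: L2B => //; have [? ?] := fi n.
  exact: fourier_L2.
split => //.
  by apply/(L2norm_cvg0 _).2 => // n; apply: L2B => //; case: (fi n).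
apply/(L2norm_cvg0 _).2 => // n; apply: L2B => //; have [? ?] := fi n.
exact: fourier_L2.
Qed.

Lemma fourierL2_L1 f : L1 f -> L2 f -> fourierL2 f (fourier f).
Proof.
move=> fi f2; apply/fourierL2P; have F2 := fourier_L2 fi f2.
have cst h : L2 h -> cvgL2 (fun _ => h) h.
  move=> h2; rewrite /cvgL2 ae_n2_eq0; [exact: cvg_cst|exact: L2_measurable..|].
  exact: aeW.
by split => //; exists (fun _ => f) => //; split; exact: cst.
Qed.

Lemma fourierL2_inner f F g G : fourierL2 f F -> fourierL2 g G -> inner f g = inner F G.
Proof.
move=> /fourierL2P[f2 F2 [f_ fi [fc Fc]]] /fourierL2P[g2 G2 [g_ gi [gc Gc]]].
apply: (cvgL2_inner_eq _ _ f2 g2 _ _ F2 G2 fc gc Fc Gc) => n;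
  have [f1 f2'] := fi n; have [g1 g2'] := gi n => //; try exact: fourier_L2.
by rewrite plancherel_inner.
Qed.

Lemma fourierL2_n2 f F : fourierL2 f F -> n2 f = n2 F.
Proof.
move=> fF; have := fourierL2_inner fF fF; rewrite !inner_self.
exact: complexI.
Qed.

Lemma fourierL2D f F g G : fourierL2 f F -> fourierL2 g G ->
  fourierL2 (fun t => f t + g t) (fun t => F t + G t).
Proof.
move=> /fourierL2P[f2 F2 [f_ fi [fc Fc]]] /fourierL2P[g2 G2 [g_ gi [gc Gc]]].
have f1_ n : L1 (f_ n) by case: (fi n).
have f2_ n : L2 (f_ n) by case: (fi n).
have g1_ n : L1 (g_ n) by case: (gi n).
have g2_ n : L2 (g_ n) by case: (gi n).
apply/fourierL2P; split; [exact: L2D|exact: L2D|].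
exists (fun n t => f_ n t + g_ n t).
  by move=> n; split; [exact: cintegrableD (f1_ n) (g1_ n)|exact: L2D (f2_ n) (g2_ n)].
split; first exact: cvgL2D.
rewrite (_ : (fun n => _) = (fun n xi => fourier (f_ n) xi + fourier (g_ n) xi)).
  by apply: cvgL2D => // n; exact: fourier_L2.
by apply/funext => n; exact: fourierD.
Qed.

Lemma fourierL2Z a f F : fourierL2 f F ->
  fourierL2 (fun t => a * f t) (fun t => a * F t).
Proof.
move=> /fourierL2P[f2 F2 [f_ fi [fc Fc]]].
have f1_ n : L1 (f_ n) by case: (fi n).
have f2_ n : L2 (f_ n) by case: (fi n).
apply/fourierL2P; split; [exact: L2Z|exact: L2Z|].
exists (fun n t => a * f_ n t).
  by move=> n; split; [exact: cintegrableZ (f1_ n)|exact: L2Z (f2_ n)].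
split; first exact: cvgL2Z.
rewrite (_ : (fun n => _) = (fun n xi => a * fourier (f_ n) xi)).
  by apply: cvgL2Z => // n; exact: fourier_L2.
by apply/funext => n; exact: fourierZ.
Qed.

Lemma fourierL2B f F g G : fourierL2 f F -> fourierL2 g G ->
  fourierL2 (fun t => f t - g t) (fun t => F t - G t).
Proof.
move=> fF gG; have := fourierL2D fF (fourierL2Z (-1) gG).
by congr fourierL2; apply/funext => t; rewrite mulN1r.
Qed.

Lemma fourierL2_dist f F g G : fourierL2 f F -> fourierL2 g G ->
  n2 (fun t => f t - g t) = n2 (fun t => F t - G t).
Proof. by move=> fF gG; exact: fourierL2_n2 (fourierL2B fF gG). Qed.

Lemma n2_ae f g : cmeasurable f -> cmeasurable g ->
  {ae leb, forall t, f t = g t} -> n2 f = n2 g.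
Proof. by move=> mf mg fg; rewrite /n2 (N2_ae mf mg fg). Qed.

Lemma cvgL2_ae (f_ : nat -> R -> R[i]) f g : (forall n, L2 (f_ n)) -> L2 f -> L2 g ->
  {ae leb, forall t, f t = g t} -> cvgL2 f_ f -> cvgL2 f_ g.
Proof.
move=> f2_ f2 g2 fg; rewrite /cvgL2.
rewrite (_ : (fun n => n2 (fun t => f_ n t - f t)) = (fun n => n2 (fun t => f_ n t - g t)))//.
apply/funext => n; apply: n2_ae.
- exact: cmeasurableB (L2_measurable (f2_ n)) (L2_measurable f2).
- exact: cmeasurableB (L2_measurable (f2_ n)) (L2_measurable g2).
- by apply: ae_leb_mono fg => t ->.
Qed.

Lemma fourierL2_ae f F g G : fourierL2 f F -> L2 g -> L2 G ->
  {ae leb, forall t, f t = g t} -> {ae leb, forall t, F t = G t} -> fourierL2 g G.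
Proof.
move=> /fourierL2P[f2 F2 [f_ fi [fc Fc]]] g2 G2 fg FG; apply/fourierL2P; split => //.
exists f_ => //; split.
  by apply: cvgL2_ae fc => // n; case: (fi n).
by apply: cvgL2_ae Fc => // n; have [? ?] := fi n; exact: fourier_L2.
Qed.

(** Truncations of [f] lie in L1 and L2; the transform preserves their mutual distances, so the
    transforms form a fast Cauchy sequence, whose limit is taken. *)
Lemma fourierL2_ex f : L2 f -> exists F, fourierL2 f F.
Proof.
move=> f2; have [r rP] := window_fast_approx f2.
pose g j t := window (r j) t * f t.
have g1 j : L1 (g j) by exact: windowM_L1.
have g2 j : L2 (g j) by exact: windowM_L2.
have G2 j : L2 (fourier (g j)) by exact: fourier_L2.
have e0 j : (0 : R) <= 8^-1 ^+ j by rewrite exprn_ge0// invr_ge0.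
have d j : n2 (fun t => fourier (g j.+1) t - fourier (g j) t) <= 8^-1 ^+ j.
  rewrite -(fourierL2_dist (fourierL2_L1 (g1 j.+1) (g2 j.+1)) (fourierL2_L1 (g1 j) (g2 j))).
  rewrite (_ : (fun t => _) = (fun t => (g j.+1 t - f t) + (f t - g j t))); last first.
    by apply/funext => t; ring.
  apply: le_trans (n2D (L2B (g2 _) f2) (L2B f2 (g2 _))) _.
  rewrite (n2BC f); have := rP j; have := rP j.+1; rewrite exprS.
  by have := e0 j; rewrite /g; lra.
have [F F2 FG] := complete_L2 G2 d.
exists F; apply/fourierL2P; split => //; exists g => //; split => //.
apply: (@squeeze_cvgr _ _ _ _ (fun=> 0) (fun j => 8^-1 ^+ j / 4)).
- by apply: nearW => j; rewrite n2_ge0 andTb; exact: rP.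
- exact: cvg_cst.
- rewrite -[X in _ --> X](mul0r 4^-1); apply: cvgM; last exact: cvg_cst.
  by apply: cvg_expr; rewrite ger0_norm ?invr_ge0// invf_lt1// ltr1n.
Qed.

Lemma fourier_mul_formula f g : L1 f -> L1 g ->
  cintegral leb (fun x => fourier f x * g x) = cintegral leb (fun x => f x * fourier g x).
Proof.
move=> fi gi; have ti := cintegrable_tensor fi gi.
have mp : measurable_fun setT (fun z : R * R => - (2 * pi * z.1 * z.2)).
  apply: measurableT_comp => //; apply: measurable_funM; last exact: measurable_snd.
  by apply: measurable_funM => //; exact: measurable_fst.
have /(_ (fun z => - (2 * pi * z.1 * z.2)) mp) Hi :=
  fun u mu => cintegrable_expi (u := u) mu ti.
have := cintegral12_prod Hi; rewrite -(cintegral21_prod Hi) => E.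
apply/esym; apply: etrans (etrans E _).
  apply: eq_cintegral => x; rewrite /fourier -cintegralZ; last exact: fourier_integrable.
  by apply: eq_cintegral => t; rewrite mulrA /= -!mulrA; congr (_ * (_ * expi _)); ring.
apply: eq_cintegral => x; rewrite [RHS]mulrC /fourier -cintegralZ; last exact: fourier_integrable.
by apply: eq_cintegral => t; rewrite /=; ring.
Qed.

Lemma cvgL2_conj (f_ : nat -> R -> R[i]) f : cvgL2 f_ f ->
  cvgL2 (fun n t => conjc (f_ n t)) (fun t => conjc (f t)).
Proof.
rewrite /cvgL2 (_ : (fun n => n2 (fun t => f_ n t - f t)) =
  (fun n => n2 (fun t => conjc (f_ n t) - conjc (f t))))//.
apply/funext => n; rewrite /n2 -N2_conj; congr (fine (N2 _)).
by apply/funext => t; rewrite conjcB.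
Qed.

(** The bilinear multiplication formula on L1, passed to the limit. The conjugations convert it into
    a statement about inner products. *)
Lemma fourierL2_adjoint f F g H : fourierL2 f F -> L2 g ->
  fourierL2 (fun t => conjc (g t)) H -> inner F g = inner f (fun t => conjc (H t)).
Proof.
move=> /fourierL2P[f2 F2 [f_ fi [fc Fc]]] g2 /fourierL2P[h2 H2 [h_ hi [hc Hc]]].
have Hc' := cvgL2_conj Hc; have hc' := cvgL2_conj hc.
have gE : (fun t => conjc (conjc (g t))) = g by apply/funext => t; rewrite conjcK.
rewrite gE in hc'.
have f1_ n : L1 (f_ n) by case: (fi n).
have f2_ n : L2 (f_ n) by case: (fi n).
have h1_ n : L1 (h_ n) by case: (hi n).
have h2_ n : L2 (h_ n) by case: (hi n).
have F2_ n : L2 (fourier (f_ n)) by exact: fourier_L2.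
have hc2_ n : L2 (fun t => conjc (h_ n t)) by exact: L2_conj.
have Hc2_ n : L2 (fun t => conjc (fourier (h_ n) t)) by apply: L2_conj; exact: fourier_L2.
apply: (cvgL2_inner_eq F2_ hc2_ F2 g2 f2_ Hc2_ f2 (L2_conj H2) Fc hc' fc Hc') => n.
rewrite /inner; under eq_cintegral do rewrite conjcK.
by under [RHS]eq_cintegral do rewrite conjcK; exact: fourier_mul_formula.
Qed.

(* The candidate is [conjc (hat (conjc g))], the adjoint of the transform at [g]; the
   adjoint formula then gives [|hat f - g|^2 = 0]. *)
Lemma fourierL2_surj g : L2 g -> exists f, fourierL2 f g.
Proof.
move=> g2; have [h gh] := fourierL2_ex (L2_conj g2).
have /fourierL2P[_ h2 _] := gh.
pose f t := conjc (h t); have f2 : L2 f by exact: L2_conj.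
have [k fk] := fourierL2_ex f2; have /fourierL2P[_ k2 _] := fk.
exists f; apply: (fourierL2_ae fk) => //; first exact: aeW.
apply: ae_eq_n2 => //.
have kg : inner k g = (n2 f)%:C by rewrite (fourierL2_adjoint fk g2 gh) inner_self.
have gf : n2 g = n2 f.
  have := fourierL2_n2 gh; rewrite /n2 N2_conj => ->.
  by rewrite /f N2_conj.
have kf := fourierL2_n2 fk.
apply: (@complexI R); rewrite -inner_self innerBl//; last exact: L2B.
rewrite !innerBr// !inner_self -kf gf (inner_conj k2 g2) kg conjc_real.
by rewrite !subrr.
Qed.

End FourierL2.

(** * Fourier multipliers as bounded operators on L2 *)

Section Multipliers.
Context {R : realType}.
Local Notation leb := (@lebesgue_measure R).
Local Notation normc := (@Normc.normc R).
Implicit Types f g : R -> R[i].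

Lemma fourierL2_dom f F : fourierL2 f F -> L2 f. Proof. by case. Qed.

Lemma fourierL2_cod f F : fourierL2 f F -> L2 F. Proof. by case. Qed.

Lemma n2_subrr f : L2 f -> n2 (fun t => f t - f t) = 0.
Proof. by move=> f2; apply: ae_n2_eq0; [exact: L2_measurable..|exact: aeW]. Qed.

Lemma fourierL2_uniq_cod f F F' : fourierL2 f F -> fourierL2 f F' ->
  {ae leb, forall xi, F xi = F' xi}.
Proof.
move=> fF fF'; apply: ae_eq_n2; [exact: fourierL2_cod fF|exact: fourierL2_cod fF'|].
by rewrite -(fourierL2_dist fF fF') n2_subrr//; exact: fourierL2_dom fF.
Qed.

Lemma fourierL2_uniq_dom f f' F : fourierL2 f F -> fourierL2 f' F ->
  {ae leb, forall t, f t = f' t}.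
Proof.
move=> fF f'F; apply: ae_eq_n2; [exact: fourierL2_dom fF|exact: fourierL2_dom f'F|].
by rewrite (fourierL2_dist fF f'F) n2_subrr//; exact: fourierL2_cod fF.
Qed.

(** [fourierL2] fixes the transform only up to null sets, so one representative is chosen. The
    default [0] is taken exactly when [f] is outside [L2]. *)
Definition hatL2 f : R -> R[i] := xget (fun=> 0) [set F | fourierL2 f F].

Definition invL2 g : R -> R[i] := xget (fun=> 0) [set f | fourierL2 f g].

Lemma hatL2P f : L2 f -> fourierL2 f (hatL2 f).
Proof.
move=> /fourierL2_ex[F fF].
exact: (@xgetPex _ (fun=> 0) [set F | fourierL2 f F] (ex_intro _ F fF)).
Qed.

Lemma invL2P g : L2 g -> fourierL2 (invL2 g) g.
Proof.
move=> /fourierL2_surj[f fg].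
exact: (@xgetPex _ (fun=> 0) [set f | fourierL2 f g] (ex_intro _ f fg)).
Qed.

Definition multiplier (m : R -> R) f : R -> R[i] :=
  invL2 (fun xi => (m xi)%:C * hatL2 f xi).

Variables (m : R -> R) (C : R).
Hypothesis mm : measurable_fun setT m.
Hypothesis C0 : 0 <= C.
Hypothesis mC : forall xi, `|m xi| <= C.

Lemma realM_L2 g : L2 g -> L2 (fun xi => (m xi)%:C * g xi).
Proof.
move=> g2; apply: (@L2_le _ _ g C) => //.
  by apply: cmeasurableM; [exact: cmeasurable_real|exact: L2_measurable].
by move=> t; rewrite Normc.normcM normc_real ler_wpM2r ?normc_ge0.
Qed.

(** Valid for every transform [F] of [f], which frees later arguments from the representative
    selected by [hatL2]. *)
Lemma fourierL2_multiplier f F : fourierL2 f F ->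
  fourierL2 (multiplier m f) (fun xi => (m xi)%:C * F xi).
Proof.
move=> fF; have f2 := fourierL2_dom fF; have F2 := fourierL2_cod fF.
have H := hatL2P f2; have mH2 := realM_L2 (fourierL2_cod H).
have I := invL2P mH2; apply: (fourierL2_ae I) => //.
- exact: fourierL2_dom I.
- exact: realM_L2.
- exact: aeW.
- by apply: ae_leb_mono (fourierL2_uniq_cod H fF) => xi ->.
Qed.

Lemma multiplier_bounded_linear : bounded_linear_L2 (multiplier m).
Proof.
split.
- by move=> f /hatL2P/fourierL2_multiplier/fourierL2_dom.
- move=> f g f2 g2 /ae_eq_lebP fg; apply/ae_eq_lebP.
  have fH := hatL2P f2.
  have gH : fourierL2 g (hatL2 f).
    by apply: (fourierL2_ae fH _ _ fg) => //; [exact: fourierL2_cod fH|exact: aeW].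
  exact: fourierL2_uniq_dom (fourierL2_multiplier fH) (fourierL2_multiplier gH).
- move=> a f g f2 g2; apply/ae_eq_lebP.
  have fH := hatL2P f2; have gH := hatL2P g2.
  have H1 := fourierL2_multiplier (fourierL2D (fourierL2Z a fH) gH).
  have H2 := fourierL2D (fourierL2Z a (fourierL2_multiplier fH)) (fourierL2_multiplier gH).
  apply: (fourierL2_uniq_dom H1); move: H2; congr fourierL2.
  by apply/funext => xi; ring.
- exists C => f f2; have fH := hatL2P f2; have mH := fourierL2_multiplier fH.
  rewrite !L2norm_n2//; last exact: fourierL2_dom mH.
  rewrite -EFinM lee_fin (fourierL2_n2 mH) (fourierL2_n2 fH).
  have H2 := fourierL2_cod fH; have mH2 := fourierL2_cod mH.
  rewrite -[X in X * _](ger0_norm C0) -sqrtr_sqr -sqrtrM ?sqr_ge0//.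
  apply: ler_wsqrtr; rewrite -lee_fin EFinM -!L2_n2E//.
  apply: le_N2 => //; [exact: L2_measurable mH2|exact: L2_measurable H2|].
  by move=> t; rewrite Normc.normcM normc_real ler_wpM2r ?normc_ge0.
Qed.

End Multipliers.

Lemma multiplier_inv {R : realType} (m m' : R -> R) (C C' : R) f :
  measurable_fun setT m -> measurable_fun setT m' -> 0 <= C -> 0 <= C' ->
  (forall xi, `|m xi| <= C) -> (forall xi, `|m' xi| <= C') ->
  (forall xi, m xi * m' xi = 1) -> L2 f ->
  multiplier m (multiplier m' f) = f %[ae (@lebesgue_measure R)].
Proof.
move=> mm mm' C0 C'0 mC mC' mm1 f2; apply/ae_eq_lebP.
have fH := hatL2P f2.
have H := fourierL2_multiplier mm C0 mC (fourierL2_multiplier mm' C'0 mC' fH).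
apply: (fourierL2_uniq_dom H); move: fH; congr fourierL2.
by apply/funext => xi; rewrite mulrA -realcM mm1 mul1r.
Qed.

(** * The systems on the Fourier side *)

Section SystemTransform.
Context {R : realType}.
Local Notation leb := (@lebesgue_measure R).
Local Notation normc := (@Normc.normc R).
Implicit Types (f g : R -> R[i]) (x w : R).

Lemma beta_gt0 w : 0 < beta w.
Proof. by rewrite invr_gt0 ltr_pwDl. Qed.

Lemma betaV w : (beta w)^-1 = 1 + `|w|.
Proof. exact: invrK. Qed.

(** The square root of [beta w], written as the amplitude of the dilation times the Jacobian of its
    change of variables, as it arises in [fourier_system]. *)
Definition scale w : R := `|beta w| `^ (- 2^-1) * beta w.

Lemma scale_ge0 w : 0 <= scale w.
Proof. by rewrite mulr_ge0 ?powR_ge0// ltW// beta_gt0. Qed.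

Lemma scale_sqr w : scale w ^+ 2 = beta w.
Proof.
have b0 := beta_gt0 w; rewrite /scale exprMn -powR_mulrn ?powR_ge0// -powRrM.
rewrite (gtr0_norm b0) mulNr mulVf// powRN powRr1 ?ltW//.
by rewrite expr2 mulrA mulVf ?mul1r// gt_eqF.
Qed.

(** The transform turns modulation by [w] into translation by [w], translation by [x] into
    modulation by [- x], and inverts the dilation. Modulation is applied last in [system], so the
    character is evaluated at [xi - w]. *)
Definition system_hat g (p : R * R) : R -> R[i] := fun xi =>
  (scale p.2)%:C * expi (- (2 * pi * p.1 * (xi - p.2))) * g (beta p.2 * (xi - p.2)).

Lemma systemE f x w : system f (x, w) =
  (fun t => (`|beta w| `^ (- 2^-1))%:C * (expi (2 * pi * w * t) *
    f ((beta w)^-1 * t + - (x / beta w)))).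
Proof.
apply/funext => t; rewrite /system /modulation /translation /dilation/=.
by rewrite mulrCA; congr (_ * (_ * f _)); rewrite mulrBl mulrC.
Qed.

Lemma cmeasurable_affine (a b : R) f : cmeasurable f -> cmeasurable (fun t => f (a * t + b)).
Proof. exact: cmeasurable_comp (measurable_affine a b). Qed.

Lemma cmeasurable_system f p : cmeasurable f -> cmeasurable (system f p).
Proof.
move=> mf; case: p => x w; rewrite systemE.
apply: cmeasurableM; first exact: cmeasurable_cst.
apply: cmeasurableM; last exact: cmeasurable_affine.
by apply: cmeasurable_expi; exact: mulrl_measurable.
Qed.

Lemma N2_affine f (a b : R) : 0 < a -> cmeasurable f ->
  N2 (fun t => f (a * t + b)) = ((a^-1)%:E * N2 f)%E.
Proof.
move=> a0 mf; apply: (ge0_integral_affine b (f := fun t => (normc (f t) ^+ 2)%:E) a0).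
  by apply/measurable_EFinP; exact: measurable_normc_sqr.
by move=> t; rewrite lee_fin sqr_ge0.
Qed.

Lemma N2Z (a : R[i]) f : cmeasurable f ->
  N2 (fun t => a * f t) = ((normc a ^+ 2)%:E * N2 f)%E.
Proof.
move=> mf; rewrite /N2 -ge0_integralZl_EFin; [|exact: measurableT|
  by move=> t _; rewrite lee_fin sqr_ge0|
  by apply/measurable_EFinP; exact: measurable_normc_sqr|exact: sqr_ge0].
by apply: eq_integral => t _; rewrite Normc.normcM exprMn EFinM.
Qed.

Lemma N2_expi (u : R -> R) f : N2 (fun t => expi (u t) * f t) = N2 f.
Proof. by apply: eq_integral => t _; rewrite Normc.normcM normc_expi mul1r. Qed.

Lemma N2_system f p : cmeasurable f -> N2 (system f p) = N2 f.
Proof.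
move=> mf; case: p => x w; rewrite systemE N2Z; last first.
  apply: cmeasurableM; last exact: cmeasurable_affine.
  by apply: cmeasurable_expi; exact: mulrl_measurable.
have b0 := beta_gt0 w.
rewrite N2_expi N2_affine ?invr_gt0// invrK muleA -EFinM normc_real.
rewrite (ger0_norm (powR_ge0 _ _)) -powR_mulrn ?powR_ge0// -powRrM.
rewrite (gtr0_norm b0) mulNr mulVf// powRN powRr1 ?ltW//.
by rewrite mulVf ?mul1e// gt_eqF.
Qed.

Lemma L2_system f p : L2 f -> L2 (system f p).
Proof.
move=> /L2P[mf fi]; apply/L2P; split; first exact: cmeasurable_system.
by rewrite N2_system.
Qed.

Lemma system_hatE g x w : system_hat g (x, w) =
  (fun xi => (scale w)%:C * (expi (- (2 * pi * x * (xi - w))) *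
    g (beta w * xi + - (beta w * w)))).
Proof. by apply/funext => xi; rewrite /system_hat/= -mulrA (mulrBr (beta w)). Qed.

Lemma cmeasurable_system_hat g p : cmeasurable g -> cmeasurable (system_hat g p).
Proof.
move=> mg; case: p => x w; rewrite system_hatE.
apply: cmeasurableM; first exact: cmeasurable_cst.
apply: cmeasurableM; last exact: cmeasurable_affine.
apply: cmeasurable_expi; apply: measurableT_comp => //.
by apply: measurable_funM => //; exact: measurable_funB.
Qed.

Lemma N2_system_hat g p : cmeasurable g -> N2 (system_hat g p) = N2 g.
Proof.
move=> mg; case: p => x w; rewrite system_hatE N2Z; last first.
  apply: cmeasurableM; last exact: cmeasurable_affine.
  apply: cmeasurable_expi; apply: measurableT_comp => //.
  by apply: measurable_funM => //; exact: measurable_funB.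
have b0 := beta_gt0 w.
rewrite N2_expi N2_affine// muleA -EFinM normc_real (ger0_norm (scale_ge0 w)).
by rewrite scale_sqr mulfV ?mul1e// gt_eqF.
Qed.

Lemma L2_system_hat g p : L2 g -> L2 (system_hat g p).
Proof.
move=> /L2P[mg gi]; apply/L2P; split; first exact: cmeasurable_system_hat.
by rewrite N2_system_hat.
Qed.

Lemma L1_system f p : L1 f -> L1 (system f p).
Proof.
move=> fi; case: p => x w; rewrite systemE; apply: cintegrableZ.
have ai := cintegrable_affine (- (x / beta w)) (etrans (invr_gt0 _) (beta_gt0 w)) fi.
apply: cintegrable_le (cintegrable_normc ai) _.
  apply: cmeasurableM; last exact: cintegrable_measurable ai.
  by apply: cmeasurable_expi; exact: mulrl_measurable.
by move=> t; rewrite Normc.normcM normc_expi mul1r.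
Qed.

(** The substitution [s = (t - x) / beta w]; both sides carry the total phase
    [- 2 * pi * t * (xi - w)]. *)
Lemma fourier_system f p : L1 f -> fourier (system f p) = system_hat (fourier f) p.
Proof.
move=> fi; case: p => x w; apply/funext => xi.
have b0 := beta_gt0 w; have bN0 : beta w != 0 by rewrite gt_eqF.
have hi := cintegrableZ (expi (- (2 * pi * x * (xi - w))))
  (fourier_integrable (beta w * (xi - w)) fi).
have := cintegral_affine (- (x / beta w)) (etrans (invr_gt0 _) b0) hi.
rewrite (invrK (beta w)) [X in _ = _ * X]cintegralZ; last exact: fourier_integrable.
move=> E; rewrite /system_hat /fourier /scale realcM -[RHS]mulrA -[RHS]mulrA -E.
rewrite -cintegralZ; last exact: (cintegrable_affine _ (etrans (invr_gt0 _) b0) hi).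
have perm1 (c e1 y e2 : R[i]) : c * (e1 * y) * e2 = c * (y * (e1 * e2)) by ring.
have perm2 (e1 y e2 : R[i]) : e1 * (y * e2) = y * (e1 * e2) by ring.
apply: eq_cintegral => t; rewrite systemE perm1 [X in _ = _ * X]perm2; congr (_ * (_ * _)).
by rewrite -!expiD; congr expi; move: bN0; move: (beta w) => b bN0; field.
Qed.

Lemma systemB f g p : (fun t => system f p t - system g p t) =
  system (fun t => f t - g t) p.
Proof.
case: p => x w; rewrite !systemE; apply/funext => t.
by rewrite -!mulrBr.
Qed.

Lemma system_hatB f g p : (fun t => system_hat f p t - system_hat g p t) =
  system_hat (fun t => f t - g t) p.
Proof. by apply/funext => t; rewrite /system_hat -mulrBr. Qed.

(** [system] and [system_hat] preserve energy, so they carry an approximating sequence for [(f, F)]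
    to one for the images. *)
Lemma fourierL2_system f F p : fourierL2 f F -> fourierL2 (system f p) (system_hat F p).
Proof.
move=> /fourierL2P[f2 F2 [f_ fi [fc Fc]]].
have f1_ n : L1 (f_ n) by case: (fi n).
have f2_ n : L2 (f_ n) by case: (fi n).
have F2_ n : L2 (fourier (f_ n)) by exact: fourier_L2.
apply/fourierL2P; split; [exact: L2_system|exact: L2_system_hat|].
exists (fun n => system (f_ n) p).
  by move=> n; split; [exact: L1_system|exact: L2_system].
split; rewrite /cvgL2.
  rewrite (_ : (fun n => _) = (fun n => n2 (fun t => f_ n t - f t)))//.
  apply/funext => n; rewrite systemB /n2 N2_system//.
  exact: cmeasurableB (L2_measurable (f2_ n)) (L2_measurable f2).
rewrite (_ : (fun n => _) = (fun n => n2 (fun t => fourier (f_ n) t - F t)))//.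
apply/funext => n; rewrite fourier_system// system_hatB /n2 N2_system_hat//.
exact: cmeasurableB (L2_measurable (F2_ n)) (L2_measurable F2).
Qed.

Lemma measurable_beta : measurable_fun setT (@beta R).
Proof.
apply: continuous_measurable_fun => w; apply: cvgV; first by rewrite gt_eqF// ltr_pwDl.
by apply: cvgD; [exact: cvg_cst|exact: norm_continuous].
Qed.

Lemma system_weakly_measurable f : L2 f -> weakly_measurable (system f).
Proof.
move=> f2; split=> [p|g g2]; first exact: L2_system.
have mf := L2_measurable f2; have mg := L2_measurable g2.
(* The coefficient is an integral depending on the parameter [(x, w)], so joint measurability of the
   integrand in [((x, w), t)] is enough. *)
pose K (z : (R * R) * R) := g z.2 * conjc (system f z.1 z.2).
apply: (@cmeasurable_cintegral1 R _ _ _ _ leb K).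
have mx : measurable_fun setT (fun z : (R * R) * R => z.1.1).
  exact: (measurableT_comp measurable_fst measurable_fst).
have mw : measurable_fun setT (fun z : (R * R) * R => z.1.2).
  exact: (measurableT_comp measurable_snd measurable_fst).
have mt : measurable_fun setT (fun z : (R * R) * R => z.2).
  exact: measurable_snd.
have mb := measurableT_comp measurable_beta mw.
apply: cmeasurableM; first exact: (cmeasurable_comp mt mg).
apply: cmeasurable_conj.
rewrite (_ : (fun z => _) = (fun z : (R * R) * R =>
    (`|beta z.1.2| `^ (- 2^-1))%:C * (expi (2 * pi * z.1.2 * z.2) *
    f ((1 + `|z.1.2|) * z.2 + - (z.1.1 * (1 + `|z.1.2|)))))); last first.
  by apply/funext => -[[x w] t]; rewrite systemE/= betaV.
have mn : measurable_fun setT (fun z : (R * R) * R => 1 + `|z.1.2|).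
  by apply: measurable_funD => //; exact: measurableT_comp mw.
apply: cmeasurableM; last (apply: cmeasurableM).
- apply: cmeasurable_real.
  apply: (@measurableT_comp _ _ _ _ _ _ (fun u : R => u `^ (- 2^-1))).
    exact: measurable_powR.
  exact: measurableT_comp mb.
- apply: cmeasurable_expi; apply: measurable_funM => //.
  exact: measurable_funM.
- apply: (@cmeasurable_comp _ _ _ _ _ (fun z : (R * R) * R =>
    (1 + `|z.1.2|) * z.2 + - (z.1.1 * (1 + `|z.1.2|)))) => //.
  apply: measurable_funD; first exact: measurable_funM.
  by apply: measurableT_comp => //; exact: measurable_funM.
Qed.

End SystemTransform.

(** * The symbol of the resolution operator and its bounds *)

Section Symbol.
Context {R : realType}.
Local Notation leb := (@lebesgue_measure R).
Implicit Types w xi : R.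

Definition symbol_kernel w xi : R :=
  beta w * (1 - (beta w * (xi - w)) ^+ 2) * \1_`[-1, 1] (beta w * (xi - w)).

Lemma symbol_kernel_ge0 w xi : 0 <= symbol_kernel w xi.
Proof.
rewrite /symbol_kernel indicE; case: (boolP (_ \in _)) => [|_]; last by rewrite mulr0.
move: (beta w * (xi - w)) => y; rewrite inE/= in_itv/= => /andP[y1 y2].
by rewrite mulr1 mulr_ge0 ?(ltW (beta_gt0 w))//; nra.
Qed.

Lemma measurable_betaB : measurable_fun setT (fun z : R * R => beta z.1 * (z.2 - z.1)).
Proof.
apply: measurable_funM; first exact: (measurableT_comp measurable_beta measurable_fst).
by apply: measurable_funB; [exact: measurable_snd|exact: measurable_fst].
Qed.

Lemma measurable_symbol_kernel :
  measurable_fun setT (fun z : R * R => symbol_kernel z.1 z.2).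
Proof.
have my := measurable_betaB.
apply: measurable_funM.
  apply: measurable_funM; first exact: (measurableT_comp measurable_beta measurable_fst).
  by apply: measurable_funB => //; exact: measurable_funX.
by apply: (measurableT_comp _ my); exact: measurable_indic.
Qed.

Lemma measurable_symbol_kernel1 xi : measurable_fun setT (fun w => symbol_kernel w xi).
Proof. exact: (measurableT_comp measurable_symbol_kernel (@pair2_measurable _ _ _ _ xi)). Qed.

Lemma betaN w : beta (- w) = beta w.
Proof. by rewrite /beta normrN. Qed.

Lemma symbol_kernelN w xi : symbol_kernel (- w) xi = symbol_kernel w (- xi).
Proof.
rewrite /symbol_kernel betaN.
rewrite (_ : beta w * (xi - - w) = - (beta w * (- xi - w))); last by ring.
rewrite sqrrN !indicE; congr (_ * _%:R); congr nat_of_bool.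
by rewrite !mem_setE /= !in_itv/=; apply/andP/andP => -[? ?]; split; lra.
Qed.

Lemma integral_inv_sqr (a : R) : 0 <= a ->
  (\int[leb]_(w in `[a, +oo[) ((1 + w) ^- 2)%:E = ((1 + a)^-1)%:E)%E.
Proof.
move=> a0.
have nz w : a <= w -> 1 + w != 0 by move=> aw; rewrite gt_eqF//; lra.
have c1 : continuous (fun w : R => 1 + w).
  by move=> w; apply: cvgD; [exact: cvg_cst|exact: cvg_id].
have der w : a < w -> is_derive w 1 (fun w => - (1 + w)^-1) ((1 + w) ^- 2).
  move=> /ltW/nz wn; have d1 : is_derive w 1 (fun w : R => 1 + w) 1.
    by apply: is_derive_eq; rewrite add0r mulr1.
  apply: (is_derive_eq (is_deriveN (is_deriveV wn d1))).
  by rewrite /GRing.scale/= mulr1 opprK.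
rewrite (@ge0_continuous_FTC2y _ _ (fun w => - (1 + w)^-1) _ 0).
- by rewrite EFinN oppeK add0e.
- by move=> w aw; rewrite invr_ge0 sqr_ge0.
- apply: continuous_in_subspaceT => w; rewrite inE/= in_itv/= andbT => aw.
  apply: cvgV; first by rewrite expf_neq0// nz.
  by apply: (@continuous_comp _ _ _ (fun w : R => 1 + w) (fun x => x ^+ 2));
    [exact: c1|exact: exprn_continuous].
- rewrite -[X in _ --> X]oppr0; apply: cvgN; apply/gtr0_cvgV0; last exact: cvg_addrl.
  by near=> w; have : 0 < w by []; lra.
- by move=> w /der[].
- by apply: cvg_at_right_filter; apply: cvgN; apply: cvgV; [exact: nz|exact: c1].
- by move=> w; rewrite in_itv/= andbT => /der[_ H]; rewrite derive1E H.
Unshelve. all: by end_near. Qed.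

Lemma integral_beta_sqr (a : R) : 0 <= a ->
  (\int[leb]_(w in `[a, +oo[) (beta w ^+ 2)%:E = ((1 + a)^-1)%:E)%E.
Proof.
move=> a0; rewrite -integral_inv_sqr//; apply: eq_integral => w.
by rewrite inE/= in_itv/= andbT => aw; rewrite /beta exprVn ger0_norm// (le_trans a0).
Qed.

Definition half_symbol xi : \bar R :=
  (\int[leb]_(w in `[0%R, +oo[) (symbol_kernel w xi)%:E)%E.

Definition esymbol xi : \bar R := (\int[leb]_w (symbol_kernel w xi)%:E)%E.

Lemma esymbolE xi : esymbol xi = (half_symbol xi + half_symbol (- xi))%E.
Proof.
have mk := measurable_symbol_kernel1 xi.
rewrite /esymbol -(setUv `[0, +oo[%classic) ge0_integral_setU//=; last 4 first.
- exact: measurableC.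
- by rewrite setUv; exact/measurable_EFinP.
- by move=> w _; rewrite lee_fin symbol_kernel_ge0.
- exact/disj_setPCl.
congr (_ + _)%E; rewrite /half_symbol.
have H := @ge0_integration_by_substitution0 R (fun w => (symbol_kernel (- w) xi)%:E).
under [RHS]eq_integral do rewrite -symbol_kernelN.
rewrite H.
- rewrite setCitvr -integral_itv_bndo_bndc.
    by apply: eq_integral => w _; rewrite opprK.
  apply/measurable_EFinP; apply: measurable_funTS.
  rewrite (_ : (fun w => _) = (fun w => symbol_kernel w xi))//.
  by apply/funext => w; rewrite opprK.
- apply/measurable_EFinP; exact: (measurableT_comp mk (@oppr_measurable R setT)).
- by move=> w; rewrite lee_fin symbol_kernel_ge0.
Qed.

Lemma betaB_ge0 w xi : 0 <= w ->
  beta w * (xi - w) = (1 + xi) / (1 + w) - 1.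
Proof.
move=> w0; rewrite /beta ger0_norm//; field.
by rewrite gt_eqF//; lra.
Qed.

(** With [q = (1 + xi) * beta w] the factor [1 - y ^+ 2] is [q * (2 - q)], at most [2 * q], and the
    kernel vanishes for [q] above [2]. The integral of [2 * (1 + xi) * beta w ^+ 2] over the
    remaining [w] is at most [4]. *)
Lemma half_symbol_le xi : (half_symbol xi <= 4%:E)%E.
Proof.
have mk := measurable_symbol_kernel1 xi.
have uneq w : 0 <= w -> 0 < 1 + w by move=> ?; lra.
have [c0|c0] := leP (1 + xi) 0.
  rewrite /half_symbol integral0_eq ?lee_fin// => w; rewrite /= in_itv/= andbT => w0.
  rewrite /symbol_kernel betaB_ge0//.
  have : (1 + xi) / (1 + w) <= 0 by rewrite ler_pdivrMr ?mul0r// uneq.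
  move: ((1 + xi) / (1 + w)) => q q0; rewrite indicE.
  case: (boolP (_ \in _)) => [|_]; last by rewrite mulr0.
  rewrite inE/= in_itv/= => /andP[q1 _].
  (* The indicator forces [0 <= q], so only the endpoint [y = - 1] is left, where [1 - y ^+ 2]
     vanishes. *)
  by rewrite (_ : q = 0) ?sub0r ?sqrrN ?expr1n ?subrr ?mulr0 ?mul0r//; lra.
(* The condition [q <= 2] reads [(1 + xi) / 2 - 1 <= w]; the maximum intersects this range with the
   half-line. *)
pose a0 : R := Num.max 0 ((1 + xi) / 2 - 1).
have a00 : 0 <= a0 by rewrite le_max lexx.
have a0c : (1 + xi) / 2 <= 1 + a0.
  by rewrite -lerBlDl le_max lexx orbT.
have mb2 (D : set R) : measurable_fun D (fun w : R => (beta w ^+ 2)%:E).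
  by apply/measurable_EFinP; apply: measurable_funTS; apply: measurable_funX; exact: measurable_beta.
have mb : measurable_fun setT (fun w : R => (2 * (1 + xi)) * beta w ^+ 2).
  by apply: measurable_funM => //; apply: measurable_funX; exact: measurable_beta.
apply: (@le_trans _ _ (\int[leb]_(w in `[a0, +oo[) ((2 * (1 + xi)) * beta w ^+ 2)%:E)%E); last first.
  rewrite (@eq_integral _ _ R leb _ (fun w : R => (2 * (1 + xi))%:E * (beta w ^+ 2)%:E)%E) =>
    [|w _]; last exact: EFinM.
  rewrite ge0_integralZl_EFin; [|exact: measurable_itv|by move=> w _; rewrite lee_fin sqr_ge0|exact: mb2|lra].
  rewrite integral_beta_sqr// -EFinM lee_fin ler_pdivrMr ?uneq//; lra.
have mr (h : R -> R) i : measurable_fun setT h ->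
    measurable_fun setT ((EFin \o h) \_ [set` Interval (BLeft i) +oo%O]).
  move=> mh; apply/(measurable_restrictT _ (measurable_itv _)).
  by apply/measurable_EFinP; exact: measurable_funTS.
rewrite /half_symbol integral_mkcond [leRHS]integral_mkcond.
apply: ge0_le_integral => //.
- by move=> w _; rewrite patchE; case: ifP => // _; rewrite lee_fin symbol_kernel_ge0.
- exact: (mr (fun w => symbol_kernel w xi) _ mk).
- exact: (mr (fun w => (2 * (1 + xi)) * beta w ^+ 2) _ mb).
move=> w _; rewrite !patchE; case: ifPn; last first.
  move=> _; case: ifP => // _; rewrite lee_fin mulr_ge0 ?sqr_ge0//; lra.
rewrite mem_setE/= in_itv/= andbT => w0.
have uw := uneq _ w0.
have bE : (1 + w)^-1 = beta w by rewrite /beta ger0_norm.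
have b0 := beta_gt0 w.
rewrite /symbol_kernel betaB_ge0// bE.
set q := (1 + xi) * beta w.
have q0 : 0 < q by rewrite mulr_gt0.
rewrite mem_setE/= in_itv/= andbT; case: ifPn => [_|].
  rewrite lee_fin indicE; case: (_ \in _); last by rewrite mulr0 mulr_ge0 ?sqr_ge0//; lra.
  rewrite mulr1 (_ : 2 * (1 + xi) * beta w ^+ 2 = beta w * (2 * q)); last by rewrite /q; ring.
  by apply: ler_wpM2l; [exact: ltW|nra].
rewrite -ltNge /a0 lt_max ltNge w0/= => wc.
have q2 : 2 < q by rewrite /q -bE ltr_pdivlMr//; lra.
rewrite lee_fin indicE memNset ?mulr0//= in_itv/= => /andP[_]; lra.
Qed.

(** Only [w >= xi] is kept. There [q = (1 + xi) * beta w] is at most [1], so [q * (2 - q)] is at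
    least [q], and the integral of [(1 + xi) * beta w ^+ 2] from [xi] on is exactly [1]. *)
Lemma half_symbol_ge xi : 0 <= xi -> (1%:E <= half_symbol xi)%E.
Proof.
move=> xi0; have mk := measurable_symbol_kernel1 xi.
have c0 : 0 < 1 + xi by lra.
have mb2 (D : set R) : measurable_fun D (fun w : R => (beta w ^+ 2)%:E).
  by apply/measurable_EFinP; apply: measurable_funTS; apply: measurable_funX; exact: measurable_beta.
have mb : measurable_fun setT (fun w : R => (1 + xi) * beta w ^+ 2).
  by apply: measurable_funM => //; apply: measurable_funX; exact: measurable_beta.
rewrite (_ : 1 = (1 + xi) * (1 + xi)^-1); last by rewrite divff// gt_eqF.
rewrite EFinM -integral_beta_sqr// -ge0_integralZl_EFin; [|exact: measurable_itv|
  by move=> w _; rewrite lee_fin sqr_ge0|exact: mb2|exact: ltW].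
apply: (@le_trans _ _ (\int[leb]_(w in `[xi, +oo[) (symbol_kernel w xi)%:E)%E); last first.
  apply: ge0_subset_integral => //.
  - by apply/measurable_EFinP; exact: measurable_funTS.
  - by move=> w _; rewrite lee_fin symbol_kernel_ge0.
  - by move=> w /=; rewrite !in_itv/= !andbT; exact: le_trans.
apply: ge0_le_integral => //.
- by move=> w _; rewrite -EFinM lee_fin mulr_ge0 ?sqr_ge0// ltW.
- by apply/measurable_EFinP; exact: measurable_funTS.
- by apply/measurable_EFinP; exact: measurable_funTS.
move=> w /=; rewrite in_itv/= andbT => xiw.
have w0 := le_trans xi0 xiw.
have uw : 0 < 1 + w by lra.
have bE : (1 + w)^-1 = beta w by rewrite /beta ger0_norm.
have b0 := beta_gt0 w.
rewrite /symbol_kernel betaB_ge0// bE -EFinM lee_fin.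
have q1 : (1 + xi) * beta w <= 1 by rewrite -bE ler_pdivrMr//; lra.
have q0 : 0 < (1 + xi) * beta w by rewrite mulr_gt0.
rewrite indicE mem_set ?mulr1; last by rewrite /= in_itv/=; apply/andP; split; lra.
rewrite (_ : (1 + xi) * beta w ^+ 2 = beta w * ((1 + xi) * beta w)); last by ring.
apply: ler_wpM2l; first exact: ltW.
by move: q0 q1; move: ((1 + xi) * beta w) => q; nra.
Qed.

Lemma esymbol_le xi : (esymbol xi <= 8%:E)%E.
Proof.
rewrite esymbolE (_ : 8 = 4 + 4); last by ring.
by rewrite EFinD; apply: leeD; exact: half_symbol_le.
Qed.

Lemma esymbol_ge xi : (1%:E <= esymbol xi)%E.
Proof.
have h0 x : (0 <= half_symbol x)%E.
  by apply: integral_ge0 => w _; rewrite lee_fin symbol_kernel_ge0.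
rewrite esymbolE; have [xi0|xi0] := leP 0 xi.
  by rewrite (le_trans (half_symbol_ge xi0))// leeDl.
by rewrite (@le_trans _ _ (half_symbol (- xi)))// ?leeDr// half_symbol_ge// oppr_ge0 ltW.
Qed.

Definition symbol xi : R := fine (esymbol xi).

Lemma symbolE xi : (symbol xi)%:E = esymbol xi.
Proof.
by rewrite fineK// ge0_fin_numE ?(le_lt_trans (esymbol_le xi)) ?ltry// (le_trans _ (esymbol_ge xi)).
Qed.

Lemma symbol_ge1 xi : 1 <= symbol xi.
Proof. by rewrite -lee_fin symbolE esymbol_ge. Qed.

Lemma symbol_le8 xi : symbol xi <= 8.
Proof. by rewrite -lee_fin symbolE esymbol_le. Qed.

Lemma measurable_symbol : measurable_fun setT symbol.
Proof.
apply/measurable_EFinP.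
rewrite (_ : EFin \o symbol = fubini_G leb (fun z : R * R => (symbol_kernel z.1 z.2)%:E)); last first.
  by apply/funext => xi; rewrite /= symbolE.
apply: measurable_fun_fubini_tonelli_G => /=.
- by apply/measurable_EFinP; exact: measurable_symbol_kernel.
- by move=> z; rewrite lee_fin symbol_kernel_ge0.
Qed.

Lemma integral_beta : (\int[leb]_(w in `[0%R, +oo[) (beta w)%:E = +oo)%E.
Proof.
apply/eqyP => A A0.
have e1 : 1 <= expR A by rewrite -expR0 ler_expR ltW.
(* The endpoint is chosen so that the antiderivative [ln (1 + w)] takes the value [A] there. *)
apply: (@le_trans _ _ (\int[leb]_(w in `[0%R, (expR A - 1)%R]) (beta w)%:E)%E); last first.
  apply: ge0_subset_integral => //.
  - by apply/measurable_EFinP; apply: measurable_funTS; exact: measurable_beta.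
  - by move=> w _; rewrite lee_fin ltW// beta_gt0.
  - by move=> w /=; rewrite !in_itv/= andbT => /andP[].
rewrite (@eq_integral _ _ R leb _ (fun w : R => ((1 + w)^-1)%:E)); last first.
  by move=> w; rewrite inE/= in_itv/= => /andP[w0 _]; rewrite /beta ger0_norm.
have c1 : continuous (fun w : R => 1 + w).
  by move=> w; apply: cvgD; [exact: cvg_cst|exact: cvg_id].
have der w : 0 <= w -> is_derive w 1 (fun w => ln (1 + w)) ((1 + w)^-1).
  move=> w0; have d1 : is_derive w 1 (fun w : R => 1 + w) 1.
    by apply: is_derive_eq; rewrite add0r mulr1.
  have u0 : 0 < 1 + w by lra.
  have := @is_derive1_comp R (@ln R) (fun w => 1 + w) w _ _ (is_derive1_ln u0) d1.
  by rewrite mulr1.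
have cl w : 0 <= w -> ln (1 + u) @[u --> w] --> ln (1 + w).
  by move=> /der[d _]; exact: (differentiable_continuous ((derivable1_diffP _ _).1 d)).
rewrite (@continuous_FTC2 _ _ (fun w => ln (1 + w))).
- by rewrite addr0 ln1 (addrC (expR A)) addrA subrr add0r expRK sube0.
- by rewrite subr_gt0 expR_gt1.
- apply: continuous_in_subspaceT => w; rewrite inE/= in_itv/= => /andP[w0 _].
  by apply: cvgV; [rewrite gt_eqF//; lra|exact: c1].
- split.
  + by move=> w; rewrite in_itv/= => /andP[/ltW/der[]].
  + by apply: cvg_at_right_filter; exact: cl.
  + by apply: cvg_at_left_filter; apply: cl; rewrite subr_ge0.
- by move=> w; rewrite in_itv/= => /andP[/ltW/der[_ H] _]; rewrite derive1E H.
Qed.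

End Symbol.

(** * Coefficients at fixed [w] as Fourier transforms of slices *)

Section SystemSlices.
Context {R : realType}.
Local Notation leb := (@lebesgue_measure R).
Local Notation normc := (@Normc.normc R).
Implicit Types (f fh : R -> R[i]) (x w : R) (p : R -> R).

(** What the two profiles have in common, so that one argument serves both systems; [2] is the
    maximum of [1 + y] and of [1 - y] on the band. *)
Definition band p : Prop :=
  measurable_fun setT p /\ forall y, `|p y| <= 2 * \1_`[-1, 1] y.

Lemma band_le2 p y : band p -> `|p y| <= 2.
Proof. by move=> [_ /(_ y)/le_trans]; apply; rewrite indicE; case: (_ \in _) => /=; lra. Qed.

Lemma L2_band p : band p -> L2 (fun y => (p y)%:C).
Proof.
move=> [mp bp]; apply: (@L2_le _ _ (window 1) 2).
- exact: cmeasurable_real.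
- exact: window_L2.
- by [].
- move=> y; rewrite normc_real (le_trans (bp y))// /window normc_real ger0_norm//.
Qed.

Definition slice_kernel p w xi : R := scale w * p (beta w * (xi - w)).

(** At [x = 0] the character is trivial, so the kernel inherits square integrability from
    [L2_system_hat]. *)
Lemma slice_kernelE p w : (fun xi => (slice_kernel p w xi)%:C) =
  system_hat (fun y => (p y)%:C) (0, w).
Proof.
apply/funext => xi; rewrite /system_hat /slice_kernel/= mulr0 mul0r oppr0 expi0 mulr1.
exact: realcM.
Qed.

Definition slice p fh w : R -> R[i] := fun xi => fh xi * (slice_kernel p w xi)%:C.

Lemma L2_slice_kernel p w : band p -> L2 (fun xi => (slice_kernel p w xi)%:C).
Proof. by move=> bp; rewrite slice_kernelE; exact/L2_system_hat/L2_band. Qed.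

Lemma slice_L1 p fh w : band p -> L2 fh -> L1 (slice p fh w).
Proof. by move=> bp f2; apply: L2_mul_integrable => //; exact: L2_slice_kernel. Qed.

Lemma slice_L2 p fh w : band p -> L2 fh -> L2 (slice p fh w).
Proof.
move=> bp f2; apply: (@L2_le _ _ fh (scale w * 2)) => //.
- exact: cmeasurableM (L2_measurable f2) (L2_measurable (L2_slice_kernel w bp)).
- by rewrite mulr_ge0// scale_ge0.
move=> xi; rewrite Normc.normcM normc_real mulrC; apply: ler_wpM2r; first exact: normc_ge0.
rewrite /slice_kernel normrM (ger0_norm (scale_ge0 w)); apply: ler_wpM2l; first exact: scale_ge0.
exact: band_le2.
Qed.

(** The pairing integrates the slice against a character with the sign opposite to that in
    [fourier]; the two conjugations correct the sign. The factor in front has modulus one and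
    cancels in energies and in products of two coefficients. *)
Lemma inner_system_slice p psi f fh x w : band p ->
  fourierL2 f fh -> fourierL2 psi (fun y => (p y)%:C) ->
  inner f (system psi (x, w)) = expi (- (2 * pi * x * w)) *
    conjc (fourier (fun xi => conjc (slice p fh w xi)) x).
Proof.
move=> bp Ff Fpsi; have f2 := fourierL2_cod Ff.
have s1 : L1 (fun xi => conjc (slice p fh w xi)) by apply: cintegrable_conj; exact: slice_L1.
have si := fourier_integrable x s1.
rewrite (fourierL2_inner Ff (fourierL2_system (x, w) Fpsi)) /inner /fourier.
rewrite -(cintegral_conj si) -cintegralZ; last exact: cintegrable_conj.
apply: eq_cintegral => xi; rewrite /system_hat /slice /slice_kernel realcM.
have E : conjc (expi (- (2 * pi * x * (xi - w)))) =
    expi (- (2 * pi * x * w)) * conjc (expi (- (2 * pi * xi * x))) :> R[i].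
  by rewrite -!expiN -expiD; congr expi; ring.
rewrite !conjcM conjcK E.
have cr (a : R) : conjc a%:C = a%:C :> R[i] by apply: complex_ext; rewrite ?cE//= oppr0.
rewrite !cr.
move: (expi _) (conjc (expi _)) (scale w)%:C (p _)%:C => a b c d; ring.
Qed.

Lemma energy_slice p psi f fh w : band p ->
  fourierL2 f fh -> fourierL2 psi (fun y => (p y)%:C) ->
  (\int[leb]_x (normc (inner f (system psi (x, w))) ^+ 2)%:E = N2 (slice p fh w))%E.
Proof.
move=> bp Ff Fpsi; have f2 := fourierL2_cod Ff.
rewrite -N2_conj -plancherel_L1; last 2 first.
- by apply: cintegrable_conj; exact: slice_L1.
- by apply: L2_conj; exact: slice_L2.
apply: eq_integral => x _; rewrite (inner_system_slice _ _ bp Ff Fpsi).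
by rewrite Normc.normcM normc_expi mul1r normc_conj.
Qed.

Lemma resolution_slice p q psi phi f1 f2 h1 h2 w : band p -> band q ->
  fourierL2 psi (fun y => (p y)%:C) -> fourierL2 phi (fun y => (q y)%:C) ->
  fourierL2 f1 h1 -> fourierL2 f2 h2 ->
  let F x := inner f1 (system psi (x, w)) * conjc (inner f2 (system phi (x, w))) in
  cintegrable leb F /\
  cintegral leb F = cintegral leb (fun xi => slice p h1 w xi * conjc (slice q h2 w xi)).
Proof.
move=> bp bq Fpsi Fphi Ff1 Ff2.
have h12 := fourierL2_cod Ff1; have h22 := fourierL2_cod Ff2.
pose u1 xi := conjc (slice p h1 w xi); pose u2 xi := conjc (slice q h2 w xi).
have u11 : L1 u1 by apply: cintegrable_conj; exact: slice_L1.
have u21 : L1 u2 by apply: cintegrable_conj; exact: slice_L1.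
have u12 : L2 u1 by apply: L2_conj; exact: slice_L2.
have u22 : L2 u2 by apply: L2_conj; exact: slice_L2.
(* Conjugation exchanges the two factors, so [F] is the integrand of the inner product of the
   transforms of [u2] and [u1], in this order. *)
move=> F; have FE x : fourier u2 x * conjc (fourier u1 x) = F x.
  rewrite /F (inner_system_slice _ _ bp Ff1 Fpsi) (inner_system_slice _ _ bq Ff2 Fphi).
  rewrite -/u1 -/u2 conjcM conjcK.
  have := mul_conjc (expi (- (2 * pi * x * w)) : R[i]); rewrite normc_expi expr1n.
  move: (expi _) (conjc (expi _)) (fourier u2 x) (conjc (fourier u1 x)) => e e' a b ee.
  by rewrite mulrACA ee mul1r mulrC.
split.
  apply: (@eq_cintegrable _ _ _ leb _ _ FE); apply: inner_integrable; exact: fourier_L2.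
rewrite -(@eq_cintegral _ _ _ leb _ _ FE); apply: (etrans (plancherel_inner u21 u22 u11 u12)).
by apply: eq_cintegral => xi; rewrite /u1 conjcK mulrC.
Qed.

End SystemSlices.

(** * The reproducing pair and the failure of the Bessel bounds *)

Section NotBessel.
Context {R : realType}.
Local Notation leb := (@lebesgue_measure R).
Local Notation normc := (@Normc.normc R).
Implicit Types (p : R -> R) (A : set R).

Lemma L2_indic A : measurable A -> (leb A < +oo)%E -> L2 (fun xi => (\1_A xi)%:C).
Proof.
move=> mA Aoo; apply/L2P; split; first by apply: cmeasurable_real; exact: measurable_indic.
rewrite /N2 (@eq_integral _ _ R leb _ (fun xi => (\1_A xi)%:E)) => [|xi _].
  by rewrite integral_indic// setIT.
by rewrite normc_real ger0_norm// !indicE; case: (_ \in _); rewrite ?expr1n ?expr0n.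
Qed.

Lemma slice_energy_ge p A w : band p -> measurable A -> leb A = 1%E ->
  (forall xi, A xi -> 1 <= `|p (beta w * (xi - w))|) ->
  ((beta w)%:E <= N2 (slice p (fun xi => (\1_A xi)%:C) w))%E.
Proof.
move=> bp mA A1 pA.
have A2 : L2 (fun xi => (\1_A xi)%:C) by apply: L2_indic; rewrite ?A1 ?ltry.
rewrite (_ : (beta w)%:E = (\int[leb]_xi ((beta w)%:E * (\1_A xi)%:E))%E); last first.
  rewrite ge0_integralZl_EFin; [|exact: measurableT|by move=> xi _; rewrite lee_fin|
    by apply/measurable_EFinP; exact: measurable_indic|exact: ltW (beta_gt0 w)].
  by rewrite integral_indic// setIT [X in (_ * X)%E](_ : _ = 1%E) ?mule1.
apply: ge0_le_integral => //.
- by move=> xi _; rewrite mule_ge0// lee_fin ltW// beta_gt0.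
- by apply/measurable_EFinP; apply: measurable_funM => //; exact: measurable_indic.
- apply/measurable_EFinP; apply: measurable_normc_sqr; apply: L2_measurable.
  exact: slice_L2.
move=> xi _; rewrite -EFinM lee_fin /slice Normc.normcM !normc_real exprMn.
rewrite indicE; case: (boolP (xi \in A)) => [|_]; last by rewrite mulr0 mulr_ge0 ?sqr_ge0.
rewrite inE => /pA p1; rewrite mulr1 normr1 expr1n mul1r /slice_kernel normrM exprMn.
rewrite (ger0_norm (scale_ge0 w)) scale_sqr.
by apply: ler_peMr; [exact: ltW (beta_gt0 w)|exact: exprn_ege1].
Qed.

(** The test function has transform [\1_A]. At each [w] of one half-line its energy in [x] is at
    least [beta w], so Tonelli makes the double integral infinite. The disjunction selects the
    half-line; its second case is stated after the reflection of [w], so that both end in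
    [integral_beta]. *)
Lemma not_bessel p A psi : band p -> measurable A -> leb A = 1%E ->
  (forall w xi, 0 <= w -> A xi -> 1 <= `|p (beta w * (xi - w))|) \/
  (forall w xi, 0 <= w -> A xi -> 1 <= `|p (beta w * (xi + w))|) ->
  fourierL2 psi (fun y => (p y)%:C) -> ~ bessel (leb \x leb)%E (system psi).
Proof.
move=> bp mA A1 pA Fpsi [_ [B [B0 HB]]].
have A2 : L2 (fun xi => (\1_A xi)%:C) by apply: L2_indic; rewrite ?A1 ?ltry.
have [f Ff] := fourierL2_surj A2; have f2 := fourierL2_dom Ff.
have [_ /(_ f f2) ms] := system_weakly_measurable (fourierL2_dom Fpsi).
pose E w := N2 (slice p (fun xi => (\1_A xi)%:C) w).
pose K (z : R * R) := ((normc (inner f (system psi z)) ^+ 2)%:E : \bar R).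
have mK : measurable_fun setT K by apply/measurable_EFinP; exact: measurable_normc_sqr.
have K0 z : (0 <= K z)%E by rewrite lee_fin sqr_ge0.
have EK w : E w = fubini_G leb K w by rewrite /E -(energy_slice _ bp Ff Fpsi).
have mE : measurable_fun setT E.
  rewrite (_ : E = fubini_G leb K); last exact/funext.
  exact: measurable_fun_fubini_tonelli_G.
have E0 w : (0 <= E w)%E by exact: N2_ge0.
have tail (G : R -> \bar R) : measurable_fun setT G -> (forall w, 0 <= G w)%E ->
    (forall w, 0 <= w -> ((beta w)%:E <= G w)%E) -> (\int[leb]_w G w = +oo)%E.
  move=> mG G0 bG; apply/eqP; rewrite -leye_eq -(@integral_beta R).
  apply: (@le_trans _ _ (\int[leb]_(w in `[0%R, +oo[) G w)%E).
    apply: ge0_le_integral => //.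
    - by move=> w _; rewrite lee_fin ltW// beta_gt0.
    - by apply/measurable_EFinP; apply: measurable_funTS; exact: measurable_beta.
    - exact: measurable_funTS.
    - by move=> w /=; rewrite in_itv/= andbT; exact: bG.
  by apply: ge0_subset_integral => //; exact: measurable_funTS.
have Eoo : (\int[leb]_w E w = +oo)%E.
  case: pA => pA; first by apply: tail => // w w0; apply: slice_energy_ge => // xi; exact: pA.
  rewrite -ge0_integral_opp//; apply: tail => //.
    exact: (measurableT_comp mE (@oppr_measurable R setT)).
  move=> w w0; rewrite -(betaN w); apply: slice_energy_ge => // xi Axi.
  by rewrite betaN opprK; exact: pA.
have KE : (\int[(leb \x leb)%E]_z K z = +oo)%E.
  rewrite -Eoo (@fubini_tonelli2 _ _ _ _ _ leb leb K mK K0).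
  by apply: eq_integral => w _; rewrite EK.
have := HB _ f2; rewrite [leLHS](_ : _ = +oo%E); last exact: KE.
by rewrite L2normX// -EFinM leye_eq.
Qed.

End NotBessel.

(** * The resolution operator as an invertible multiplier *)

Section Resolution.
Context {R : realType}.
Local Notation leb := (@lebesgue_measure R).
Local Notation normc := (@Normc.normc R).

(** The real function underlying [psi_hat], which is convertible to its embedding into the complex
    numbers. *)
Definition psi_profile (y : R) : R := (1 + y) * \1_`[-1, 1] y.

Definition phi_profile (y : R) : R := (1 - y) * \1_`[-1, 1] y.

Lemma band_psi : band psi_profile.
Proof.
split.
  by apply: measurable_funM; [exact: measurable_funD|exact: measurable_indic].
move=> y; rewrite /psi_profile indicE; case: (boolP (_ \in _)) => [|_].
  rewrite inE/= in_itv/= !mulr1 => /andP[? ?]; rewrite ler_norml; lra.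
by rewrite !mulr0 normr0.
Qed.

Lemma band_phi : band phi_profile.
Proof.
split.
  by apply: measurable_funM; [exact: measurable_funB|exact: measurable_indic].
move=> y; rewrite /phi_profile indicE; case: (boolP (_ \in _)) => [|_].
  rewrite inE/= in_itv/= !mulr1 => /andP[? ?]; rewrite ler_norml; lra.
by rewrite !mulr0 normr0.
Qed.

Lemma slice_kernelM w xi : slice_kernel psi_profile w xi * slice_kernel phi_profile w xi =
  symbol_kernel w xi.
Proof.
rewrite /slice_kernel /symbol_kernel -scale_sqr /psi_profile /phi_profile.
move: (scale w) => s; move: (_ * (xi - w)) => y; rewrite indicE.
by case: (_ \in _) => /=; ring.
Qed.

Lemma resolution_symbol (psi phi f1 f2 h1 h2 : R -> R[i]) :
  fourierL2 psi psi_hat -> fourierL2 phi phi_hat ->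
  fourierL2 f1 h1 -> fourierL2 f2 h2 ->
  let F w x := inner f1 (system psi (x, w)) * conjc (inner f2 (system phi (x, w))) in
  [/\ forall w, cintegrable leb (F w),
      cintegrable leb (fun w => cintegral leb (F w)) &
      cintegral leb (fun w => cintegral leb (F w)) =
      inner (fun xi => (symbol xi)%:C * h1 xi) h2].
Proof.
move=> Fpsi Fphi Ff1 Ff2 F.
have h12 := fourierL2_cod Ff1; have h22 := fourierL2_cod Ff2.
have HF w := resolution_slice w band_psi band_phi Fpsi Fphi Ff1 Ff2.
pose g xi := h1 xi * conjc (h2 xi).
have gi : cintegrable leb g by exact: inner_integrable.
pose K (z : R * R) := g z.2 * (symbol_kernel z.1 z.2)%:C.
have FK w : cintegral leb (F w) = cintegral leb (fun xi => K (w, xi)).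
  rewrite (HF w).2; apply: eq_cintegral => xi; rewrite /slice /K/= -slice_kernelM.
  rewrite (realcM (slice_kernel psi_profile w xi)).
  rewrite conjcM /g; set c := conjc _%:C.
  have -> : c = (slice_kernel phi_profile w xi)%:C by apply: complex_ext; rewrite ?cE//= oppr0.
  by rewrite mulrACA.
have mg := cintegrable_measurable gi.
have mK : cmeasurable K.
  apply: cmeasurableM; first exact: (cmeasurable_comp measurable_snd mg).
  by apply: cmeasurable_real; exact: measurable_symbol_kernel.
have si xi : leb.-integrable setT (EFin \o (fun w => symbol_kernel w xi)).
  apply/integrableP; split; first by apply/measurable_EFinP; exact: measurable_symbol_kernel1.
  rewrite (@eq_integral _ _ R leb _ (fun w => (symbol_kernel w xi)%:E)) => [|w _].
    exact: le_lt_trans (esymbol_le xi) (ltry _).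
  by rewrite gee0_abs// lee_fin symbol_kernel_ge0.
(* Integrating [w] first bounds the total mass by [8] times the L1 norm of [g], which is a product
   of two L2 functions. *)
have Ki : cintegrable (leb \x leb)%E K.
  apply/cintegrableP; split=> //.
  have mKn : measurable_fun setT (fun z : R * R => (normc (K z))%:E).
    by apply/measurable_EFinP; exact: measurable_normc.
  rewrite (@fubini_tonelli2 _ _ _ _ _ leb leb _ mKn) => [|z]; last by rewrite lee_fin normc_ge0.
  have /cintegrableP[_ goo] := gi.
  apply: (@le_lt_trans _ _ (8%:E * \int[leb]_xi (normc (g xi))%:E)%E); last first.
    by rewrite lte_mul_pinfty// ge0_fin_numE//; apply: integral_ge0 => xi _; rewrite lee_fin normc_ge0.
  rewrite -ge0_integralZl_EFin; [|exact: measurableT|by move=> xi _; rewrite lee_fin normc_ge0|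
    by apply/measurable_EFinP; exact: measurable_normc|by []].
  apply: ge0_le_integral => //.
  - by move=> xi _; apply: integral_ge0 => w _; rewrite lee_fin normc_ge0.
  - apply: (@measurable_fun_fubini_tonelli_G _ _ _ _ _ leb _ mKn) => z; rewrite lee_fin normc_ge0//.
  - apply/measurable_EFinP; apply: measurable_funM => //; exact: measurable_normc.
  move=> xi _; rewrite /fubini_G.
  rewrite (@eq_integral _ _ R leb _ (fun w => (normc (g xi))%:E * (symbol_kernel w xi)%:E)%E) => [|w _].
    rewrite ge0_integralZl_EFin; [|exact: measurableT|by move=> w _; rewrite lee_fin symbol_kernel_ge0|
      by apply/measurable_EFinP; exact: measurable_symbol_kernel1|exact: normc_ge0].
    by rewrite muleC; apply: lee_wpmul2r; [rewrite lee_fin normc_ge0|exact: esymbol_le].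
  by rewrite /K/= Normc.normcM normc_real (ger0_norm (symbol_kernel_ge0 _ _)) EFinM.
split=> [w||]; first by have [] := HF w.
  apply: (@eq_cintegrable _ _ _ leb _ _ (fun w => esym (FK w))).
  exact: (cintegrable_cintegral1 Ki).
rewrite (@eq_cintegral _ _ _ leb _ _ FK).
rewrite (cintegral12_prod Ki) -(cintegral21_prod Ki).
apply: eq_cintegral => xi.
have ck : cintegrable leb (fun w => (symbol_kernel w xi)%:C).
  apply: (cintegrable_le _ (si xi)) => [|w].
    exact: cmeasurable_real (measurable_symbol_kernel1 xi).
  by rewrite normc_real ger0_norm ?symbol_kernel_ge0.
apply: (etrans (cintegralZ (g xi) ck)).
by rewrite cintegral_Re_ge0 mulrC mulrA.
Qed.

(** The bound [symbol_le8] makes the multiplier bounded and [symbol_ge1] does the same for its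
    inverse. The weak formula is Plancherel's identity read against [resolution_symbol]. *)
Lemma system_reproducing_pair (psi phi : R -> R[i]) :
  fourierL2 psi psi_hat -> fourierL2 phi phi_hat ->
  reproducing_pair (system psi) (system phi).
Proof.
move=> Fpsi Fphi; have ms := @measurable_symbol R.
have s0 (xi : R) : 0 < symbol xi by exact: lt_le_trans (symbol_ge1 xi).
have s8 (xi : R) : `|symbol xi| <= 8 by rewrite gtr0_norm// symbol_le8.
have msV : measurable_fun setT (fun xi : R => (symbol xi)^-1).
  rewrite (_ : (fun xi => _) = (fun xi => symbol xi `^ (-1))).
    exact: (measurableT_comp (@measurable_powR R (-1)) ms).
  by apply/funext => xi; rewrite powR_inv1// ltW.
have sV1 (xi : R) : `|(symbol xi)^-1| <= 1.
  by rewrite gtr0_norm ?invr_gt0// invf_le1// symbol_ge1.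
have sVK (xi : R) : symbol xi * (symbol xi)^-1 = 1 by rewrite divff// gt_eqF.
have VsK (xi : R) : (symbol xi)^-1 * symbol xi = 1 by rewrite mulVf// gt_eqF.
have bs := multiplier_bounded_linear ms (ler0n _ 8) s8.
split; [exact: system_weakly_measurable (fourierL2_dom Fpsi)|
  exact: system_weakly_measurable (fourierL2_dom Fphi)|].
exists (multiplier symbol); split; last first.
  split=> //; exists (multiplier (fun xi => (symbol xi)^-1)); split.
    exact: (multiplier_bounded_linear msV ler01 sV1).
  by move=> f f2; split; apply: multiplier_inv; try eassumption.
split=> // f1 f2 _ f12 _ f22 F.
have [h1 Fh1] := fourierL2_ex f12; have [h2 Fh2] := fourierL2_ex f22.
have [Fi cFi ->] := resolution_symbol Fpsi Fphi Fh1 Fh2.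
split=> //; first exact: aeW.
exact: (fourierL2_inner (fourierL2_multiplier ms (ler0n _ 8) s8 Fh1) Fh2).
Qed.

End Resolution.

Theorem mainTheorem3 (R : realType) :
  (exists psi : R -> R[i], fourierL2 psi psi_hat) /\
  (exists phi : R -> R[i], fourierL2 phi phi_hat) /\
  forall psi phi : R -> R[i],
    fourierL2 psi psi_hat -> fourierL2 phi phi_hat ->
    [/\ reproducing_pair (system psi) (system phi),
        ~ bessel (lebesgue_measure \x lebesgue_measure)%E (system psi) &
        ~ bessel (lebesgue_measure \x lebesgue_measure)%E (system phi)].
Proof.
split; first exact: fourierL2_surj (L2_band band_psi).
split; first exact: fourierL2_surj (L2_band band_phi).
have leb1 (a : R) : lebesgue_measure `[a, a + 1]%classic = 1%E.
  by rewrite lebesgue_measure_itv/= lte_fin ltrDl ltr01 -EFinB addrAC subrr add0r.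
have bbound (w : R) : 0 <= w -> 0 <= beta w * w /\ beta w * (1 + w) = 1.
  move=> w0; have b0 := beta_gt0 w; split; first by rewrite mulr_ge0// ltW.
  by rewrite /beta ger0_norm// mulVf// gt_eqF//; lra.
move=> psi phi Fpsi Fphi; split; first exact: system_reproducing_pair.
(* On [A = [0, 1]] and at parameter [- w] with [0 <= w], the argument [y = beta w * (xi + w)] lies
   between [0] and [1], so [1 + y] is at least [1]. *)
- apply: (not_bessel band_psi _ (leb1 0) _ Fpsi) => //; right=> w xi w0.
  rewrite /= in_itv/= add0r => /andP[x0 x1]; have b0 := beta_gt0 w.
  have [_ b1] := bbound _ w0.
  have y0 : 0 <= beta w * (xi + w) by rewrite mulr_ge0 ?addr_ge0// ltW.
  have y1 : beta w * (xi + w) <= 1 by rewrite -[leRHS]b1 ler_pM2l// lerD2r.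
  rewrite /psi_profile indicE mem_set; last by rewrite /= in_itv/= y1 andbT; lra.
  by rewrite mulr1 ger0_norm; lra.
(* The mirror image: on [A = [-1, 0]] and for [0 <= w] the argument lies between [- 1] and [0], so
   [1 - y] is at least [1]. *)
- apply: (not_bessel band_phi _ (leb1 (-1)) _ Fphi) => //; left=> w xi w0.
  rewrite /= in_itv/= addNr => /andP[x0 x1]; have b0 := beta_gt0 w.
  have [_ b1] := bbound _ w0.
  have y0 : beta w * (xi - w) <= 0 by rewrite mulr_ge0_le0 ?subr_le0 ?(le_trans x1)// ltW.
  have y1 : - 1 <= beta w * (xi - w).
    by rewrite -[X in - X]b1 -mulrN ler_pM2l// opprD lerD2r.
  rewrite /phi_profile indicE mem_set; last by rewrite /= in_itv/= y1/=; lra.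
  by rewrite mulr1 ger0_norm; lra.
Qed.
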